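(* Let $\mathcal P$ be an Apollonian circle packing in $\hat{\mathbb C}=\mathbb C\cup\{\infty\}$ and let $C_0\in\mathcal P$. Let $\mathcal P_0$ denote the union of the disks $D_i$ bounded by the circles $C_i\in\mathcal P$ that are tangent to $C_0$. Define the curve $C_\epsilon$ as follows: if $C_0=\partial B(z_0,r_0)$ is a bounded circle which is not the outer circle of a bounded packing, $C_\epsilon=\partial B(z_0,r_0+\epsilon)$; if $\mathcal P$ is bounded and $C_0=\partial B(z_0,r_0)$ is its outer circle, $C_\epsilon=\partial B(z_0,r_0-\epsilon)$; if $C_0$ is a straight line, $C_\epsilon$ is the line parallel to $C_0$ at distance $\epsilon$ on the side of $C_0$ where the packing lies. Let $\mu_\epsilon$ be the Lebesgue (arc-length) probability measure on $C_\epsilon$ (when $C_\epsilon$ is a line, $\mu_\epsilon$ is the normalized Lebesgue measure on the part of $C_\epsilon$ lying over a fixed bounded subinterval of positive length of the line $C_0$). Then $$\lim_{\epsilon\to 0}\mu_\epsilon(\mathcal P_0)=\frac{3}{\pi}.$$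
   Context: An Apollonian circle packing (ACP) is obtained by starting with three mutually tangent circles $C_1,C_2,C_3\subset\hat{\mathbb C}$ (circles through $\infty$ being straight lines), adding the two circles $C_0,C_4$ tangent to all three, and then inductively, for every triple of mutually tangent circles already constructed, adding the remaining circle tangent to all three; the packing is the collection of all circles so obtained. For a circle $C_i$ of the packing, its disk $D_i$ is the open component of $\hat{\mathbb C}\setminus C_i$ (a disk, half-plane, or exterior of a disk) that contains no other circle of the packing. Two circles are tangent if they meet in exactly one point. *)

(* Defs.v *)
From mathcomp Require Import all_boot all_order all_algebra.
From mathcomp.real_closed Require Import complex.
From mathcomp Require Import all_classical all_reals all_analysis.

Set Implicit Arguments.
Unset Strict Implicit.
Unset Printing Implicit Defensive.

Import Order.TTheory GRing.Theory Num.Theory.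
Import numFieldNormedType.Exports.

Local Open Scope classical_set_scope.
Local Open Scope ring_scope.
Local Open Scope complex_scope.

(* The Riemann sphere: [Some z] is the point z of the complex plane and [None]
   is the point at infinity. *)
Definition sphere (R : realType) := option R[i].

Section Circles.
Context {R : realType}.
Implicit Types (z p v : R[i]) (r : R) (A B C D : set (sphere R)).

Definition circle z r : set (sphere R) :=
  [set Some z' | z' in [set z' | Normc.normc (z' - z) = r]].

Definition disk z r : set (sphere R) :=
  [set Some z' | z' in [set z' | Normc.normc (z' - z) < r]].

Definition exterior z r : set (sphere R) :=
  None |` [set Some z' | z' in [set z' | r < Normc.normc (z' - z)]].

(* The line through p with unit direction v, including infinity. *)
Definition line p v : set (sphere R) :=
  None |` [set Some (p + t%:C * v) | t in [set: R]].

(* The points p + (t + i s) v with s > 0, i.e. the open half-plane to the left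
   of the line through p travelled in the direction v. *)
Definition left_half p v : set (sphere R) :=
  [set Some z | z in [set z | 0 < complex.Im ((z - p) / v)]].

Definition is_circle C : Prop :=
  (exists z r, 0 < r /\ C = circle z r) \/
  (exists p v, Normc.normc v = 1 /\ C = line p v).

(* D is one of the two components of the complement of C in the sphere. The
   lines through p with directions v and - v coincide, so the last clause gives
   both half-planes. *)
Definition is_side C D : Prop :=
  [\/ exists z r, [/\ 0 < r, C = circle z r & D = disk z r],
      exists z r, [/\ 0 < r, C = circle z r & D = exterior z r] |
      exists p v, [/\ Normc.normc v = 1, C = line p v
                    & D = left_half p v]].

Definition tangent A B : Prop := exists! x, (A `&` B) x.

(* The last condition rules out three circles that are all tangent at one and
   the same point (such as three parallel lines), for which there is no pair of
   circles tangent to all three. *)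
Definition mutually_tangent A B C : Prop :=
  [/\ tangent A B, tangent B C, tangent A C & A `&` B `&` C = set0].

Inductive generated C1 C2 C3 : set (sphere R) -> Prop :=
| generated1 : generated C1 C2 C3 C1
| generated2 : generated C1 C2 C3 C2
| generated3 : generated C1 C2 C3 C3
| generated_step A B C D :
    generated C1 C2 C3 A -> generated C1 C2 C3 B -> generated C1 C2 C3 C ->
    mutually_tangent A B C ->
    is_circle D -> tangent D A -> tangent D B -> tangent D C ->
    generated C1 C2 C3 D.

Definition apollonian_packing (P : set (set (sphere R))) : Prop :=
  exists C1 C2 C3,
    [/\ is_circle C1, is_circle C2, is_circle C3, mutually_tangent C1 C2 C3
      & P = [set C | generated C1 C2 C3 C]].

Definition is_disk_of (P : set (set (sphere R))) C D : Prop :=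
  is_side C D /\ forall C', P C' -> C' <> C -> ~ C' `<=` D.

Definition tangent_disks (P : set (set (sphere R))) (C0 : set (sphere R)) :
    set (sphere R) :=
  \bigcup_(D in [set D | exists C, [/\ P C, tangent C C0 & is_disk_of P C D]]) D.

(* Every circle of P lies in the closed ball B(z0, r0); this entails that P is
   bounded, and for P containing the boundary of B(z0, r0) it says that this
   boundary is the outer circle of P. *)
Definition is_outer_circle (P : set (set (sphere R))) z0 r0 : Prop :=
  forall C, P C -> C `<=` circle z0 r0 `|` disk z0 r0.

Definition lies_on_left (P : set (set (sphere R))) p v : Prop :=
  forall C, P C -> C `<=` line p v `|` left_half p v.

(* Arc-length probability measure on [circle z r]: the image of the normalized
   Lebesgue measure on [0, 2 pi] under theta |-> z + r exp(i theta). *)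
Definition circle_prob z r A : \bar R :=
  let S : set R := `[0, 2 * pi] `&`
    [set theta | A (Some (z + r%:C * (cos theta +i* sin theta)))] in
  (((2 * pi)^-1)%:E * lebesgue_measure S)%E.

(* Normalized length measure on the segment {p + t v : a <= t <= b}; since v is
   a unit vector, t is an arc-length parameter. *)
Definition segment_prob p v (a b : R) A : \bar R :=
  let S : set R := `[a, b] `&` [set t | A (Some (p + t%:C * v))] in
  (((b - a)^-1)%:E * lebesgue_measure S)%E.

End Circles.

(* Main.v *)
(*
A circle of the sphere is, up to sign, a unit vector of the quadratic form
[x^2 + y^2 - a c]; tangency is [dot v w = -1] for suitable signs. Four mutually tangent
circles form a basis, and the packing is its orbit under the reflections exchanging the
two circles tangent to a triple. The circles tangent to a fixed member C0 are then
indexed by the primitive integer pairs (a, b) up to sign, and the sum of the curvatures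
of C0 and of the circle (a, b) is a quadratic form [F a b]: positive definite if C0 is a
bounded circle, the square of a linear form if C0 is a line.

At distance eps from C0 the disk (a, b) cuts out an arc of length about
[2 eps sqrt (X / F a b - 1)] with [X] of order [2 / eps], so the measure is a sum of
[sqrt (X f (p / q) / q^2 - 1)] over reduced fractions p / q, with f slowly varying.
For f = 1 on an interval of length l and without the coprimality condition that sum is
a Riemann sum for the quarter circle, about [l X pi / 4]; coprimality divides by
[zeta 2 = pi^2 / 6] and yields [l X 3 / (2 pi)]. Integrating f gives the limit 3 / pi.
*)
Require Import Defs.
From mathcomp Require Import all_boot all_order all_algebra.
From mathcomp.real_closed Require Import complex.
From mathcomp Require Import all_classical all_reals all_analysis.
From mathcomp Require Import ring lra zify.
Import Order.TTheory GRing.Theory Num.Theory.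
Import numFieldNormedType.Exports.
Set Implicit Arguments.
Unset Strict Implicit.
Unset Printing Implicit Defensive.
Local Open Scope classical_set_scope.
Local Open Scope ring_scope.
Local Open Scope complex_scope.

Local Notation Re := complex.Re.
Local Notation Im := complex.Im.

(** Three obstacles shape the proof. The pairs (a, b) up to sign form a projective line, whereas the
    estimate for sums over p / q needs a bounded interval and a Lipschitz weight. A bounded circle
    is treated in two charts exchanged by x -> - 1 / x; their integrals are arctangents with total
    pi. For a line, p / q becomes infinite at one point of contact, and a unimodular change of (a,
    b) moves that point off the interval.

    The circles of the packing are bare sets, so orientations have to be recovered: the signs are
    chosen so that the sum of any two distinct vectors of the packing is causal and future-directed.
    This one property makes the disks disjoint and tells which side of each circle is its disk.

    The disks meeting the curve at distance eps change with eps. Since [Num.sqrt] vanishes on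
    negative numbers, a disk that is not reached contributes 0, and every sum may be cut at any
    sufficiently large denominator. *)

Lemma ge0_derive_le (R : realType) (f df : R -> R) (a b : R) : a <= b ->
  (forall x : R, is_derive x (1 : R) f (df x)) -> (forall x, a <= x <= b -> 0 <= df x) ->
  f a <= f b.
Proof.
move=> ab fdf df0.
have cf : {within `[a, b], continuous f}.
  by apply: derivable_within_continuous => x _; case: (fdf x).
have [c] := @MVT_segment R f df a b ab (fun x _ => fdf x) cf.
rewrite in_itv /= => cab /eqP; rewrite subr_eq => /eqP ->.
by rewrite lerDr mulr_ge0 ?subr_ge0 ?df0.
Qed.

Lemma sin_le_id (R : realType) (x : R) : 0 <= x -> sin x <= x.
Proof.
move=> x0; rewrite -subr_ge0.
have := @ge0_derive_le R (id \- sin) (fun x => 1 - cos x) 0 x x0.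
rewrite /= sin0 subrr; apply=> y _.
by rewrite subr_ge0 cos_le1.
Qed.

(** Together with [sin_le_id] this squeezes [x ^- 2] between the squares of cotangent and cosecant,
    and later an arc against its chord. *)
Lemma id_cos_le_sin (R : realType) (x : R) : 0 <= x <= pi / 2 -> x * cos x <= sin x.
Proof.
move=> /andP[x0 xpi]; rewrite -subr_ge0.
have := @ge0_derive_le R (sin \- id \* cos) (fun x => x * sin x) 0 x x0.
rewrite /= sin0 mul0r subrr; apply=> [y|y /andP[y0 yx]].
  by apply: is_derive_eq; rewrite /GRing.scale /=; ring.
rewrite mulr_ge0 // sin_ge0_pi // y0 /=; have := pi_gt0 R; lra.
Qed.

(** * The Basel sum *)

Section Basel.
Context {R : realType}.
Implicit Types (n k : nat).

(* Basel's sum by the duplication [1 / sin^2 x + 1 / cos^2 x = 4 / sin^2 (2 x)], which gives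
   a linear recurrence for the sum over the dyadic fractions of [pi / 2]. *)
Definition csc_sum n : R :=
  \sum_(1 <= k < 2 ^ n) (sin (k%:R * pi / (2 ^+ n.+1)))^-2.

Lemma sin_gt0_dyadic n k : (0 < k < 2 ^ n)%N ->
  0 < sin (k%:R * pi / (2 ^+ n.+1) : R) /\ 0 < (k%:R * pi / (2 ^+ n.+1) : R) < pi / 2.
Proof.
move=> /andP[k0 kn]; set x := _ / _.
have x0 : 0 < x by rewrite divr_gt0 ?mulr_gt0 ?pi_gt0 ?exprn_gt0 ?ltr0n.
have xpi : x < pi / 2.
  rewrite /x ltr_pdivrMr ?exprn_gt0 // exprS mulrA divfK // mulrC ltr_pM2l ?pi_gt0 //.
  by rewrite -natrX ltr_nat.
by rewrite x0 xpi; split => //; apply: sin_gt0_pihalf; rewrite x0.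
Qed.

(** Pairing k with [2 ^ n.+1 - k] exchanges sine and cosine, so each pair gives 4 / sin^2 at the
    doubled angle. The doubled angles are symmetric about pi / 2: they run twice through the angles
    of level n and once through pi / 2 itself. *)
Lemma csc_sum_rec n : csc_sum n.+1 = 4 * csc_sum n + 2.
Proof.
pose x k : R := k%:R * pi / (2 ^+ n.+2).
have pow2 m : (2 : R) ^+ m != 0 by rewrite expf_neq0.
have e2 : (2 ^ n.+1 = 2 ^ n + 2 ^ n)%N by rewrite expnS mul2n addnn.
have sym k : (k <= 2 ^ n.+1)%N -> x (2 ^ n.+1 - k)%N = pi / 2 - x k.
  by move=> kn; rewrite /x natrB // natrX !exprS; field; rewrite ?pow2.
have dbl k : (0 < k < 2 ^ n.+1)%N ->
    (sin (x k))^-2 + (sin (x (2 ^ n.+1 - k)%N))^-2 = 4 * (sin (x k *+ 2))^-2.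
  move=> /andP[k0 kn]; rewrite sym ?(ltnW kn) //.
  rewrite sinB sin_pihalf cos_pihalf mul1r mul0r subr0.
  have [s0 /andP[x0 xpi]] := @sin_gt0_dyadic n.+1 k (introT andP (conj k0 kn)).
  have c0 : 0 < cos (x k) by apply: cos_gt0_pihalf; rewrite (xpi : x k < _) (lt_trans _ x0) // oppr_lt0 divr_gt0 ?pi_gt0.
  rewrite sin_mulr2n -mulr_natr; move: (cos2Dsin2 (x k)) => cs.
  have [s1 c1] := (lt0r_neq0 s0 : sin (x k) != 0, lt0r_neq0 c0).
  have -> : (sin (x k))^-2 + (cos (x k))^-2 =
      (cos (x k) ^+ 2 + sin (x k) ^+ 2) / (sin (x k) ^+ 2 * cos (x k) ^+ 2).
    by field; rewrite s1 c1.
  by rewrite cs; field; rewrite s1 c1.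
have two : csc_sum n.+1 + csc_sum n.+1 = 4 * \sum_(1 <= k < 2 ^ n.+1) (sin (x k *+ 2))^-2.
  rewrite /csc_sum {2}big_nat_rev /= -big_split mulr_sumr; apply: eq_big_nat => k kn.
  by rewrite -dbl // add1n subSS.
have : \sum_(1 <= k < 2 ^ n.+1) (sin (x k *+ 2))^-2 = csc_sum n + csc_sum n + 1 :> R.
  have x2 k : x k *+ 2 = k%:R * pi / (2 ^+ n.+1) :> R.
    by rewrite /x (exprS _ n.+1) -mulr_natr; field; rewrite pow2.
  under eq_bigr => k _ do rewrite x2.
  have p0 : (0 < 2 ^ n)%N by rewrite expn_gt0.
  rewrite (@big_cat_nat _ _ _ (2 ^ n)) //=; last by rewrite e2 leq_addl.
  rewrite [X in _ + X]big_ltn; last by rewrite e2 -addn1 leq_add2l.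
  rewrite -addrA; congr (_ + _).
  have -> : (2 ^ n)%:R * pi / 2 ^+ n.+1 = pi / 2 :> R.
    by rewrite natrX exprS; field; rewrite pow2.
  rewrite sin_pihalf expr1n invr1 addrC; congr (_ + 1).
  rewrite -(add1n (2 ^ n)) big_addn e2 addnK big_nat_rev /csc_sum.
  apply: eq_big_nat => k /andP[k0 kn]; rewrite add1n subSS.
  rewrite -[sin (k%:R * _ / _)]opprK -sinN -sinDpi; congr (sin _ ^- 2).
  rewrite natrD natrB ?(ltnW kn) // natrX !exprS; field; by rewrite pow2.
move=> e; move: two; rewrite e; lra.
Qed.

Lemma csc_sumE n : csc_sum n = (2 / 3) * (4 ^+ n - 1).
Proof.
elim: n => [|n IH]; first by rewrite /csc_sum expn0 big_geq // expr0 subrr mulr0.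
by rewrite csc_sum_rec IH exprS; field.
Qed.

Definition zeta2 n : R := \sum_(1 <= k < n) (k%:R ^- 2).

Lemma zeta2_homo m n : (m <= n)%N -> zeta2 m <= zeta2 n.
Proof.
move=> mn; rewrite /zeta2; have [m0|m1] := posnP m.
  by rewrite m0 big_geq // sumr_ge0.
by rewrite (@big_cat_nat _ _ _ m _ _ _ _ m1 mn) /= lerDl sumr_ge0.
Qed.

(** Sum 1 / sin^2 x - 1 <= 1 / x^2 <= 1 / sin^2 x over the dyadic angles; the ones contribute at
    most [2 ^+ n]. *)
Lemma zeta2_dyadic n : (pi ^+ 2 / 4 ^+ n.+1) * (csc_sum n - 2 ^+ n) <= zeta2 (2 ^ n)
  <= (pi ^+ 2 / 4 ^+ n.+1) * csc_sum n.
Proof.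
have pow m : (2 : R) ^+ m != 0 by rewrite expf_neq0.
have e4 : (4 : R) = 2 ^+ 2 by ring.
have term k : (0 < k < 2 ^ n)%N -> k%:R ^- 2 =
    (pi ^+ 2 / 4 ^+ n.+1) * (k%:R * pi / (2 ^+ n.+1)) ^- 2 :> R.
  move=> /andP[k0 _]; rewrite e4 -!exprM mulnC exprM.
  have := lt0r_neq0 (pi_gt0 R); move: (pi : R) => c c0; field.
  by rewrite c0 pow pnatr_eq0 -lt0n k0.
have c0 : 0 <= pi ^+ 2 / 4 ^+ n.+1 :> R by rewrite divr_ge0 ?sqr_ge0 ?exprn_ge0.
rewrite /zeta2 [X in _ <= X <= _](_ : _ = (pi ^+ 2 / 4 ^+ n.+1) *
  \sum_(1 <= k < 2 ^ n) (k%:R * pi / (2 ^+ n.+1)) ^- 2); last first.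
  by rewrite mulr_sumr; apply: eq_big_nat => k kn; exact: term.
have est k : (0 < k < 2 ^ n)%N -> forall x : R, x = k%:R * pi / (2 ^+ n.+1) ->
    (sin x) ^- 2 - 1 <= x ^- 2 <= (sin x) ^- 2.
  move=> kn x xE; have := sin_gt0_dyadic kn; rewrite -xE => -[s0 /andP[x0 xpi]].
  apply/andP; split; last first.
    by rewrite lef_pV2 ?posrE ?exprn_gt0 // lerXn2r ?nnegrE ?(ltW s0) ?(ltW x0) // sin_le_id // ltW.
  have h : x * cos x <= sin x by apply: id_cos_le_sin; rewrite !ltW.
  have cx : 0 <= cos x by apply: cos_ge0_pihalf; lra.
  have h2 : (x * cos x) ^+ 2 <= sin x ^+ 2.
    by rewrite lerXn2r ?nnegrE ?mulr_ge0 ?(ltW s0) ?(ltW x0).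
  have -> : (sin x) ^- 2 - 1 = (cos x) ^+ 2 / sin x ^+ 2.
    by rewrite cos2sin2; field; rewrite lt0r_neq0.
  by rewrite ler_pdivrMr ?exprn_gt0 // mulrC ler_pdivlMr ?exprn_gt0 // -exprMn mulrC.
apply/andP; split; apply: ler_wpM2l => //; last first.
  by rewrite /csc_sum; apply: ler_sum_nat => k kn; have /andP[] := est k kn _ erefl.
apply: (@le_trans _ _ (\sum_(1 <= k < 2 ^ n) ((sin (k%:R * pi / (2 ^+ n.+1) : R)) ^- 2 - 1))).
  rewrite sumrB -/(csc_sum n) lerB // sumr_const_nat -natrX ler_nat; lia.
by apply: ler_sum_nat => k kn; have /andP[] := est k kn _ erefl.
Qed.

Lemma zeta2_cvg (e : R) : 0 < e ->
  exists n0, forall n, (n0 <= n)%N -> `|pi ^+ 2 / 6 - zeta2 n| <= e.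
Proof.
move=> e0.
have up n : zeta2 n <= pi ^+ 2 / 6.
  apply: (le_trans (zeta2_homo (ltnW (ltn_expl n (isT : (1 < 2)%N))))).
  have /andP[_ /le_trans] := zeta2_dyadic n; apply.
  rewrite csc_sumE (exprS _ n); set q : R := 4 ^+ n.
  have q0 : 0 < q by rewrite exprn_gt0.
  have -> : pi ^+ 2 / (4 * q) * (2 / 3 * (q - 1)) = pi ^+ 2 / 6 - pi ^+ 2 / 6 / q :> R.
    by field; rewrite lt0r_neq0.
  by rewrite gerBl !divr_ge0 ?sqr_ge0 // ltW.
(* The dyadic lower bound misses pi^2 / 6 by at most pi^2 / 2^m, and 2^m exceeds m. *)
pose m := (Num.bound (pi ^+ 2 / e)).
exists (2 ^ m)%N => n mn; rewrite ger0_norm ?subr_ge0 //.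
apply: (@le_trans _ _ (pi ^+ 2 / 6 - zeta2 (2 ^ m))); first by rewrite lerB // zeta2_homo.
have /andP[lo _] := zeta2_dyadic m; rewrite lerBlDr -lerBlDl; apply: le_trans lo.
rewrite csc_sumE (exprS _ m); set p : R := 2 ^+ m.
have -> : 4 ^+ m = p ^+ 2 by rewrite /p -exprM mulnC exprM; congr (_ ^+ _); ring.
have p1 : 1 <= p by rewrite exprn_ege1 // ler1n.
have p0 : 0 < p by apply: lt_le_trans p1.
have pe : pi ^+ 2 / e <= p.
  apply: (@le_trans _ _ m%:R); first by rewrite ltW // archi_boundP // divr_ge0 ?sqr_ge0 // ltW.
  by rewrite /p -natrX ler_nat ltnW // ltn_expl.
have -> : pi ^+ 2 / (4 * p ^+ 2) * (2 / 3 * (p ^+ 2 - 1) - p) =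
   pi ^+ 2 / 6 - pi ^+ 2 / p * (1 / 6 / p + 1 / 4) :> R.
  by field; rewrite lt0r_neq0.
rewrite lerD2l lerN2.
have : pi ^+ 2 / p <= e by rewrite ler_pdivrMr // mulrC -ler_pdivrMr.
have : 1 / 6 / p + 1 / 4 <= 1.
  have : 1 / 6 / p <= 1 / 6 by rewrite ler_pdivrMr // mulrC; nra.
  lra.
have : 0 <= pi ^+ 2 / p by rewrite divr_ge0 ?sqr_ge0 // ltW.
nra.
Qed.

End Basel.

(** * Sums over reduced fractions *)

Section WeightedSums.
Context {R : realType}.
Implicit Types (c : nat -> R) (X Y M e : R) (N d q : nat).

(** [c q] stands for the number of admissible numerators over the denominator q. The square root is
    0 as soon as q^2 >= X, so the value is the same for all N with X <= N^2; [cut] is one such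
    choice. *)
Definition wsum c N X : R := \sum_(1 <= q < N) c q * Num.sqrt (X / q%:R ^+ 2 - 1).

Definition cut X : nat := (Num.truncn X).+1.

Definition lsum c X : R := wsum c (cut X) X.

Definition asymp (f : R -> R) (l : R) : Prop :=
  forall e, 0 < e -> exists X0, forall X, X0 <= X -> `|f X - l * X| <= e * X.

Lemma cut_gt X : X < (cut X)%:R.
Proof. exact: truncnS_gt. Qed.

Lemma cut_sqr X : X <= (cut X)%:R ^+ 2.
Proof.
apply: (le_trans (ltW (cut_gt X))); rewrite expr2 ler_peMl ?ler0n //.
by rewrite ler1n.
Qed.

Lemma sqrt_term0 X q : (0 < q)%N -> X <= q%:R ^+ 2 -> Num.sqrt (X / q%:R ^+ 2 - 1) = 0.
Proof.
move=> q0 Xq; apply: ler0_sqrtr; rewrite subr_le0 ler_pdivrMr ?mul1r //.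
by rewrite exprn_gt0 // ltr0n.
Qed.

Lemma wsum_cut c N N' X : X <= N%:R ^+ 2 -> X <= N'%:R ^+ 2 -> wsum c N X = wsum c N' X.
Proof.
wlog NN : N N' / (N <= N')%N.
  move=> h h1 h2; case: (leqP N N') => [/h|/ltnW /h h']; first exact.
  by rewrite -h'.
move=> XN _; rewrite /wsum; have [N0|N0] := posnP N.
  rewrite N0 in XN *; rewrite big_geq // big_nat big1 // => q /andP[q0 _]; rewrite sqrt_term0 ?mulr0 //.
  by move: XN; rewrite expr0n /= => /le_trans; apply; rewrite sqr_ge0.
rewrite (@big_cat_nat _ _ _ N 1 N') //= [X in _ = _ + X]big_nat [X in _ = _ + X]big1 ?addr0 //.
move=> q /andP[Nq _]; rewrite sqrt_term0 ?mulr0 //; first exact: leq_trans Nq.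
by apply: (le_trans XN); rewrite lerXn2r ?nnegrE ?ler0n // ler_nat.
Qed.

Lemma lsumE c N X : X <= N%:R ^+ 2 -> lsum c X = wsum c N X.
Proof. by move=> h; apply: wsum_cut => //; apply: cut_sqr. Qed.

Lemma ler_wsum c c' N X Y : (forall q, (0 < q)%N -> 0 <= c q <= c' q) -> X <= Y ->
  wsum c N X <= wsum c' N Y.
Proof.
move=> cc XY; apply: ler_sum_nat => q /andP[q0 _].
have /andP[c0 cc'] := cc q q0; apply: ler_pM => //.
rewrite ler_wsqrtr // lerB // ler_wpM2r // invr_ge0 exprn_ge0 //.
Qed.

Lemma ler_lsum c c' X Y : (forall q, (0 < q)%N -> 0 <= c q <= c' q) -> X <= Y ->
  lsum c X <= lsum c' Y.
Proof.
move=> cc XY; rewrite (@lsumE c (cut Y)); last exact: le_trans (cut_sqr Y).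
exact: ler_wsum.
Qed.

Lemma lsum_ge0 c X : (forall q, (0 < q)%N -> 0 <= c q) -> 0 <= lsum c X.
Proof.
move=> c0; rewrite /lsum /wsum big_nat sumr_ge0 // => q /andP[q0 _].
by rewrite mulr_ge0 ?c0 ?sqrtr_ge0.
Qed.

Lemma lsum_le1 c X : X <= 1 -> lsum c X = 0.
Proof.
move=> X1; rewrite (@lsumE c 1); last by rewrite expr1n.
by rewrite /wsum big_geq.
Qed.

(** The square root depends on the denominator m only; writing m = d q, with q the denominator in
    lowest terms, and grouping by d turns X into X / d^2. Products d q >= N contribute 0. *)
Lemma wsum_divisors c n N X :
  (forall q, (0 < q)%N -> n q = \sum_(1 <= d < q.+1 | (d %| q)%N) c d) ->
  X <= N%:R ^+ 2 -> wsum n N X = \sum_(1 <= d < N) wsum c N (X / d%:R ^+ 2).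
Proof.
move=> nE XN; pose g m : R := Num.sqrt (X / m%:R ^+ 2 - 1).
have g0 m : (0 < m)%N -> (N <= m)%N -> g m = 0.
  move=> m0 Nm; apply: sqrt_term0 => //; apply: (le_trans XN).
  by rewrite lerXn2r ?nnegrE ?ler0n // ler_nat.
transitivity (\sum_(1 <= d < N) \sum_(1 <= q < N) \sum_(1 <= m < N)
    (if m == (d * q)%N then c q * g m else 0)); last first.
  apply: eq_big_nat => d /andP[d0 dN]; rewrite /wsum; apply: eq_big_nat => q /andP[q0 qN].
  have dq0 : (0 < d * q)%N by rewrite muln_gt0 d0.
  rewrite -mulrA -invfM -exprMn -natrM -big_mkcond /= -/(g _).
  have [dqN|Ndq] := ltnP (d * q)%N N.
    by rewrite big_nat1_eq dq0 dqN.
  by rewrite big_nat1_eq dq0 ltnNge Ndq /= g0 ?mulr0.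
under eq_bigr => d _ do rewrite exchange_big /=.
rewrite exchange_big /=; apply: eq_big_nat => m /andP[m0 mN].
rewrite exchange_big /= -/(g m) nE // mulr_suml.
rewrite [RHS](@big_cat_nat _ _ _ m.+1 1 N) //= [X in _ = _ + X]big_nat.
rewrite [X in _ = _ + X]big1 ?addr0; last first.
  move=> q /andP[mq _]; rewrite big_nat big1 // => d /andP[d0 _].
  case: eqP => // mE; move: mq; rewrite {1}mE ltnNge leq_pmull //.
rewrite big_mkcond; apply: eq_big_nat => q /andP[q0 qm].
rewrite ltnS in qm.
case: ifP => [/dvdnP[k mk]|ndvd]; last first.
  rewrite big_nat big1 // => d _; case: eqP => // mE.
  by rewrite mE dvdn_mull in ndvd.
have k0 : (0 < k)%N by move: m0; rewrite mk muln_gt0 => /andP[].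
have kN : (k < N)%N by apply: leq_ltn_trans mN; rewrite mk leq_pmulr.
rewrite (bigD1_seq k) ?mem_index_iota ?k0 ?kN ?iota_uniq //= mk eqxx big1 ?addr0 //.
by move=> d dk; rewrite eqn_pmul2r // eq_sym (negbTE dk).
Qed.

Lemma sum_invsqr_tail m N : (0 < m)%N ->
  \sum_(m.+1 <= d < N) (d%:R ^- 2) <= (m%:R)^-1 :> R.
Proof.
move=> m0; have [Nm|mN] := leqP N m.+1; first by rewrite big_geq // invr_ge0.
suff h k : \sum_(m.+1 <= d < m.+1 + k) (d%:R ^- 2) <= (m%:R)^-1 - ((m + k)%:R)^-1 :> R.
  by rewrite -(subnKC (ltnW mN)) (le_trans (h _)) // gerBl invr_ge0.
elim: k => [|k IH]; first by rewrite !addn0 big_geq // subrr.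
rewrite addnS big_nat_recr /=; last by rewrite addSn ltnS leq_addr.
apply: (le_trans (lerD IH (lexx _))); rewrite -addrA lerD2l.
rewrite addSn addnS; move: (m + k)%N (leq_trans m0 (leq_addr k m)) => d d0.
have d0' : 0 < d%:R :> R by rewrite ltr0n.
rewrite addrC lerBlDr -lerBlDl opprK addrC addrC -lerBrDr.
have -> : (d%:R)^-1 - (d.+1%:R)^-1 = (d%:R * d.+1%:R)^-1 :> R.
  by rewrite -natr1; field; rewrite !lt0r_neq0 // ltr_wpDl // ltW.
rewrite lef_pV2 ?posrE ?exprn_gt0 ?mulr_gt0 ?ltr0n //.
by rewrite expr2 ler_pM2r ?ltr0n // ler_nat.
Qed.

(** The term 1 / 4 plus the tail bound 1 / 2. That the sum stays below 1 is what makes the recursion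
    for the error a contraction. *)
Lemma sum_invsqr_ge2 N : \sum_(2 <= d < N) (d%:R ^- 2) <= 3 / 4 :> R.
Proof.
have [N2|N2] := leqP N 2; first by rewrite big_geq.
rewrite big_ltn //; have := @sum_invsqr_tail 2 N isT; lra.
Qed.

Section Primitive.
Variables (c n : nat -> R) (alpha : R).
Hypothesis c_ge0 : forall q, (0 < q)%N -> 0 <= c q.
Hypothesis nE : forall q, (0 < q)%N -> n q = \sum_(1 <= d < q.+1 | (d %| q)%N) c d.
Hypothesis n_asymp : asymp (lsum n) alpha.

Let beta : R := alpha * (6 / pi ^+ 2).
Let err X : R := lsum c X - beta * X.

Lemma primitive_le q : (0 < q)%N -> 0 <= c q <= n q.
Proof.
move=> q0; rewrite c_ge0 // nE // big_mkcond big_nat_recr //= dvdnn lerDr big_nat sumr_ge0 //.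
by move=> d /andP[d0 _]; case: ifP => // _; apply: c_ge0.
Qed.

(** The starting point of the contraction. It has to hold for every positive X, since X / d^2 gets
    small for large d: the sum is 0 up to 1, bounded by its value at [X1] in between, and below
    [lsum n] beyond. *)
Lemma primitive_bound : exists2 M0, 0 < M0 & forall X, 0 < X -> `|err X| <= M0 * X.
Proof.
have [X0 hX0] := n_asymp ltr01; pose X1 := Num.max 1 X0.
pose K := (`|alpha| + 1) * X1.
have X11 : 1 <= X1 by rewrite le_max lexx.
have hX X : X0 <= X -> 0 < X -> lsum n X <= (`|alpha| + 1) * X.
  move=> XX Xp; have := hX0 _ XX; rewrite mul1r => /ler_normlP [_].
  have := ler_norm alpha; have := normr_ge0 alpha; nra.
have K0 : 0 < K by rewrite mulr_gt0 ?ltr_wpDl // (lt_le_trans ltr01).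
exists (K + `|beta|); first by rewrite ltr_wpDr.
move=> X X0'; rewrite /err (le_trans (ler_normB _ _)) // mulrDl lerD //; last by rewrite normrM (gtr0_norm X0').
rewrite ger0_norm ?lsum_ge0 //; have [Xle|X1X] := leP X 1.
  by rewrite lsum_le1 // mulr_ge0 // ltW.
have le1 : lsum c X <= lsum n X by apply: ler_lsum => //; apply: primitive_le.
apply: (le_trans le1); have [XX|XX] := leP X1 X.
  apply: (le_trans (hX X _ X0')); first by apply: le_trans XX; rewrite le_max lexx orbT.
  rewrite ler_pM2r // /K ler_peMr // addr_ge0 //.
have : lsum n X <= lsum n X1.
  by apply: ler_lsum (ltW XX) => q q0; have /andP[h1 h2] := primitive_le q0; rewrite lexx (le_trans h1).
move=> /le_trans; apply; apply: (@le_trans _ _ K); first by apply: hX; rewrite ?le_max ?lexx ?orbT // (lt_le_trans ltr01).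
by rewrite ler_peMr ?(ltW K0) // ltW.
Qed.

Let Lim M := exists X1, forall X, X1 <= X -> `|err X| <= M * X.

(* A contraction in place of Moebius inversion: [lsum n X] is the sum of the
   [lsum c (X / d ^ 2)], and the terms [d >= 2] have total weight at most [3 / 4]. *)
Lemma primitive_contract M : 0 < M -> Lim M -> Lim (7 / 8 * M).
Proof.
move=> M0 [X1 hX1]; have [K K0 hK] := primitive_bound.
(* Three errors [e] come on top of 3 / 4 * M, and 3 / 4 + 3 / 32 < 7 / 8. *)
pose e := M / 32; have e0 : 0 < e by rewrite divr_gt0.
have [X2 hX2] := n_asymp e0.
(* For d up to about [D0] the bound M applies to X / d^2; beyond, only the crude bound K does, but
   its total weight is at most 1 / D0. *)
pose D := (Num.bound (K / e)); pose D0 := D.+1.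
have D0p : 0 < D0%:R :> R by rewrite ltr0n.
have KD : K / D0%:R <= e.
  rewrite ler_pdivrMr // mulrC -ler_pdivrMr //; apply: ltW.
  apply: (lt_le_trans (archi_boundP _)); first by rewrite divr_ge0 // ltW.
  by rewrite ler_nat.
have [N0 hN0] := @zeta2_cvg R (e / (`|beta| + 1)) (divr_gt0 e0 (ltr_wpDl (normr_ge0 _) ltr01)).
pose X3 := Num.max (Num.max 1 X2) (X1 * D0.+1%:R ^+ 2).
exists X3 => X; rewrite !ge_max => /andP[/andP[X1' XX2] XX1].
have Xp : 0 < X by apply: lt_le_trans X1'.
pose N := (maxn (maxn N0 2) (cut X)).
have N2 : (2 <= N)%N by rewrite /N !leq_max orbT.
have XN : X <= N%:R ^+ 2.
  by apply: (le_trans (cut_sqr X)); rewrite lerXn2r ?nnegrE ?ler0n // ler_nat leq_maxr.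
have Xd d : (0 < d)%N -> X / d%:R ^+ 2 <= X.
  by move=> d0; rewrite ler_pdivrMr ?exprn_gt0 ?ltr0n // ler_peMr ?(ltW Xp) // exprn_ege1 // ler1n.
have sumE : \sum_(1 <= d < N) err (X / d%:R ^+ 2) = lsum n X - beta * X * zeta2 N.
  rewrite (@lsumE n N) // (wsum_divisors nE XN) /zeta2 mulr_sumr -sumrB.
  apply: eq_big_nat => d /andP[d0 _]; rewrite /err (@lsumE c N) ?mulrA //.
  exact: le_trans (Xd d d0) XN.
have errE : err X = (lsum n X - alpha * X) + beta * X * (pi ^+ 2 / 6 - zeta2 N)
     - \sum_(2 <= d < N) err (X / d%:R ^+ 2).
  move: sumE; rewrite big_ltn // expr1n divr1 => /(canRL (addrK _)) ->.
  have p0 := lt0r_neq0 (pi_gt0 R); rewrite /beta; move: (pi : R) p0 => p p0.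
  by field.
have b1 : `|beta * X * (pi ^+ 2 / 6 - zeta2 N)| <= e * X.
  rewrite [`|beta * X * _|]normrM [`|beta * X|]normrM (gtr0_norm Xp) mulrAC ler_pM2r //.
  have /hN0 : (N0 <= N)%N by rewrite /N !leq_max leqnn.
  have b0 : 0 < `|beta| + 1 by rewrite ltr_wpDl.
  rewrite ler_pdivlMr // => h; apply: le_trans h.
  by rewrite mulrC ler_wpM2l // lerDl.
have b2 : \sum_(2 <= d < N) `|err (X / d%:R ^+ 2)| <= (M * (3 / 4) + e) * X.
  apply: (@le_trans _ _ (\sum_(2 <= d < N) M * X * d%:R ^- 2 +
      \sum_(2 <= d < N | (D0 < d)%N) K * X * d%:R ^- 2)).
    rewrite [X in _ + X]big_mkcond -big_split /=; apply: ler_sum_nat => d /andP[d2 dN].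
    have d0 : (0 < d)%N by apply: leq_trans d2.
    have d0' : 0 < d%:R ^+ 2 :> R by rewrite exprn_gt0 // ltr0n.
    have [dD|dD] := leqP d D0.+1.
      have : X1 <= X / d%:R ^+ 2.
        rewrite ler_pdivlMr //; have [X1n|X1p] := leP X1 0.
          by apply: (le_trans _ (ltW Xp)); rewrite mulr_le0_ge0 // ltW.
        apply: le_trans XX1; rewrite ler_pM2l // lerXn2r ?nnegrE ?ler0n // ler_nat //.
      move=> /hX1 /le_trans; apply; rewrite mulrA lerDl; case: ifP => // _.
      by rewrite !mulr_ge0 ?invr_ge0 // ?ltW.
    rewrite ifT; last by apply: ltn_trans dD.
    apply: (le_trans (hK _ (divr_gt0 Xp d0'))); rewrite mulrA lerDr.
    by rewrite !mulr_ge0 ?invr_ge0 // ?ltW.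
  rewrite mulrDl lerD //.
    by rewrite -mulr_sumr mulrAC ler_pM2r // ler_wpM2l ?sum_invsqr_ge2 // ltW.
  have -> : \sum_(2 <= d < N | (D0 < d)%N) K * X / d%:R ^+ 2 =
     K * X * \sum_(D0.+1 <= d < N) d%:R ^- 2.
    by rewrite mulr_sumr [RHS](big_nat_widenl _ 2).
  rewrite mulrAC ler_pM2r //; apply: le_trans KD; rewrite ler_wpM2l ?(ltW K0) //.
  exact: sum_invsqr_tail.
rewrite errE (le_trans (ler_normB _ _)) // (le_trans (lerD (ler_normD _ _) (ler_norm_sum _ _ _))) //.
apply: (le_trans (lerD (lerD (hX2 _ XX2) b1) b2)).
rewrite -!mulrDl ler_pM2r // /e; lra.
Qed.

Lemma asymp_primitive : asymp (lsum c) (alpha * (6 / pi ^+ 2)).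
Proof.
have [K K0 hK] := primitive_bound.
have L k : Lim (K * (7 / 8) ^+ k).
  elim: k => [|k IH]; first by exists 1 => X X1; rewrite expr0 mulr1 hK // (lt_le_trans _ X1).
  rewrite exprS mulrCA; apply: primitive_contract IH; by rewrite mulr_gt0 // exprn_gt0.
move=> e e0; have : (K * (7 / 8) ^+ k) @[k --> \oo] --> (K * 0 : R).
  by apply: cvgM; [exact: cvg_cst | apply: cvg_expr; rewrite ger0_norm; lra].
rewrite mulr0 => /cvgrPdist_le /(_ e e0) [k _ /(_ k (leqnn k)) /=].
rewrite sub0r normrN ger0_norm; last by rewrite mulr_ge0 ?exprn_ge0 // ltW.
move=> ke; have [X1 h] := L k; exists (Num.max X1 1) => X.
rewrite ge_max => /andP[/h + X1']; move=> /le_trans; apply.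
by rewrite ler_wpM2r // (le_trans ler01).
Qed.

End Primitive.

End WeightedSums.

(** * The sum over all numerators as a Riemann sum of the quarter circle *)

Section QuarterCircle.
Context {R : realType}.

(** The area under the unit circle between the abscissas 0 and sin t. *)
Let G (t : R) : R := (t + sin t * cos t) / 2.

(** A vertical slice lies between its inscribed and circumscribed rectangles. In the parameter t the
    derivative of the area is cos^2, that of the width is cos, and cosine decreases. *)
Lemma quarter_area_slice (t t' : R) : 0 <= t -> t <= t' -> t' <= pi / 2 ->
  cos t' * (sin t' - sin t) <= G t' - G t <= cos t * (sin t' - sin t).
Proof.
move=> t0 tt tp.
have cosle (x y : R) : 0 <= x -> x <= y -> y <= pi / 2 -> 0 <= cos y <= cos x.
  move=> x0 xy yp; have pp := pi_gt0 R; apply/andP; split.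
    by apply: cos_ge0_pihalf; lra.
  by rewrite leNgt ltr_cos ?in_itv /=; [rewrite -leNgt | lra | lra].
have dG (x : R) : is_derive x (1 : R) (fun y => 2^-1 * (y + sin y * cos y)) (cos x ^+ 2).
  apply: is_derive_eq; rewrite /GRing.scale /=.
  have := cos2Dsin2 x; lra.
apply/andP; split.
- suff : 2^-1 * (t + sin t * cos t) - cos t' * sin t <=
      2^-1 * (t' + sin t' * cos t') - cos t' * sin t' by rewrite /G; lra.
  apply: (@ge0_derive_le R (fun x => 2^-1 * (x + sin x * cos x) - cos t' * sin x)
    (fun x => cos x ^+ 2 - cos t' * cos x) t t' tt) => x /andP[tx xt].
  have /andP[] := cosle x t' (le_trans t0 tx) xt tp; nra.
- suff : cos t * sin t - 2^-1 * (t + sin t * cos t) <=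
      cos t * sin t' - 2^-1 * (t' + sin t' * cos t') by rewrite /G; lra.
  apply: (@ge0_derive_le R (fun x => cos t * sin x - 2^-1 * (x + sin x * cos x))
    (fun x => cos t * cos x - cos x ^+ 2) t t' tt) => x /andP[tx xt].
  have /andP[] := cosle t x t0 tx (le_trans xt tp); nra.
Qed.

(** The terms are sqrt (X - q^2), the ordinates of the circle of radius sqrt X at integer abscissas.
    The ordinate decreases, so the lower and upper sums differ by its value sqrt X at 0. *)
Lemma lsum_id_bounds (X : R) : 0 < X ->
  pi / 4 * X - Num.sqrt X <= lsum (fun q => q%:R) X <= pi / 4 * X.
Proof.
move=> X0; pose Y := Num.sqrt X.
have Y0 : 0 < Y by rewrite sqrtr_gt0.
have YX : Y ^+ 2 = X by rewrite sqr_sqrtr // ltW.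
(* The minimum ends the last slice at the radius, where it is narrower than a full step. *)
pose x (q : nat) : R := Num.min (q%:R / Y) 1.
have x01 q : 0 <= x q <= 1.
  rewrite /x le_min ge_min lexx orbT ler01 !andbT.
  by rewrite divr_ge0 ?(ltW Y0).
have xi q : -1 <= x q <= 1 by have /andP[] := x01 q; lra.
pose t q := asin (x q).
have st q : sin (t q) = x q by rewrite asinK // in_itv /= xi.
have ct q : Y * cos (t q) = Num.sqrt (X - q%:R ^+ 2).
  rewrite cos_asin // -{1}(ger0_norm (ltW Y0)) -sqrtr_sqr YX -sqrtrM ?(ltW X0) //.
  rewrite /x minEle; case: ifPn => [_|]; first by congr Num.sqrt; rewrite -YX; field; rewrite lt0r_neq0.
  rewrite -ltNge ltr_pdivlMr // mul1r => qY.
  rewrite expr1n subrr mulr0 sqrtr0 ler0_sqrtr // subr_le0 -YX lerXn2r ?nnegrE ?ler0n // ltW //.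
have t0 q : 0 <= t q.
  have [//|h] := leP 0 (t q); have /andP[h0 _] := x01 q.
  have tp : - (pi / 2) <= t q by apply: asin_geNpi2.
  have : sin (- t q) > 0 \/ t q = 0.
    left; apply: sin_gt0_pi; have := pi_gt0 R; lra.
  by rewrite sinN st => -[]; lra.
have tp q : t q <= pi / 2 by apply: asin_lepi2.
have xm q : x q <= x q.+1.
  rewrite /x le_min !ge_min lexx orbT andbT ler_pM2r ?invr_gt0 // ler_nat leqnSn //.
have xd q : x q.+1 - x q <= Y^-1.
  rewrite /x -natr1 mulrDl mul1r !minEle; have := invr_gt0 Y; rewrite Y0.
  by move: (q%:R / Y) (Y^-1) => a b b0; do 2 (case: ifPn; rewrite -?ltNge); lra.
have tm q : t q <= t q.+1.
  have [//|h] := leP (t q) (t q.+1).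
  have := xm q; rewrite -!st leNgt ltr_sin ?h // in_itv /=; have := pi_gt0 R.
  - by have := t0 q.+1; have := tp q.+1; lra.
  - by have := t0 q; have := tp q; lra.
have sl q : Num.sqrt (X - q.+1%:R ^+ 2) <= X * (G (t q.+1) - G (t q)) <= Num.sqrt (X - q%:R ^+ 2).
  have /andP[h1 h2] := quarter_area_slice (t0 q) (tm q) (tp q.+1).
  rewrite !st in h1 h2.
  have c0 j : 0 <= cos (t j) by apply: cos_ge0_pihalf; have := t0 j; have := tp j; have := pi_gt0 R; lra.
  rewrite -!ct; apply/andP; split; last first.
    apply: (@le_trans _ _ (X * (cos (t q) * Y^-1))).
      by rewrite ler_pM2l //; apply: (le_trans h2); rewrite ler_wpM2l.
    by rewrite -YX le_eqVlt; apply/orP; left; apply/eqP; field; rewrite lt0r_neq0.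
  apply: le_trans (_ : X * (cos (t q.+1) * (x q.+1 - x q)) <= _); last by rewrite ler_pM2l.
  have [qY|qY] := leP q.+1%:R Y.
    have -> : x q.+1 - x q = Y^-1.
      have q1 : q.+1%:R / Y <= 1 by rewrite ler_pdivrMr // mul1r.
      have q2 : q%:R / Y <= 1 by apply: le_trans q1; rewrite ler_pM2r ?invr_gt0 // ler_nat.
      by rewrite /x (min_idPl q1) (min_idPl q2) -natr1; field; rewrite lt0r_neq0.
    by rewrite -YX le_eqVlt; apply/orP; left; apply/eqP; field; rewrite lt0r_neq0.
  rewrite ct ler0_sqrtr; last by rewrite subr_le0 -YX lerXn2r ?nnegrE ?ltW.
  by rewrite !mulr_ge0 ?subr_ge0 // ltW.
pose N := cut X.
have tN : t N = pi / 2.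
  rewrite /t /x (min_idPr _); last first.
    rewrite ler_pdivlMr // mul1r -(@ler_pXn2r _ 2) ?nnegrE ?ler0n ?(ltW Y0) //.
    by rewrite YX cut_sqr.
  have := @sinK R (pi / 2); rewrite sin_pihalf => -> //.
  by rewrite in_itv /=; have := pi_gt0 R; lra.
have t00 : t 0%N = 0.
  rewrite /t /x mul0r (min_idPl ler01); have := @sinK R 0; rewrite sin0 => -> //.
  by rewrite in_itv /=; have := pi_gt0 R; lra.
have tel : \sum_(0 <= q < N) (X * (G (t q.+1) - G (t q))) = pi / 4 * X.
  by rewrite -mulr_sumr telescope_sumr // tN t00 /G sin_pihalf cos_pihalf sin0; field.
have term q : (0 < q)%N -> q%:R * Num.sqrt (X / q%:R ^+ 2 - 1) = Num.sqrt (X - q%:R ^+ 2).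
  move=> q0; have q0' : 0 < q%:R :> R by rewrite ltr0n.
  rewrite -{1}(ger0_norm (ltW q0')) -sqrtr_sqr -sqrtrM ?sqr_ge0 //.
  by congr Num.sqrt; field; rewrite lt0r_neq0.
have lE : lsum (fun q => q%:R) X = \sum_(1 <= q < N) Num.sqrt (X - q%:R ^+ 2).
  by apply: eq_big_nat => q /andP[q0 _]; apply: term.
rewrite lE -tel; apply/andP; split.
  rewrite lerBlDl [X in _ <= X](_ : _ = \sum_(0 <= q < N) Num.sqrt (X - q%:R ^+ 2)).
    by apply: ler_sum_nat => q _; have /andP[] := sl q.
  by rewrite [RHS]big_ltn // expr0n subr0.
rewrite big_add1; apply: (@le_trans _ _ (\sum_(0 <= q < N) Num.sqrt (X - q.+1%:R ^+ 2))).
  by rewrite [X in _ <= X]big_nat_recr //= lerDl sqrtr_ge0.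
by apply: ler_sum_nat => q _; have /andP[] := sl q.
Qed.

Lemma sqrt_small (e : R) : 0 < e -> exists2 X0 : R, 0 < X0 & forall X, X0 <= X -> Num.sqrt X <= e * X.
Proof.
move=> e0; exists (e ^- 2); first by rewrite invr_gt0 exprn_gt0.
move=> X hX; have X0 : 0 < X by apply: lt_le_trans hX; rewrite invr_gt0 exprn_gt0.
have s0 : 0 < Num.sqrt X by rewrite sqrtr_gt0.
have : e^-1 <= Num.sqrt X.
  rewrite -(ger0_norm (ltW (_ : 0 < e^-1))) ?invr_gt0 // -sqrtr_sqr ler_wsqrtr //.
  by rewrite exprVn.
rewrite -[X in e * X](sqr_sqrtr (ltW X0)) expr2 mulrA => h; rewrite ler_peMl ?(ltW s0) //.
by rewrite -ler_pdivrMl // mulr1.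
Qed.

Lemma asymp_lsum_id : asymp (lsum (fun q => q%:R)) (pi / 4 : R).
Proof.
move=> e e0; have [X0 X0p h] := sqrt_small e0; exists X0 => X hX.
have Xp := lt_le_trans X0p hX.
have /andP[h1 h2] := lsum_id_bounds Xp; have := h X hX.
have := mulr_gt0 e0 Xp; move=> h3 h4; apply/ler_normlP; split; lra.
Qed.

Lemma lsum_linear (c c' : nat -> R) (k X : R) :
  lsum (fun q => c q + k * c' q) X = lsum c X + k * lsum c' X.
Proof.
rewrite /lsum /wsum mulr_sumr -big_split /=; apply: eq_bigr => q _.
by rewrite mulrDl mulrA.
Qed.

(** Compare 1 with [q <= k] + q / k: the first k terms are at most sqrt X each, and the rest is at
    most 1 / k times the quarter circle. This absorbs the rounding error of one integer per
    denominator. *)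
Lemma asymp_lsum_const : asymp (lsum (fun=> 1)) (0 : R).
Proof.
move=> e e0; pose k := (Num.bound (8 / e)).+1.
have k0 : 0 < k%:R :> R by rewrite ltr0n.
have ke : k%:R^-1 <= e / 8.
  rewrite -[e / 8]invrK lef_pV2 ?posrE ?invr_gt0 ?divr_gt0 // invf_div.
  apply: ltW; apply: (lt_le_trans (archi_boundP _)); first by rewrite divr_ge0 // ltW.
  by rewrite ler_nat.
have [X0 X0p h] := sqrt_small (divr_gt0 (divr_gt0 e0 (ltr0n R 2)) k0).
exists X0 => X hX; have Xp := lt_le_trans X0p hX.
rewrite mul0r subr0 ger0_norm; last by apply: lsum_ge0.
have le1 : lsum (fun=> 1) X <= lsum (fun q => (q <= k)%N%:R + k%:R^-1 * q%:R) X.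
  apply: ler_lsum => // q _; rewrite ler01 /=; have [qk|kq] := leqP q k.
    by rewrite lerDl mulr_ge0 ?invr_ge0.
  by rewrite add0r mulrC ler_pdivlMr // mul1r ler_nat ltnW.
apply: (le_trans le1); rewrite lsum_linear.
have /andP[_ h2] := lsum_id_bounds Xp.
have pi4 : pi < 4 :> R by have := pihalf_lt2 R; lra.
have h3 : k%:R^-1 * lsum (fun q => q%:R) X <= e / 2 * X.
  apply: (@le_trans _ _ (e / 8 * (pi / 4 * X))).
    by apply: ler_pM => //; apply: lsum_ge0.
  by rewrite mulrA ler_pM2r //; nra.
have h4 : lsum (fun q => (q <= k)%N%:R) X <= k%:R * Num.sqrt X.
  rewrite /lsum /wsum; apply: (@le_trans _ _ (\sum_(1 <= q < cut X | (q < k.+1)%N) Num.sqrt X)).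
    rewrite [X in _ <= X]big_mkcond; apply: ler_sum_nat => q /andP[q0 _].
    rewrite ltnS; case: (q <= k)%N; rewrite ?mul0r // mul1r ler_wsqrtr //.
    apply: (@le_trans _ _ (X / q%:R ^+ 2)); first by rewrite gerBl.
    by rewrite ler_pdivrMr ?exprn_gt0 ?ltr0n // ler_peMr ?(ltW Xp) // exprn_ege1 // ler1n.
  apply: (@le_trans _ _ (\sum_(1 <= q < k.+1) Num.sqrt X)); last first.
    by rewrite sumr_const_nat subSS subn0 mulr_natl.
  have [ck|ck] := leqP (cut X) k.+1.
    rewrite big_mkcond [X in _ <= X](@big_cat_nat _ _ _ (cut X)) //=.
    apply: ler_wpDr; first by apply: sumr_ge0 => *; apply: sqrtr_ge0.
    by apply: ler_sum_nat => q _; case: ifP => // _; apply: sqrtr_ge0.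
  by rewrite [X in _ <= X](big_nat_widen _ _ (cut X)) // ltnW.
have h6 : k%:R * Num.sqrt X <= e / 2 * X.
  apply: le_trans (_ : k%:R * (e / 2 / k%:R * X) <= _); first by rewrite ler_pM2l // h.
  by rewrite le_eqVlt; apply/orP; left; apply/eqP; field; rewrite lt0r_neq0.
by have := lerD (le_trans h4 h6) h3; lra.
Qed.

End QuarterCircle.

(** * Reduced fractions in an interval *)

Section IntervalCount.
Context {R : realType}.
Implicit Types (u v w : R) (q : nat).

(** Half-open, so that adjacent intervals split without overlap. *)
Definition ints u v : set int := [set p | u < p%:~R <= v].

Definition fracs u v q : set int := [set p | ints (u * q%:R) (v * q%:R) p /\ coprime `|p| q].

Lemma intsE u v : ints u v =
  [set (Num.floor u + 1 + k%:Z) | k in `I_(`|(Num.max 0 (Num.floor v - Num.floor u))%R|%N)].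
Proof.
apply/seteqP; split=> [p /= /andP[]|_ /= [k + <-]].
  rewrite -floor_lt_int -floor_ge_int; move: (Num.floor u) (Num.floor v) => a b up pv.
  have ab : 0 <= b - a by lia.
  exists (`|(p - (a + 1))%R|%N) => /=; last by lia.
  by rewrite (max_idPr ab); lia.
rewrite /ints /= -floor_lt_int -floor_ge_int.
move: (Num.floor u) (Num.floor v) => a b.
by have [ab|ab] := leP 0 (b - a); lia.
Qed.

Lemma finite_ints u v : finite_set (ints u v).
Proof. by rewrite intsE; apply: finite_image; apply: finite_II. Qed.

Lemma finite_fracs u v q : finite_set (fracs u v q).
Proof. by apply: (@sub_finite_set _ _ (ints (u * q%:R) (v * q%:R))) => [p []|]; [|apply: finite_ints]. Qed.

Definition icount (A : set int) : R := \sum_(p \in A) (1 : R).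

Lemma icount_ints u v : u <= v -> `|icount (ints u v) - (v - u)| <= 1.
Proof.
move=> uv; have fl : (Num.floor u <= Num.floor v)%R by apply: le_floor.
have -> : icount (ints u v) = (Num.floor v - Num.floor u)%:~R.
  rewrite /icount intsE (reindex_fsbig (fun k : nat => Num.floor u + 1 + k%:Z)
     `I_(`|(Num.max 0 (Num.floor v - Num.floor u))%R|%N)) /=.
    rewrite -(fsbig_ord _ _ (fun=> 1)) sumr_const card_ord.
    rewrite (max_idPr _) ?subr_ge0 // -[X in _ = X%:~R](gez0_abs (_ : 0 <= _)) ?subr_ge0 //.
  by split => // k l _ _ /= /addrI [].
rewrite rmorphB /=; have := ge_floor u; have := ge_floor v.
have := floorD1_gt u; have := floorD1_gt v; rewrite !rmorphD /=.
move=> h1 h2 h3 h4; apply/ler_normlP; split; lra.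
Qed.

(** Classify p by the denominator [den p] of p / q in lowest terms; for q = m d, the map p -> p m is
    a bijection from the reduced numerators over d onto the class of d. *)
Lemma icount_fracs_divisors u v q : (0 < q)%N ->
  icount (ints (u * q%:R) (v * q%:R)) =
  \sum_(1 <= d < q.+1 | (d %| q)%N) icount (fracs u v d).
Proof.
move=> q0; pose B := ints (u * q%:R) (v * q%:R).
pose den (p : int) := (q %/ gcdn `|p| q)%N.
transitivity (\sum_(1 <= d < q.+1 | (d %| q)%N) \sum_(p \in B) (if den p == d then 1 else 0 : R)).
  rewrite /icount !(fsbig_finite _ _ (finite_ints _ _)) /=.
  under [RHS]eq_bigr => d _ do rewrite (fsbig_finite _ _ (finite_ints _ _)) /=.
  rewrite exchange_big /=; apply: eq_bigr => p _.
  have dq : (den p %| q)%N by apply/dvdnP; exists (gcdn `|p| q); rewrite mulnC divnK ?dvdn_gcdr.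
  have d0 : (0 < den p)%N by rewrite /den divn_gt0 ?gcdn_gt0 ?q0 ?orbT // dvdn_leq ?dvdn_gcdr.
  rewrite big_mkcond (bigD1_seq (den p)) ?iota_uniq ?mem_index_iota ?d0 //=; last by rewrite ltnS dvdn_leq.
  by rewrite dq eqxx big1 ?addr0 // => d dn; case: ifP => // _; rewrite eq_sym (negbTE dn).
rewrite big_mkcond [RHS]big_mkcond; apply: eq_big_nat => d /andP[d0 _]; case: ifP => // dq.
transitivity (\sum_(p \in B `&` [set p | den p == d]) (1 : R)).
  rewrite [RHS]fsbig_mkcondr; apply: eq_fsbigr => p _.
  by case: ifPn => h; [rewrite ifT // inE|rewrite ifF //; apply/negP; rewrite inE /= (negbTE h)].
rewrite /icount.
have [m qE] : exists m, q = (m * d)%N by case/dvdnP: dq => m ->; exists m.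
have m0 : (0 < m)%N by move: q0; rewrite qE muln_gt0 => /andP[].
have m0' : 0 < m%:R :> R by rewrite ltr0n.
rewrite (reindex_fsbig (fun p : int => p * m%:Z) (fracs u v d)) //; split.
- move=> p [/andP[up pv] cop]; split => /=.
    rewrite /B /ints /= qE natrM rmorphM /= ![_ * (m%:R * _)]mulrCA ![_ * m%:~R]mulrC.
    by rewrite ltr_pM2l // ler_pM2l // up pv.
  have gE : gcdn `|(p * m%:Z)%R| q = m.
    by rewrite qE abszM absz_nat [(`|p| * m)%N]mulnC -muln_gcdr (eqP cop) muln1.
  by rewrite /den gE qE mulKn.
- by move=> p p' _ _ /= /(@mulIf _ m%:Z); apply; rewrite eqz_nat -lt0n.
- move=> p [/andP[up pv] /eqP dE]; rewrite /den in dE.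
  have gE : gcdn `|p| q = m.
    have := divnK (dvdn_gcdr `|p| q); rewrite dE {2}qE [(m * d)%N]mulnC => /eqP.
    by rewrite eqn_pmul2l // => /eqP.
  have mp : (m %| `|p|)%N by rewrite -gE dvdn_gcdl.
  have mp' : (m%:Z %| p)%Z by rewrite dvdzE.
  exists (p %/ m%:Z)%Z; last by rewrite /= divzK.
  have pE : p = (p %/ m%:Z)%Z * m%:Z by rewrite divzK.
  set p' := (p %/ m%:Z)%Z in pE *; split.
    move: up pv; rewrite /ints /= pE qE natrM rmorphM /= ![_ * (m%:R * _)]mulrCA ![_ * m%:~R]mulrC.
    by rewrite ltr_pM2l // ler_pM2l // => -> ->.
  move: gE; rewrite pE qE abszM absz_nat [(`|p'| * m)%N]mulnC -muln_gcdr => /eqP.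
  by rewrite -{2}[m]muln1 eqn_pmul2l.
Qed.

(** The quarter circle pi / 4 times 6 / pi^2. *)
Definition kappa : R := 3 / (2 * pi).

Lemma icount_ge0 (A : set int) : 0 <= icount A.
Proof. by apply: fsumr_ge0. Qed.

(** An interval of length (v - u) q contains that many integers up to an error of 1, which is
    negligible by [asymp_lsum_const]; then pass to reduced fractions. *)
Lemma asymp_fracs u v : u <= v -> asymp (lsum (fun q => icount (fracs u v q))) ((v - u) * kappa).
Proof.
move=> uv; have -> : (v - u) * kappa = (v - u) * (pi / 4) * (6 / pi ^+ 2).
  by rewrite /kappa; have := lt0r_neq0 (pi_gt0 R); move: (pi : R) => p p0; field.
apply: (@asymp_primitive R _ (fun q => icount (ints (u * q%:R) (v * q%:R)))).
- by move=> q _; apply: icount_ge0.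
- by move=> q q0; apply: icount_fracs_divisors.
move=> e e0; pose k := v - u; have k0 : 0 <= k by rewrite subr_ge0.
have e1 : 0 < e / 2 / (k + 1) by rewrite !divr_gt0 // ltr_wpDl.
have [X1 h1] := @asymp_lsum_id R _ e1.
have [X2 h2] := @asymp_lsum_const R (e / 2) (divr_gt0 e0 (ltr0n R 2)).
exists (Num.max 1 (Num.max X1 X2)) => X; rewrite !ge_max => /andP[X1' /andP[/h1 hX1 /h2 hX2]].
have Xp : 0 < X by apply: lt_le_trans X1'.
have b1 : `|lsum (fun q => icount (ints (u * q%:R) (v * q%:R))) X - k * lsum (fun q => q%:R) X|
    <= lsum (fun=> 1) X.
  rewrite /lsum /wsum mulr_sumr -sumrB (le_trans (ler_norm_sum _ _ _)) //.
  apply: ler_sum => q _; rewrite mulrA -mulrBl normrM [`|Num.sqrt _|]ger0_norm ?sqrtr_ge0 //.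
  rewrite ler_wpM2r ?sqrtr_ge0 // /k mulrBl; apply: icount_ints.
  by rewrite ler_wpM2r.
rewrite mul0r subr0 in hX2.
have b2 : lsum (fun=> 1) X <= e / 2 * X by apply: le_trans hX2; apply: ler_norm.
have b3 : `|k * lsum (fun q => q%:R) X - k * (pi / 4) * X| <= e / 2 * X.
  rewrite -mulrA -mulrBr normrM (ger0_norm k0).
  apply: (@le_trans _ _ (k * (e / 2 / (k + 1) * X))); first by rewrite ler_wpM2l.
  rewrite mulrA ler_pM2r // mulrCA ler_piMr ?divr_ge0 ?(ltW e0) //.
  by rewrite ler_pdivrMr ?mul1r ?lerDl // ltr_wpDl.
rewrite -/k (le_trans (ler_distD (k * lsum (fun q => q%:R) X) _ _)) //.
by have := lerD (le_trans b1 b2) b3; lra.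
Qed.

Implicit Types (f sg : R -> R) (N : nat).

(** When 1 / f (p / q) is F / q^2 for a quadratic form F, the square root is sqrt (X / F - 1). *)
Definition psum u v f N (X : R) : R := \sum_(1 <= q < N) \sum_(p \in fracs u v q)
  Num.sqrt (X * f (p%:~R / q%:R) / q%:R ^+ 2 - 1).

Lemma fracs_frac u v q p : (0 < q)%N -> fracs u v q p -> u < p%:~R / q%:R <= v.
Proof.
move=> q0 [/andP[h1 h2] _]; have q0' : 0 < q%:R :> R by rewrite ltr0n.
by rewrite ltr_pdivlMr // ler_pdivrMr // h1 h2.
Qed.

Lemma ler_fsum (I : choiceType) (A : set I) (F G : I -> R) : finite_set A ->
  (forall i, A i -> F i <= G i) -> \sum_(i \in A) F i <= \sum_(i \in A) G i.
Proof.
move=> fA h; rewrite !(fsbig_finite _ _ fA) /= big_seq [X in _ <= X]big_seq.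
by apply: ler_sum => i; rewrite in_fset_set // inE; apply: h.
Qed.

Lemma psum_const u v (c : R) N X : psum u v (fun=> c) N X = wsum (fun q => icount (fracs u v q)) N (X * c).
Proof. by apply: eq_bigr => q _; rewrite /icount mulr_fsuml; apply: eq_fsbigr => p _; rewrite mul1r. Qed.

Lemma ler_psum u v f g N X : 0 <= X -> (forall x, u < x <= v -> f x <= g x) ->
  psum u v f N X <= psum u v g N X.
Proof.
move=> X0 fg; apply: ler_sum_nat => q /andP[q0 _]; apply: ler_fsum; first exact: finite_fracs.
move=> p pf; rewrite ler_wsqrtr // lerB // ler_wpM2r ?invr_ge0 ?exprn_ge0 // ler_wpM2l //.
by apply: fg; apply: fracs_frac pf.
Qed.

Lemma psum_split u v w f N X : u <= v -> v <= w ->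
  psum u w f N X = psum u v f N X + psum v w f N X.
Proof.
move=> uv vw; rewrite /psum -big_split /=; apply: eq_bigr => q _.
rewrite -fsbigU; last 3 first.
- exact: finite_fracs.
- exact: finite_fracs.
- by move=> p [[/andP[_ h1] _] [/andP[h2 _] _]]; move: (le_lt_trans h1 h2); rewrite ltxx.
apply: eq_fsbigl; apply/seteqP; split=> [p [/andP[h1 h2] c]|p [] [/andP[h1 h2] c]].
- have [h|h] := leP p%:~R (v * q%:R); [left|right]; split => //; apply/andP; split => //.
- by split => //; apply/andP; split => //; apply: (le_trans h2); rewrite ler_wpM2r.
- by split => //; apply/andP; split => //; apply: le_lt_trans h1; rewrite ler_wpM2r.
Qed.

(** * Sums with a slowly varying weight *)

Section Core.
Variables (A B m M K : R) (f sg : R -> R).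
Hypothesis m0 : 0 < m.
Hypothesis K0 : 0 <= K.
Hypothesis fm : forall x, A <= x <= B -> m <= f x <= M.
Hypothesis fK : forall x y, A <= x <= B -> A <= y <= B -> `|f x - f y| <= K * `|x - y|.
Hypothesis sgK : forall x y, A <= x -> x <= y -> y <= B ->
  `|sg y - sg x - (y - x) * f x| <= K * (y - x) ^+ 2.

(** Here [sg] is an antiderivative of [f], encoded by a quadratic Taylor bound. The error is
    proportional to v - u so that it adds up over adjacent intervals; [M + 1] leaves room for a
    constant slightly above [f]. *)
Let good e u v := exists X0, forall X N, X0 <= X -> X * (M + 1) <= N%:R ^+ 2 ->
  `|psum u v f N X - kappa * (sg v - sg u) * X| <= e * (v - u) * X.

(** [psum] is monotone in the weight, and on a short interval the weight lies between the constants
    f u - t and f u + t, whose sums are known from [asymp_fracs]. *)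
Lemma psum_local (e : R) : 0 < e -> exists2 d : R, 0 < d &
  forall u v, A <= u -> u < v -> v <= B -> v - u <= d -> good e u v.
Proof.
move=> e0; have kp : 0 < kappa by rewrite divr_gt0 ?mulr_gt0 ?pi_gt0.
(* The three bounds on t = K (v - u) keep the upper constant below M + 1, the lower one positive,
   and kappa * t below e / 8. *)
pose d : R := Num.min (Num.min 1 (m / 2)) (e / (8 * kappa)) / (K + 1).
have K1 : 0 < K + 1 by rewrite ltr_wpDl.
have d0 : 0 < d.
  by rewrite divr_gt0 // !lt_min ltr01 /= divr_gt0 //= divr_gt0 // mulr_gt0.
exists d => // u v Au uv vB vud.
have Kd : [/\ K * (v - u) <= 1, K * (v - u) <= m / 2 & K * (v - u) <= e / (8 * kappa)].
  have : K * (v - u) <= Num.min (Num.min 1 (m / 2)) (e / (8 * kappa)).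
    apply: (@le_trans _ _ ((K + 1) * d)); last by rewrite /d mulrC divfK ?lt0r_neq0.
    by apply: ler_pM => //; rewrite ?subr_ge0 ?(ltW uv) // lerDl.
  by rewrite !le_min => /andP[/andP[]].
case: Kd; set t := K * (v - u) => t1 tm te.
have t0 : 0 <= t by rewrite mulr_ge0 // subr_ge0 ltW.
have tE0 : t = K * (v - u) by [].
clearbody t.
have uAB : A <= u <= B by rewrite Au /= (le_trans (ltW uv)).
have /andP[fum fuM] := fm uAB.
pose fp := f u + t; pose fn := f u - t.
have fn0 : 0 < fn by rewrite /fn; have := m0; lra.
have fp0 : 0 < fp by rewrite /fp; have := m0; lra.
have fpM : fp <= M + 1 by rewrite /fp; lra.
have fx x : u < x <= v -> fn <= f x <= fp.
  move=> /andP[ux xv].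
  have := fK uAB (_ : A <= x <= B); rewrite (le_trans Au (ltW ux)) (le_trans xv vB) => /(_ isT).
  have : K * `|u - x| <= t by rewrite tE0 ler_wpM2l // ler0_norm ?subr_le0 ?(ltW ux) // opprB lerB.
  by move=> h1 h2; have := le_trans h2 h1 => /ler_normlP []; rewrite /fn /fp; lra.
pose e' := e / 2 * (v - u) / (M + 1).
have M1 : 0 < M + 1 by apply: lt_le_trans fpM.
have vu0 : 0 < v - u by rewrite subr_gt0.
have e'0 : 0 < e' by rewrite divr_gt0 // mulr_gt0 // divr_gt0.
have [Y0 hY] := asymp_fracs (ltW uv) e'0.
exists (Num.max 1 (Num.max 0 Y0 / fn)) => X N; rewrite ge_max => /andP[X1 XY] XN.
have X0 : 0 < X by apply: lt_le_trans X1.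
have Yn : Y0 <= X * fn.
  by move: XY; rewrite ler_pdivrMr // => /(le_trans _); apply; rewrite le_max lexx orbT.
have Yp : Y0 <= X * fp by apply: (le_trans Yn); rewrite ler_pM2l // /fn /fp; lra.
have cutp : X * fp <= N%:R ^+ 2 by apply: le_trans XN; rewrite ler_pM2l.
have cutn : X * fn <= N%:R ^+ 2 by apply: le_trans cutp; rewrite ler_pM2l // /fn /fp; lra.
have up : psum u v f N X <= lsum (fun q => icount (fracs u v q)) (X * fp).
  rewrite (lsumE _ cutp) -psum_const; apply: ler_psum => [|x /fx /andP[]//]; exact: ltW.
have lo : lsum (fun q => icount (fracs u v q)) (X * fn) <= psum u v f N X.
  rewrite (lsumE _ cutn) -psum_const; apply: ler_psum => [|x /fx /andP[]//]; exact: ltW.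
have /ler_normlP [_ hp] := hY _ Yp.
have /ler_normlP [hn _] := hY _ Yn.
have e'X g : 0 < g -> g <= M + 1 -> e' * (X * g) <= e / 2 * (v - u) * X.
  move=> g0 gM; rewrite /e' mulrAC ler_pdivrMr // [_ * X * _]mulrAC -!mulrA ler_pM2l ?divr_gt0 //.
  by rewrite !ler_pM2l ?invr_gt0 // [X * g]mulrC ler_pM2r.
have e'p := e'X _ fp0 fpM.
have e'n : e' * (X * fn) <= e / 2 * (v - u) * X by apply: e'X => //; rewrite /fn; lra.
have /ler_normlP [s1 s2] := sgK Au (ltW uv) vB.
have tE : K * (v - u) ^+ 2 = (v - u) * t by rewrite tE0; ring.
rewrite tE in s1 s2.
have kX : 0 < kappa * X by rewrite mulr_gt0.
have kt : kappa * t <= e / 8.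
  by rewrite mulrC -ler_pdivlMr //; move: te; rewrite invfM mulrA.
have ktX : kappa * t * ((v - u) * X) <= e / 8 * ((v - u) * X) by rewrite ler_pM2r // mulr_gt0.
have q1 : kappa * X * (sg v - sg u - (v - u) * f u) <= kappa * X * ((v - u) * t) by rewrite ler_pM2l.
have q2 : kappa * X * (- (sg v - sg u - (v - u) * f u)) <= kappa * X * ((v - u) * t) by rewrite ler_pM2l.
have evX : 0 < e * ((v - u) * X) by rewrite !mulr_gt0.
clear - up lo hp hn e'p e'n ktX q1 q2 evX.
rewrite /fp /fn in up lo hp hn e'p e'n *.
apply/ler_normlP; split; lra.
Qed.

Lemma psum_asymp (e : R) u v : 0 < e -> A <= u -> u <= v -> v <= B -> good e u v.
Proof.
move=> e0; have [d d0 loc] := psum_local e0.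
have [n] : exists n : nat, v - u <= n%:R * d.
  exists (Num.bound (`|v - u| / d)); rewrite -ler_pdivrMr // ltW //.
  apply: le_lt_trans (archi_boundP _); first by rewrite ler_pM2r ?invr_gt0 // ler_norm.
  by rewrite divr_ge0 // ltW.
elim: n u => [|n IH] u.
  rewrite mul0r => h _ uv _; have -> : v = u by lra.
  exists 1 => X N X1 _; rewrite !subrr !mulr0 !mul0r subr0 [psum _ _ _ _ _]big1 ?normr0 //.
  move=> q _; rewrite (_ : fracs u u q = set0) ?fsbig_set0 //.
  by apply/seteqP; split=> // p [/andP[h1 h2]]; move: (lt_le_trans h1 h2); rewrite ltxx.
rewrite -natr1 mulrDl mul1r => h Au uv vB.
have [vd|vd] := leP (v - u) d.
  move: uv; rewrite le_eqVlt => /orP[/eqP e1|uv]; last exact: loc.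
  apply: IH => //; last by rewrite e1.
  by have := mulr_ge0 (ler0n R n) (ltW d0); lra.
pose w := u + d.
have [uw [wv [wB Aw]]] : u < w /\ w <= v /\ w <= B /\ A <= w by rewrite /w; lra.
have wd : w - u <= d by rewrite /w; lra.
have vw : v - w <= n%:R * d by rewrite /w; lra.
have [X1 h1] := loc u w Au uw wB wd.
have [X2 h2] := IH w vw Aw wv vB.
exists (Num.max X1 X2) => X N; rewrite ge_max => /andP[XX1 XX2] XN.
rewrite (@psum_split u w v) ?(ltW uw) //.
have := h1 X N XX1 XN; have := h2 X N XX2 XN.
move: (psum w v f N X) (psum u w f N X) => a b /ler_normlP [k1 k2] /ler_normlP [k3 k4].
by apply/ler_normlP; split; lra.
Qed.

End Core.

End IntervalCount.

(** * Circles as unit vectors *)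

Section Vectors.
Context {R : realType}.

(* [Vec a x y c] stands for the circle [a |z|^2 - 2 (x Re z + y Im z) + c = 0], oriented by the
   sign of the left-hand side, see [fz] below. *)
Record vec := Vec { va : R; vx : R; vy : R; vc : R }.

Implicit Types (v w : vec).

Definition dot v w : R := vx v * vx w + vy v * vy w - (va v * vc w + vc v * va w) / 2.

Definition lin (s : R) v (t : R) w : vec :=
  Vec (s * va v + t * va w) (s * vx v + t * vx w)
      (s * vy v + t * vy w) (s * vc v + t * vc w).

Definition opp v := Vec (- va v) (- vx v) (- vy v) (- vc v).

Lemma vecP v w : va v = va w -> vx v = vx w -> vy v = vy w -> vc v = vc w -> v = w.
Proof. by case: v w => ? ? ? ? [? ? ? ?] /= -> -> -> ->. Qed.

Lemma dotC v w : dot v w = dot w v.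
Proof. by rewrite /dot; ring. Qed.

Lemma dot_linl s v t w (d : vec) : dot (lin s v t w) d = s * dot v d + t * dot w d.
Proof. by rewrite /dot /=; ring. Qed.

Lemma dot_linr s v t w (d : vec) : dot d (lin s v t w) = s * dot d v + t * dot d w.
Proof. by rewrite /dot /=; ring. Qed.

Lemma dot_oppl v w : dot (opp v) w = - dot v w.
Proof. by rewrite /dot /=; ring. Qed.

Lemma dot_oppr v w : dot v (opp w) = - dot v w.
Proof. by rewrite /dot /=; ring. Qed.

Lemma oppK v : opp (opp v) = v.
Proof. by apply: vecP => /=; rewrite opprK. Qed.

Definition i0 : 'I_4 := @Ordinal 4 0 isT.
Definition i1 : 'I_4 := @Ordinal 4 1 isT.
Definition i2 : 'I_4 := @Ordinal 4 2 isT.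
Definition i3 : 'I_4 := @Ordinal 4 3 isT.

Lemma ord4_ind (A : 'I_4 -> Prop) : A i0 -> A i1 -> A i2 -> A i3 -> forall i, A i.
Proof.
by move=> ? ? ? ? [[|[|[|[|//]]]] h]; [have -> : Ordinal h = i0 | have -> : Ordinal h = i1
  | have -> : Ordinal h = i2 | have -> : Ordinal h = i3]; rewrite //; apply: val_inj.
Qed.

Lemma sum_ord4 (F : 'I_4 -> R) : \sum_i F i = F i0 + F i1 + F i2 + F i3.
Proof.
rewrite !big_ord_recl big_ord0 addr0 !addrA.
by congr (F _ + F _ + F _ + F _); apply: val_inj.
Qed.

Definition quad := 'I_4 -> vec.
Implicit Types (q : quad).

(** A Descartes configuration. The Gram matrix is 2 I - J, with J the matrix of ones, and its square
    is 4 I. *)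
Definition desc q : Prop := forall i j, dot (q i) (q j) = if i == j then 1 else -1.

Definition comb (k0 k1 k2 k3 : R) q : vec :=
  let c f := k0 * f (q i0) + k1 * f (q i1) + k2 * f (q i2) + k3 * f (q i3) in
  Vec (c va) (c vx) (c vy) (c vc).

Lemma dot_combl k0 k1 k2 k3 q (d : vec) : dot (comb k0 k1 k2 k3 q) d =
  k0 * dot (q i0) d + k1 * dot (q i1) d + k2 * dot (q i2) d + k3 * dot (q i3) d.
Proof. by rewrite /dot /=; ring. Qed.

Lemma dot_comb k0 k1 k2 k3 l0 l1 l2 l3 q : desc q ->
  dot (comb k0 k1 k2 k3 q) (comb l0 l1 l2 l3 q) =
  2 * (k0 * l0 + k1 * l1 + k2 * l2 + k3 * l3) - (k0 + k1 + k2 + k3) * (l0 + l1 + l2 + l3).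
Proof.
move=> dq; rewrite dot_combl ![dot (q _) (comb _ _ _ _ _)]dotC !dot_combl !dq /=; ring.
Qed.

(** The inverse of the Gram matrix G is G / 4, whence the coefficients. Invertibility of G gives the
    coordinate matrix M a right inverse; M being square, it is also a left inverse, so the four
    vectors span. *)
Lemma desc_span q (d : vec) : desc q ->
  let x i := dot d (q i) in let s := x i0 + x i1 + x i2 + x i3 in
  d = comb ((2 * x i0 - s) / 4) ((2 * x i1 - s) / 4) ((2 * x i2 - s) / 4)
           ((2 * x i3 - s) / 4) q.
Proof.
move=> dq x s.
pose co (j : 'I_4) v := nth 0 [:: va v; vx v; vy v; vc v] j.
pose M : 'M[R]_4 := \matrix_(i, j) co j (q i).
pose e (i j : nat) : R := if (i == 1%N) && (j == 1%N) || (i == 2%N) && (j == 2%N) then 1 else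
  if (i == 0%N) && (j == 3%N) || (i == 3%N) && (j == 0%N) then - 2^-1 else 0.
pose E : 'M[R]_4 := \matrix_(i, j) e i j.
pose G : 'M[R]_4 := \matrix_(i, j) (if i == j then 1 else -1).
pose r : 'rV[R]_4 := \row_j co j d.
have dE v w : dot v w = \sum_(j < 4) (\sum_(i < 4) co i v * e i j) * co j w.
  by rewrite !sum_ord4 /co /e /dot /=; field.
have MG : M *m E *m M^T = G.
  apply/matrixP => i j; rewrite !mxE -dq dE; apply: eq_bigr => k _.
  by rewrite !mxE; congr (_ * _); apply: eq_bigr => l _; rewrite !mxE.
have GG : G *m G = 4%:M.
  by apply/matrixP; elim/ord4_ind; elim/ord4_ind; rewrite !mxE sum_ord4 !mxE /=; ring.
have : (E *m M^T *m (4^-1 *: G)) *m M = 1%:M.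
  apply: mulmx1C; rewrite !mulmxA MG -scalemxAr GG scale_scalar_mx mulVf // pnatr_eq0.
move=> /(congr1 (mulmx r)); rewrite mulmx1 => rE.
have xE i : (r *m (E *m M^T)) 0 i = x i.
  rewrite mulmxA mxE /x dE; apply: eq_bigr => k _.
  by rewrite !mxE; congr (_ * _); apply: eq_bigr => l _; rewrite !mxE.
have cE j : co j d = \sum_i (2 * x i - s) / 4 * co j (q i).
  have -> : co j d = r 0 j by rewrite mxE.
  rewrite -rE mulmxA [RHS]/= mxE; apply: eq_bigr => i _; rewrite [M i j]mxE; congr (_ * _).
  rewrite mulmxA -scalemxAr mxE mxE sum_ord4 !xE !mxE.
  by move: i; elim/ord4_ind => /=; rewrite /s; field.
by apply: vecP; [have := cE i0 | have := cE i1 | have := cE i2 | have := cE i3];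
  rewrite sum_ord4 /co /= => ->.
Qed.

(** The two circles tangent to three given ones have vectors whose sum is twice the sum of the
    three, so the new vector is twice the sum of all four minus three times the old one. *)
Definition flip (i : 'I_4) q : quad := fun j =>
  if j == i then lin 2 (comb 1 1 1 1 q) (-3) (q i) else q j.

Lemma dot_sum_desc q j : desc q -> dot (comb 1 1 1 1 q) (q j) = -2.
Proof. by move=> dq; rewrite dot_combl !dq; move: j; elim/ord4_ind => /=; ring. Qed.

Lemma desc_flip i q : desc q -> desc (flip i q).
Proof.
move=> dq j k; rewrite /flip.
have [ji|ji] := boolP (j == i); have [ki|ki] := boolP (k == i).
- rewrite (eqP ji) (eqP ki) eqxx dot_linl !dot_linr dot_comb // dq eqxx (dotC (q i)) dot_sum_desc //; ring.
- rewrite (eqP ji) dot_linl dq eq_sym (negbTE ki) dot_sum_desc //; ring.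
- rewrite (eqP ki) dot_linr dq (negbTE ji) dotC dot_sum_desc //; ring.
- by rewrite dq.
Qed.

Lemma flipK i q : flip i (flip i q) = q.
Proof.
apply/funext => j; rewrite /flip eqxx; case: eqP => [->|//].
by move: i; elim/ord4_ind; apply: vecP => /=; rewrite /=; ring.
Qed.

Fixpoint run (w : seq 'I_4) q : quad := if w is i :: w' then run w' (flip i q) else q.

Lemma run_cat u u' q : run (u ++ u') q = run u' (run u q).
Proof. by elim: u q => //= i u IH q; rewrite IH. Qed.

Lemma run_rcons u i q : run (rcons u i) q = flip i (run u q).
Proof. by rewrite -cats1 run_cat. Qed.

Lemma desc_run u q : desc q -> desc (run u q).
Proof. by elim: u q => //= i u IH q dq; apply: IH; apply: desc_flip. Qed.

Definition orbit q : set vec := [set v | exists u i, v = run u q i].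

Lemma orbit_run u q : orbit (run u q) = orbit q.
Proof.
elim: u q => //= i u IH q; rewrite IH; apply/seteqP; split=> v [u' [j ->]].
  by exists (i :: u'), j.
by exists (i :: u'), j; rewrite /= flipK.
Qed.

(** Flips commute with relabelling; a transposition brings any entry to position [i0]. *)
Lemma orbit_perm (s : 'I_4 -> 'I_4) q : involutive s -> orbit (q \o s) = orbit q.
Proof.
move=> sK; have sI := inv_inj sK.
have fs i q' : flip i (q' \o s) = flip (s i) q' \o s.
  apply/funext => j; rewrite /flip /= (inj_eq sI); case: eqP => // _; congr lin.
  pose S (f : vec -> R) := \sum_i f (q' i).
  have SE f : \sum_i f (q' (s i)) = S f by rewrite /S [RHS](reindex_inj sI).
  have := (SE va, SE vx, SE vy, SE vc); rewrite /S !sum_ord4 => -[[[e1 e2] e3] e4].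
  by apply: vecP; rewrite /= !mul1r.
have sub q' : orbit (q' \o s) `<=` orbit q'.
  move=> v [u [j ->]]; exists (map s u), (s j).
  have -> : run u (q' \o s) = run (map s u) q' \o s.
    by elim: u q' => //= i u IH q'; rewrite fs IH.
  by [].
apply/seteqP; split; first exact: sub.
have {1}-> : q = (q \o s) \o s by apply/funext => i /=; rewrite sK.
exact: sub.
Qed.

Definition reduced (u : seq 'I_4) := sorted (fun i j => i != j) u.

Lemma run_reduced u q : exists2 u', reduced u' & run u' q = run u q.
Proof.
elim/last_ind: u => [|u i [u' ru' e]]; first by exists [::].
case/lastP: u' ru' e => [|u' j] ru' e.
  by exists [:: i] => //; rewrite run_rcons -e.
case: (eqVneq j i) => [ji|ji].
  exists u'.
    by case: u' ru' {e} => //= k u'; rewrite /reduced /= rcons_path => /andP[].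
  by rewrite run_rcons -e run_rcons ji flipK.
exists (rcons (rcons u' j) i); last by rewrite run_rcons e run_rcons.
case: u' ru' {e} => [|k u']; rewrite /reduced /= ?ji //.
by rewrite !rcons_path last_rcons ji andbT.
Qed.

(* [fv q a b + q i0] is quadratic in [(a, b)]; the pairs (1, 0), (0, 1), (1, 1) give the three
   other circles of the quadruple. *)
Definition fv q (a b : int) : vec :=
  let x : R := a%:~R in let y : R := b%:~R in
  comb (x ^+ 2 + y ^+ 2 - x * y - 1) (x ^+ 2 - x * y) (y ^+ 2 - x * y) (x * y) q.

Lemma fv10 q : fv q 1 0 = q i1.
Proof. by apply: vecP; rewrite /= ?rmorph1 ?rmorph0; ring. Qed.

Lemma fv01 q : fv q 0 1 = q i2.
Proof. by apply: vecP; rewrite /= ?rmorph1 ?rmorph0; ring. Qed.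

Lemma fv11 q : fv q 1 1 = q i3.
Proof. by apply: vecP; rewrite /= ?rmorph1 ?rmorph0; ring. Qed.

Lemma fvN q a b : fv q (- a) (- b) = fv q a b.
Proof. by apply: vecP; rewrite /= !rmorphN; ring. Qed.

(** The value is -1 exactly for determinant 1 or -1: tangency is the Farey neighbour relation. *)
Lemma dot_fv q a b c (d : int) : desc q ->
  dot (fv q a b) (fv q c d) = 1 - 2 * ((a * d - b * c)%:~R) ^+ 2.
Proof. by move=> dq; rewrite dot_comb // rmorphB !rmorphM /=; ring. Qed.

Lemma dot_fv0 q a b : desc q -> dot (fv q a b) (q i0) = -1.
Proof. by move=> dq; rewrite dot_combl !dq /=; ring. Qed.

Lemma fv_parallelogram q a b c (d : int) (f : vec -> R) :
  (f = va \/ f = vx) \/ (f = vy \/ f = vc) ->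
  f (fv q (a - c) (b - d)) =
  2 * (f (q i0) + f (fv q a b) + f (fv q c d)) - f (fv q (a + c) (b + d)).
Proof. by case=> -[] ->; rewrite /= !rmorphB !rmorphD /=; ring. Qed.

(** As long as the first circle is not flipped, the other three are indexed by two basis vectors of
    the integer lattice and their sum. *)
Definition farey q (a b c d : int) (r : quad) : Prop :=
  [/\ r i0 = q i0, r i1 = fv q a b, r i2 = fv q c d & r i3 = fv q (a + c) (b + d)].

Definition unimod (a b c d : int) := ((a * d - b * c) ^+ 2 == 1).

Ltac unimod_ring u := move: u; rewrite /unimod => /eqP <-; apply/eqP; ring.

(** By the parallelogram law a flip replaces one of three index vectors by the difference of the
    other two, up to sign. As [fv] is even, signs can be chosen so that the third vector is again
    the sum. *)
Lemma farey_flip q (a b c d : int) r i : unimod a b c d -> farey q a b c d r -> i != i0 ->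
  exists a' b' c' d', unimod a' b' c' d' /\ farey q a' b' c' d' (flip i r).
Proof.
move=> u [r0 r1 r2 r3]; move: i; elim/ord4_ind => // _.
- exists (a + 2 * c), (b + 2 * d), (- c), (- d); split.
    by unimod_ring u.
  split; rewrite /flip /= ?fvN //; last by rewrite r3; congr fv; ring.
  by apply: vecP; rewrite /= r0 r1 r2 r3 /= !rmorphD !rmorphM /=; ring.
- exists (- a), (- b), (c + 2 * a), (d + 2 * b); split.
    by unimod_ring u.
  split; rewrite /flip /= ?fvN //; last by rewrite r3; congr fv; ring.
  by apply: vecP; rewrite /= r0 r1 r2 r3 /= !rmorphD !rmorphM /=; ring.
- exists a, b, (- c), (- d); split.
    by unimod_ring u.
  split; rewrite /flip /= ?fvN //.
  by apply: vecP; rewrite /= r0 r1 r2 r3 /= !rmorphB !rmorphD /=; ring.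
Qed.

(* Along a reduced word the values [- dot] against a fixed member of the initial
   quadruple stay constant until that member is flipped, and from then on the
   last flipped entry carries the largest value. *)
Lemma reduced_run q u : desc q -> reduced u ->
  (exists a b c d, unimod a b c d /\ farey q a b c d (run u q)) \/
  (exists j, [/\ last i0 u = j, u != [::], dot (run u q j) (q i0) < -1 &
     forall k, [/\ dot (run u q k) (q i0) <= -1,
       dot (run u q j) (q i0) <= dot (run u q k) (q i0) &
       dot (run u q k) (q i0) = -1 -> exists a b c d, unimod a b c d /\ run u q k = fv q a b]]).
Proof.
move=> dq; elim/last_ind: u => [_|u i IH ru].
  left; exists 1, 0, 0, 1; split; first by [].
  by split; rewrite /= ?fv10 ?fv01 ?addr0 ?add0r ?fv11.
have ru' : reduced u.
  by case: (u) ru => //= k v; rewrite /reduced /= rcons_path => /andP[].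
rewrite run_rcons last_rcons; have [[a [b [c [d [uab far]]]]]|[j [lj un xj xk]]] := IH ru'.
  case: (eqVneq i i0) => [->|ii0]; last by left; apply: farey_flip uab far ii0.
  right; exists i0; split=> //; first by case: (u).
    have [r0 r1 r2 r3] := far.
    by rewrite /flip /= dot_linl dot_combl r0 r1 r2 r3 !dot_fv0 // dq /=; lra.
  have [r0 r1 r2 r3] := far.
  have e0 : dot (flip i0 (run u q) i0) (q i0) = -7.
    by rewrite /flip /= dot_linl dot_combl r0 r1 r2 r3 !dot_fv0 // dq /=; ring.
  elim/ord4_ind; rewrite e0; (split; [| |]);
   rewrite /flip /= ?dot_linl ?dot_combl ?r0 ?r1 ?r2 ?r3 ?dot_fv0 // ?dq /=; try lra; move=> _.
  - by exists a, b, c, d.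
  - exists c, d, a, b; split => //; unimod_ring uab.
  - exists (a + c), (b + d), c, d; split => //; unimod_ring uab.
right; exists i.
(* [j] was flipped last and the word is reduced. *)
have ij : i != j.
  case/lastP: u ru ru' lj un {xj xk IH} => // u k; rewrite last_rcons => ru _ <- _.
  case: u ru => [|l u]; rewrite /reduced /= ?andbT ?rcons_path ?last_rcons.
    by rewrite eq_sym.
  by move=> /andP[_]; rewrite eq_sym.
pose x k := dot (run u q k) (q i0).
have xE k : dot (flip i (run u q) k) (q i0) =
    if k == i then 2 * (x i0 + x i1 + x i2 + x i3) - 3 * x i else x k.
  by rewrite /flip; case: ifP => // _; rewrite dot_linl dot_combl /x; ring.
have xb k : x k <= -1 /\ x j <= x k by have [] := xk k.
have [[x0 y0] [x1 y1] [x2 y2]] := And3 (xb i0) (xb i1) (xb i2); have [x3 y3] := xb i3.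
(* The flipped value is twice the sum of the three other values minus [x i]; [x j] is among the
   three, [x j <= x i], and all values are negative. *)
have big : 2 * (x i0 + x i1 + x i2 + x i3) - 3 * x i <= x j.
  move: i j ij {lj xk xb xE ru} xj x0 x1 x2 x3 y0 y1 y2 y3.
  by rewrite -/(x _); elim/ord4_ind; elim/ord4_ind => // _; move: (x i0) (x i1) (x i2) (x i3);
    move=> ? ? ? ? ; rewrite /x; lra.
split; [by []|by case: (u)|by rewrite xE eqxx; apply: le_lt_trans big xj|].
move=> k; rewrite !xE eqxx; case: ifP => ki.
  split => //; first by apply: ltW; apply: le_lt_trans big xj.
  by move=> e; have := le_lt_trans big xj; rewrite e ltxx.
have [h1 h2 h3] := xk k.
split => //; first by apply: (le_trans big).
by move=> /h3 [a [b [c [d [uab e]]]]]; exists a, b, c, d; split => //; rewrite /flip ki.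
Qed.

(** Swapping, negating and adding vectors generate all integer matrices of determinant 1 or -1:
    Euclid's algorithm on the first coordinates a and c ends with c = 0, where a and d are units. *)
Lemma unimod_ind (A : int -> int -> int -> int -> Prop) :
  A 1 0 0 1 -> (forall a b c d, A a b c d -> A c d a b) ->
  (forall a b c d, A a b c d -> A a b (- c) (- d)) ->
  (forall a b c d, A a b c d -> A (a + c) (b + d) c d) ->
  forall a b c d, unimod a b c d -> A a b c d.
Proof.
move=> A1 sw neg add.
have neg1 a b c d : A a b c d -> A (- a) (- b) c d by move=> /sw /neg /sw.
have sub a b c d : A a b c d -> A (a - c) (b - d) c d.
  by move=> /neg /add /neg; rewrite !opprK.
have A01 b : A 1 b 0 1.
  case: b => n.
    elim: n => // n /add; rewrite addr0; congr (A _ _ _ _); lia.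
  elim: n => [|n /sub]; first by have /sub := A1; rewrite subr0 sub0r; congr (A _ _ _ _).
  by rewrite subr0; congr (A _ _ _ _); lia.
move=> a b c d u.
have [n] : exists n, (`|a| + `|c| < n)%N by exists (`|a| + `|c|).+1.
elim: n a b c d u => // n IH a b c d u ac.
wlog leca : a b c d u ac / (`|c| <= `|a|)%N.
  move=> h; have [/h|/ltnW ca] := leqP `|c| `|a|; first exact.
  apply: sw; apply: h => //; last by rewrite addnC.
  by unimod_ring u.
have [c0|c0] := eqVneq c 0.
  have ad : (a * d) ^+ 2 = 1 by move/eqP: u; rewrite c0 mulr0 subr0.
  have /andP[ha hd] : (`|a| == 1)%N && (`|d| == 1)%N.
    move: ad; rewrite exprMn => ad; rewrite -muln_eq1 -abszM.
    have : `|(a * d) ^+ 2|%N = 1%N by rewrite exprMn ad.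
    by rewrite abszX => /eqP; rewrite -[X in _ == X](exp1n 2) eqn_exp2r.
  rewrite c0.
  have [->|->] : a = 1 \/ a = -1 by lia.
    have [->|->] : d = 1 \/ d = -1 by lia.
      exact: A01.
    by have /neg := A01 b; rewrite oppr0.
  have [->|->] : d = 1 \/ d = -1 by lia.
    by have /neg1 := A01 (- b); rewrite opprK.
  by have /neg /neg1 := A01 (- b); rewrite oppr0 opprK.
have [s|s] := ltP 0 (a * c).
  have -> : a = (a - c) + c by ring.
  have -> : b = (b - d) + d by ring.
  apply: add; apply: IH; last by nia.
  by unimod_ring u.
have -> : a = (a + c) - c by ring.
have -> : b = (b + d) - d by ring.
apply: sub; apply: IH; last by nia.
by unimod_ring u.
Qed.

Definition farey_reach q (a b c d : int) : Prop := exists u i j k,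
  [/\ uniq [:: i0; i; j; k], run u q i0 = q i0, run u q i = fv q a b,
      run u q j = fv q c d & run u q k = fv q (a + c) (b + d)].

(** The generators of [unimod_ind] are flips: negating (c, d) turns the sum into the difference, a
    flip at [k]; adding replaces (a, b) by (a + 2 c, b + 2 d), a flip at [i]; swapping only renames
    positions. *)
Lemma farey_reachP q (a b c d : int) : unimod a b c d -> farey_reach q a b c d.
Proof.
apply: unimod_ind a b c d.
- exists [::], i1, i2, i3; split => //=; rewrite ?fv10 ?fv01 //.
  by rewrite addr0 add0r fv11.
- move=> a b c d [u [i [j [k [un r0 ri rj rk]]]]]; exists u, j, i, k; split => //.
    by move: un; rewrite /= !inE !negb_or (eq_sym j i) => /and4P[/and3P[-> -> ->] /andP[-> ->] -> _].
  by rewrite rk (addrC c) (addrC d).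
- move=> a b c d [u [i [j [k [un r0 ri rj rk]]]]]; exists (rcons u k), i, j, k; split => //.
  + by rewrite run_rcons /flip; move: un; rewrite /= !inE !negb_or => /and4P[/and3P[_ _ /negbTE ->]].
  + by rewrite run_rcons /flip; move: un; rewrite /= !inE !negb_or => /and4P[_ /andP[_ /negbTE ->]].
  + by rewrite run_rcons /flip fvN; move: un; rewrite /= !inE => /and4P[_ _ /negbTE ->].
  rewrite run_rcons /flip eqxx.
  have sE (f : vec -> R) : f (run u q i0) + f (run u q i1) + f (run u q i2) + f (run u q i3)
      = f (q i0) + f (fv q a b) + f (fv q c d) + f (fv q (a + c) (b + d)).
    rewrite -r0 -ri -rj -rk; clear -un; move: i j k un.
    by elim/ord4_ind; elim/ord4_ind; elim/ord4_ind => // _; ring.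
  have pl (f : vec -> R) := @fv_parallelogram q a b c d f.
  by apply: vecP; [have := pl va | have := pl vx | have := pl vy | have := pl vc];
    move=> ->; try tauto; [have := sE va | have := sE vx | have := sE vy | have := sE vc];
    rewrite -rk /=; lra.
- move=> a b c d [u [i [j [k [un r0 ri rj rk]]]]].
  exists (rcons u i), k, j, i.
  have un' : uniq [:: i0; k; j; i].
    by move: un; rewrite /= !inE !negb_or (eq_sym k j) (eq_sym k i) (eq_sym j i)
      => /and4P[/and3P[-> -> ->] /andP[-> ->] -> _].
  split => //.
  + by rewrite run_rcons /flip; move: un; rewrite /= !inE !negb_or => /and4P[/and3P[/negbTE ->]].
  + by rewrite run_rcons /flip; move: un'; rewrite /= !inE !negb_or => /and4P[_ /andP[_ /negbTE ->]].
  + by rewrite run_rcons /flip; move: un'; rewrite /= !inE => /and4P[_ _ /negbTE ->].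
  rewrite run_rcons /flip eqxx.
  have sE (f : vec -> R) : f (run u q i0) + f (run u q i1) + f (run u q i2) + f (run u q i3)
      = f (q i0) + f (fv q a b) + f (fv q c d) + f (fv q (a + c) (b + d)).
    rewrite -r0 -ri -rj -rk; clear -un; move: i j k un.
    by elim/ord4_ind; elim/ord4_ind; elim/ord4_ind => // _; ring.
  have pl (f : vec -> R) := @fv_parallelogram q (a + c) (b + d) (- c) (- d) f.
  move: pl; rewrite !opprK fvN !addrK => pl.
  by apply: vecP; [have := pl va | have := pl vx | have := pl vy | have := pl vc];
    move=> ->; try tauto; [have := sE va | have := sE vx | have := sE vy | have := sE vc];
    rewrite -ri /=; lra.
Qed.

Lemma orbit_unit q v : desc q -> orbit q v -> dot v v = 1.
Proof. by move=> dq [u [i ->]]; rewrite (desc_run u dq) eqxx. Qed.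

Lemma orbit_dot0 q v : desc q -> orbit q v -> v = q i0 \/ dot v (q i0) <= -1.
Proof.
move=> dq [u [i ->]]; have [u' ru' <-] := run_reduced u q.
have [[a [b [c [d [_ [r0 r1 r2 r3]]]]]]|[j [_ _ _ /(_ i)[h _ _]]]] := reduced_run dq ru'; last by right.
by move: i; elim/ord4_ind; rewrite ?r0 ?r1 ?r2 ?r3 ?dot_fv0 //; [left|right|right|right].
Qed.

Lemma orbit_tangent0 q v : desc q -> orbit q v -> dot v (q i0) = -1 ->
  exists a b c d : int, unimod a b c d /\ v = fv q a b.
Proof.
move=> dq [u [i ->]]; have [u' ru' <-] := run_reduced u q.
have [[a [b [c [d [uab [r0 r1 r2 r3]]]]]]|[j [_ _ _ /(_ i)[_ _ h]]]] := reduced_run dq ru'; last exact: h.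
move: i; elim/ord4_ind; rewrite ?r0 ?r1 ?r2 ?r3.
- by rewrite dq eqxx => h; exfalso; move: h; lra.
- by exists a, b, c, d.
- exists c, d, a, b; split => //; unimod_ring uab.
- exists (a + c), (b + d), c, d; split => //; unimod_ring uab.
Qed.

Lemma orbit_fv q (a b c d : int) : unimod a b c d -> orbit q (fv q a b).
Proof. by move=> /(farey_reachP q) [u [i [j [k [_ _ <- _ _]]]]]; exists u, i. Qed.

(** Facts proved relative to [q i0] thereby hold relative to every member of the orbit. *)
Lemma orbit_rebase q v : desc q -> orbit q v ->
  exists q', [/\ desc q', orbit q' = orbit q & q' i0 = v].
Proof.
move=> dq [u [i ->]].
pose s j := if j == i0 then i else if j == i then i0 else j.
have sK : involutive s by rewrite /s; clear s; move: i; elim/ord4_ind; elim/ord4_ind.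
exists (run u q \o s); split.
- by move=> j k /=; rewrite (desc_run u dq) (inj_eq (inv_inj sK)).
- by rewrite orbit_perm ?orbit_run.
- by rewrite /= /s eqxx.
Qed.

Lemma orbit_dot q v w : desc q -> orbit q v -> orbit q w -> v <> w -> dot v w <= -1.
Proof.
move=> dq ov ow vw; have [q' [dq' oq' qw]] := orbit_rebase dq ow.
by move: ov; rewrite -oq' => /(orbit_dot0 dq'); rewrite qw => -[|].
Qed.

(** Flipping v itself gives a vector with product 2 * (-2) - 3 = -7. *)
Lemma orbit_far q v : desc q -> orbit q v -> exists2 w, orbit q w & dot v w < -1.
Proof.
move=> dq [u [i ->]]; exists (flip i (run u q) i); first by exists (rcons u i), i; rewrite run_rcons.
by rewrite /flip eqxx dot_linr dotC (dot_sum_desc _ (desc_run u dq)) (desc_run u dq) eqxx; lra.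
Qed.

(** With x rebased to position [i0], y and z have index pairs of determinant 1 or -1, so all three
    sit in one quadruple of the orbit. The product t of d with the fourth entry determines d, and
    the unit norm of d reads (t - 1) (t + 7) = 0: d is the fourth entry or its flip. *)
Lemma orbit_closed q (x y z d : vec) : desc q -> orbit q x -> orbit q y -> orbit q z ->
  dot x y = -1 -> dot y z = -1 -> dot x z = -1 ->
  dot d d = 1 -> dot d x = -1 -> dot d y = -1 -> dot d z = -1 -> orbit q d.
Proof.
move=> dq ox oy oz xy yz xz dd dx dy dz.
have [q' [dq' oq' qx]] := orbit_rebase dq ox.
rewrite -oq' in oy oz *; rewrite -qx in xy xz dx.
have [a [b [_ [_ [_ yE]]]]] := orbit_tangent0 dq' oy (etrans (dotC _ _) xy).
have [a' [b' [_ [_ [_ zE]]]]] := orbit_tangent0 dq' oz (etrans (dotC _ _) xz).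
have u : unimod a b a' b'.
  move: yz; rewrite yE zE dot_fv // => h.
  have /eqP : ((a * b' - b * a') ^+ 2)%:~R = 1 :> R by rewrite rmorphXn /=; lra.
  by rewrite -[1]/(1%:~R) eqr_int.
have [w [i [j [k [un r0 ri rj rk]]]]] := farey_reachP q' u.
have dr := desc_run w dq'.
suff [e|e] : d = run w q' k \/ d = flip k (run w q') k.
- by rewrite e; exists w, k.
- by rewrite e; exists (rcons w k), k; rewrite run_rcons.
have := desc_span d dr; rewrite /= => dE.
have := dd; rewrite {1 2}dE dot_comb //.
rewrite -r0 in dx; rewrite yE -ri in dy; rewrite zE -rj in dz.
move: (run w q') dr dx dy dz dE => r dr dx dy dz dE {ri rj rk r0}.
pose t := dot d (r k).
have tE : t = dot d (r k) by [].
clearbody t; clear -un dx dy dz tE dE.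
move: i j k un dx dy dz tE; elim/ord4_ind; elim/ord4_ind; elim/ord4_ind => // _ e1 e2 e3 e4;
 rewrite e1 e2 e3 -e4 in dE *; move=> h;
 (have /orP[/eqP t1|/eqP t7] : (t == 1) || (t == -7)
   by rewrite -subr_eq0 -[t == -7]subr_eq0 -mulf_eq0; apply/eqP; lra);
 [left|right|left|right|left|right|left|right|left|right|left|right];
 rewrite dE ?t1 ?t7; apply: vecP; rewrite /flip /=; first [by field | lra].
Qed.

End Vectors.

Local Notation "v +v w" := (lin 1 v 1 w) (at level 50).

(** * From vectors to circles, sides and points of the sphere *)

Section Circles.
Context {R : realType}.
Notation vec := (@vec R).
Implicit Types (v w u n : vec) (z : R[i]) (r : R).

(** At infinity the leading coefficient takes the place of the value, so incidence and sides are
    right there as well. *)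
Definition fz v (z : sphere R) : R := if z is Some z' then
  va v * (Re z' ^+ 2 + Im z' ^+ 2)
    - 2 * (vx v * Re z' + vy v * Im z') + vc v else va v.

Definition Zs v : set (sphere R) := [set z | fz v z = 0].
Definition Ns v : set (sphere R) := [set z | fz v z < 0].

Lemma fz_lin s v t w (z : sphere R) : fz (lin s v t w) z = s * fz v z + t * fz w z.
Proof. by case: z => [z|] //=; ring. Qed.

Lemma fz_opp v (z : sphere R) : fz (opp v) z = - fz v z.
Proof. by case: z => [z|] //=; ring. Qed.

Lemma Zs_opp v : Zs (opp v) = Zs v.
Proof.
apply/seteqP; split=> z; rewrite /Zs /= fz_opp; first by move/eqP; rewrite oppr_eq0 => /eqP.
by move=> ->; rewrite oppr0.
Qed.

Definition circ (z : R[i]) r : vec :=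
  Vec (r^-1) (Re z / r) (Im z / r)
    ((Re z ^+ 2 + Im z ^+ 2 - r ^+ 2) / r).

Definition linev (p v : R[i]) : vec :=
  Vec 0 (- Im v) (Re v)
    (2 * (Re v * Im p - Im v * Re p)).

Lemma circ_unit z r : 0 < r -> dot (circ z r) (circ z r) = 1.
Proof. by move=> r0; rewrite /dot /=; field; rewrite lt0r_neq0. Qed.

Lemma normc1 (v : R[i]) : Normc.normc v = 1 -> Re v ^+ 2 + Im v ^+ 2 = 1.
Proof.
by case: v => a b /= /(congr1 (fun x => x ^+ 2)); rewrite sqr_sqrtr ?expr1n // addr_ge0 ?sqr_ge0.
Qed.

Lemma linev_unit (p v : R[i]) : Normc.normc v = 1 -> dot (linev p v) (linev p v) = 1.
Proof. by move=> /normc1 <-; rewrite /dot /=; ring. Qed.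

Lemma fz_circ z r (x y : R) : 0 < r -> fz (circ z r) (Some (x +i* y)) =
  ((x - Re z) ^+ 2 + (y - Im z) ^+ 2 - r ^+ 2) / r.
Proof. by move=> r0 /=; field; rewrite lt0r_neq0. Qed.

Lemma normc_ltE (z : R[i]) r : 0 < r ->
  (Normc.normc z < r) = (Re z ^+ 2 + Im z ^+ 2 - r ^+ 2 < 0).
Proof.
case: z => x y r0 /=; rewrite subr_lt0 -[in LHS](ger0_norm (ltW r0)) -sqrtr_sqr.
by rewrite ltr_sqrt // exprn_gt0.
Qed.

Lemma normc_gtE (z : R[i]) r : 0 < r ->
  (r < Normc.normc z) = (0 < Re z ^+ 2 + Im z ^+ 2 - r ^+ 2).
Proof.
case: z => x y r0 /=; rewrite subr_gt0 -[in LHS](ger0_norm (ltW r0)) -sqrtr_sqr !ltNge.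
by rewrite ler_psqrt // nnegrE ?addr_ge0 ?sqr_ge0.
Qed.

Local Notation fzc z r x y := (fz (circ z r) (Some (x +i* y))).

Lemma circleE z r : 0 < r -> circle z r = Zs (circ z r).
Proof.
move=> r0; have ri : r^-1 != 0 by rewrite invr_eq0 lt0r_neq0.
apply/seteqP; split=> [_ [[x y] h <-]|[[x y]|]]; rewrite /Zs /=.
- rewrite -/(fzc z r x y) fz_circ //; apply/eqP; rewrite mulf_eq0 (negbTE ri) orbF.
  case: z h => a b /= h; rewrite eq_le -[X in X && _]negbK -[X in _ && X]negbK -!ltNge.
  by have := normc_ltE ((x - a) +i* (y - b)) r0; have := normc_gtE ((x - a) +i* (y - b)) r0;
    rewrite /= h ltxx => <- <-.
- rewrite -/(fzc z r x y) fz_circ // => /eqP; rewrite mulf_eq0 (negbTE ri) orbF => /eqP h.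
  exists (x +i* y) => //; case: z h => a b /= h; apply/eqP; rewrite eq_le !leNgt.
  have := normc_ltE ((x - a) +i* (y - b)) r0; have := normc_gtE ((x - a) +i* (y - b)) r0.
  by rewrite /= h ltxx => -> ->.
- by move=> h; rewrite h eqxx in ri.
Qed.

Lemma diskE z r : 0 < r -> disk z r = Ns (circ z r).
Proof.
move=> r0; have ri : 0 < r^-1 by rewrite invr_gt0.
apply/seteqP; split=> [_ [[x y] /= h <-]|[[x y]|]]; rewrite /Ns /=.
- rewrite -/(fzc z r x y) fz_circ // pmulr_llt0 //.
  by move: h; rewrite normc_ltE //; case: z.
- rewrite -/(fzc z r x y) fz_circ // pmulr_llt0 // => h.
  by exists (x +i* y) => //=; rewrite normc_ltE //; case: z h.
- by rewrite ltNge ltW.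
Qed.

Lemma exteriorE z r : 0 < r -> exterior z r = Ns (opp (circ z r)).
Proof.
move=> r0; have ri : 0 < r^-1 by rewrite invr_gt0.
apply/seteqP; split=> [_ [->|[[x y] /= h <-]]|[[x y]|]]; rewrite /Ns /= ?fz_opp.
- by rewrite oppr_lt0.
- rewrite -/(fz (opp (circ z r)) (Some (x +i* y))) fz_opp fz_circ // oppr_lt0 pmulr_lgt0 //.
  by move: h; rewrite normc_gtE //; case: z.
- rewrite -/(fz (opp (circ z r)) (Some (x +i* y))) fz_opp fz_circ // oppr_lt0 pmulr_lgt0 // => h.
  by right; exists (x +i* y) => //=; rewrite normc_gtE //; case: z h.
- by left.
Qed.

Lemma fz_linev (p v z : R[i]) : Normc.normc v = 1 ->
  fz (linev p v) (Some z) = - 2 * Im ((z - p) / v).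
Proof.
move=> /normc1; case: v p z => a b [c d] [x y] /= ab.
by rewrite ab !divr1; ring.
Qed.

Lemma lineE (p v : R[i]) : Normc.normc v = 1 -> line p v = Zs (linev p v).
Proof.
move=> v1; apply/seteqP; split=> [_ [->|[t _ <-]]|[z|]]; rewrite /Zs //=; last by left.
  move: v v1 p => [a b] v1 [c d] /=; ring.
rewrite -/(fz (linev p v) (Some z)).
have nz : v != 0.
  apply/eqP => v0; move: v1; rewrite v0 /= => /eqP.
  by rewrite expr0n addr0 sqrtr0 eq_sym oner_eq0.
rewrite fz_linev // => /eqP; rewrite mulf_eq0 oppr_eq0 pnatr_eq0 /= => /eqP h; right.
exists (Re ((z - p) / v)) => //; congr Some.
have -> : (Re ((z - p) / v))%:C = (z - p) / v.
  by move: h; case: ((z - p) / v) => a b /= ->.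
by rewrite divfK // addrC subrK.
Qed.

Lemma left_halfE (p v : R[i]) : Normc.normc v = 1 -> left_half p v = Ns (linev p v).
Proof.
move=> v1; apply/seteqP; split=> [_ [z h <-]|[z|]]; rewrite /Ns /=.
- by rewrite -/(fz (linev p v) (Some z)) fz_linev // nmulr_rlt0 // oppr_lt0.
- rewrite -/(fz (linev p v) (Some z)) fz_linev // nmulr_rlt0 ?oppr_lt0 // => h.
  by exists z.
- by rewrite ltxx.
Qed.

Lemma unit_vec_cases v : dot v v = 1 ->
  [\/ exists z r, 0 < r /\ v = circ z r, exists z r, 0 < r /\ v = opp (circ z r) |
      exists p d, Normc.normc d = 1 /\ v = linev p d].
Proof.
case: v => a x y c; rewrite /dot /= => h.
have [a0|a0|a0] := ltgtP a 0.
- constructor 2; exists ((x / a) +i* (y / a)), ((- a)^-1).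
  have an : a != 0 by rewrite lt_eqF.
  rewrite invr_gt0 oppr_gt0; split=> //; apply: vecP => /=; try by field.
  have -> : c = (x ^+ 2 + y ^+ 2 - 1) / a by rewrite -h; field.
  by field.
- constructor 1; exists ((x / a) +i* (y / a)), (a^-1).
  have an : a != 0 by rewrite gt_eqF.
  rewrite invr_gt0; split=> //; apply: vecP => /=; try by field.
  have -> : c = (x ^+ 2 + y ^+ 2 - 1) / a by rewrite -h; field.
  by field.
- constructor 3; exists ((c / 2 * x) +i* (c / 2 * y)), (y +i* (- x)).
  have xy : x ^+ 2 + y ^+ 2 = 1 by rewrite -h a0; field.
  split; first by rewrite /= sqrrN addrC xy sqrtr1.
  apply: vecP => //=; first by rewrite opprK.
  by transitivity (c * (x ^+ 2 + y ^+ 2)); [rewrite xy mulr1 | field].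
Qed.

Lemma is_circleE C : is_circle C <-> exists v, dot v v = 1 /\ C = Zs v.
Proof.
split=> [[[z [r [r0 ->]]]|[p [v [v1 ->]]]]|[v [v1 ->]]].
- by exists (circ z r); rewrite circ_unit // circleE.
- by exists (linev p v); rewrite linev_unit // lineE.
- have [[z [r [r0 ->]]]|[z [r [r0 ->]]]|[p [d [d1 ->]]]] := unit_vec_cases v1.
  + by left; exists z, r; rewrite circleE.
  + by left; exists z, r; rewrite circleE // Zs_opp.
  + by right; exists p, d; rewrite lineE.
Qed.

Lemma is_sideE C D : is_side C D <-> exists v, [/\ dot v v = 1, C = Zs v & D = Ns v].
Proof.
split=> [[[z [r [r0 -> ->]]]|[z [r [r0 -> ->]]]|[p [v [v1 -> ->]]]]|[v [v1 -> ->]]].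
- by exists (circ z r); rewrite circ_unit // circleE // diskE.
- exists (opp (circ z r)); rewrite dot_oppl dot_oppr opprK circ_unit //.
  by rewrite circleE // Zs_opp exteriorE.
- by exists (linev p v); rewrite linev_unit // lineE // left_halfE.
- have [[z [r [r0 ->]]]|[z [r [r0 ->]]]|[p [d [d1 ->]]]] := unit_vec_cases v1.
  + by constructor 1; exists z, r; rewrite circleE // diskE.
  + by constructor 2; exists z, r; rewrite circleE // Zs_opp exteriorE.
  + by constructor 3; exists p, d; rewrite lineE // left_halfE.
Qed.

(** Four points of the circle fix the vector up to a scalar, and the unit norm leaves the sign. *)
Lemma Zs_circ_inj w z r : 0 < r -> dot w w = 1 -> Zs w = Zs (circ z r) ->
  w = circ z r \/ w = opp (circ z r).
Proof.
move=> r0 w1 e; case: z e => x y e.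
have at_ (a b : R) : (a - x) ^+ 2 + (b - y) ^+ 2 = r ^+ 2 -> fz w (Some (a +i* b)) = 0.
  move=> h; have : Zs (circ (x +i* y) r) (Some (a +i* b)).
    by rewrite /Zs /mkset fz_circ //= h subrr mul0r.
  by rewrite -e.
have := at_ (x + r) y; have := at_ (x - r) y; have := at_ x (y + r); have := at_ x (y - r).
case: w w1 {e at_} => a bx b_y c; rewrite /dot /= => w1.
move=> /(_ ltac:(ring)) e1 /(_ ltac:(ring)) e2 /(_ ltac:(ring)) e3 /(_ ltac:(ring)) e4.
have rn : r != 0 by rewrite lt0r_neq0.
have ex : bx = a * x by apply: (mulfI rn); lra.
have ey : b_y = a * y by apply: (mulfI rn); lra.
have ec : c = a * (x ^+ 2 + y ^+ 2 - r ^+ 2) by rewrite ex ey in e1; lra.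
have /eqP : (a * r) ^+ 2 = 1 by rewrite -w1 ex ey ec; field.
rewrite sqrf_eq1 => /orP[] /eqP ar.
  have aE : a = r^-1 by apply: (mulIf rn); rewrite ar mulVf.
  by left; apply: vecP; rewrite /= ?ex ?ey ?ec aE //; field.
have aE : a = - r^-1 by apply: (mulIf rn); rewrite ar mulNr mulVf.
by right; apply: vecP; rewrite /= ?ex ?ey ?ec aE //; field.
Qed.

Lemma Zs_linev_inj w (p v : R[i]) : Normc.normc v = 1 -> dot w w = 1 -> Zs w = Zs (linev p v) ->
  w = linev p v \/ w = opp (linev p v).
Proof.
move=> v1 w1 e; have /normc1 := v1; rewrite -lineE // in e.
case: v p v1 e => s t [x y] v1 e /= st.
have e1 : Zs w None by rewrite e; left.
have e2 : Zs w (Some (x +i* y)).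
  by rewrite e; right; exists 0 => //; congr Some; apply/eqP; rewrite eq_complex /= !mul0r subr0 !addr0 !eqxx.
have e3 : Zs w (Some ((x + s) +i* (y + t))).
  by rewrite e; right; exists 1 => //; congr Some; apply/eqP; rewrite eq_complex /= !mul1r !mul0r subr0 !addr0 !eqxx.
case: w w1 e1 e2 e3 {e} => a bx b_y c; rewrite /dot /Zs /= => w1 e1 e2 e3.
rewrite e1 in w1 e2 e3 *.
have bv : bx * s + b_y * t = 0 by lra.
pose k := b_y * s - bx * t.
have ex : bx = - (k * t).
  transitivity (bx * (s ^+ 2 + t ^+ 2)); first by rewrite st mulr1.
  have : (bx * s + b_y * t) * s = 0 by rewrite bv mul0r.
  rewrite /k; lra.
have ey : b_y = k * s.
  transitivity (b_y * (s ^+ 2 + t ^+ 2)); first by rewrite st mulr1.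
  have : (bx * s + b_y * t) * t = 0 by rewrite bv mul0r.
  rewrite /k; lra.
clearbody k.
have /eqP : k ^+ 2 = 1.
  transitivity (k ^+ 2 * (s ^+ 2 + t ^+ 2)); first by rewrite st mulr1.
  by rewrite -w1 ex ey; field.
rewrite sqrf_eq1 => /orP[] /eqP kE; rewrite kE in ex ey.
  by left; rewrite ex ey in e2 *; apply: vecP => /=; lra.
by right; rewrite ex ey in e2 *; apply: vecP => /=; lra.
Qed.

Lemma Zs_inj v w : dot v v = 1 -> dot w w = 1 -> Zs v = Zs w -> v = w \/ v = opp w.
Proof.
move=> v1 w1; have [[z [r [r0 ->]]]|[z [r [r0 ->]]]|[p [d [d1 ->]]]] := unit_vec_cases w1.
- exact: Zs_circ_inj.
- by rewrite Zs_opp oppK => /(Zs_circ_inj r0 v1) [->|->]; [right|left].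
- exact: Zs_linev_inj.
Qed.

Lemma Zs_two v : dot v v = 1 -> exists x y, [/\ Zs v x, Zs v y & x <> y].
Proof.
move=> v1; suff h z r : 0 < r -> exists x y, [/\ Zs (circ z r) x, Zs (circ z r) y & x <> y].
  have [[z [r [r0 ->]]]|[z [r [r0 ->]]]|[p [d [d1 ->]]]] := unit_vec_cases v1.
  - exact: h.
  - by rewrite Zs_opp; apply: h.
  - rewrite -lineE //; exists None, (Some p); split => //; first by left.
    by right; exists 0 => //; rewrite mul0r addr0.
move=> r0; exists (Some ((Re z + r) +i* Im z)), (Some ((Re z - r) +i* Im z)).
split; rewrite /Zs /mkset ?fz_circ //; try by (apply/eqP; rewrite mulf_eq0; apply/orP; left; apply/eqP; ring).
by move=> [e]; move: e r0; lra.
Qed.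

(** Points of the sphere are the isotropic lines of the form, and incidence with a circle is
    orthogonality. *)
Definition Xp (x : sphere R) : vec := if x is Some z then
  Vec 1 (Re z) (Im z) (Re z ^+ 2 + Im z ^+ 2)
  else Vec 0 0 0 1.

Lemma fz_dot v x : fz v x = - 2 * dot v (Xp x).
Proof. by case: x => [z|]; rewrite /dot /=; field. Qed.

Lemma Xp_null x : dot (Xp x) (Xp x) = 0.
Proof. by case: x => [z|]; rewrite /dot /=; field. Qed.

Lemma Xp_inj x y : dot (Xp x) (Xp y) = 0 -> x = y.
Proof.
case: x y => [[a b]|] [[c d]|] //; rewrite /dot /=; last 2 first.
- by move=> h; exfalso; move: h; lra.
- by move=> h; exfalso; move: h; lra.
move=> h; have : (a - c) ^+ 2 + (b - d) ^+ 2 = 0 by lra.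
move=> /eqP; rewrite paddr_eq0 ?sqr_ge0 // !sqrf_eq0 !subr_eq0 => /andP[/eqP -> /eqP ->] //.
Qed.

(** The point of a nonzero isotropic vector; if [va n] is 0, isotropy kills [vx] and [vy] too, and
    the point is infinity. *)
Definition pt n : sphere R :=
  if va n == 0 then None else Some ((vx n / va n) +i* (vy n / va n)).

Definition vec0 : vec := Vec 0 0 0 0.

Lemma null_pt n : dot n n = 0 -> n <> vec0 ->
  exists2 k, k != 0 & forall v, dot v n = k * dot v (Xp (pt n)).
Proof.
case: n => a x y c; rewrite {1}/dot /pt /= => h n0; case: eqP => [a0|/eqP a0].
  have xy : x ^+ 2 + y ^+ 2 = 0 by rewrite a0 in h; lra.
  move/eqP: xy; rewrite paddr_eq0 ?sqr_ge0 // !sqrf_eq0 => /andP[/eqP x0 /eqP y0].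
  rewrite a0 x0 y0 in n0 *; exists c; last by move=> v; rewrite /dot /=; field.
  by apply/eqP => c0; apply: n0; rewrite c0.
exists a => // v; rewrite /dot /=.
have -> : c = (x ^+ 2 + y ^+ 2) / a by apply: (mulIf a0); rewrite divfK //; lra.
by field.
Qed.

Lemma pt_in n v : dot n n = 0 -> n <> vec0 -> dot v n = 0 -> Zs v (pt n).
Proof.
move=> nn n0 vn; have [k k0 kE] := null_pt nn n0.
rewrite /Zs /mkset fz_dot; apply/eqP; rewrite mulf_eq0 oppr_eq0 pnatr_eq0 /=.
by move: vn; rewrite kE => /eqP; rewrite mulf_eq0 (negbTE k0).
Qed.

Lemma ZsP v x : Zs v x <-> dot v (Xp x) = 0.
Proof. by rewrite /Zs /mkset fz_dot; split=> [|->]; [lra|rewrite mulr0]. Qed.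

Lemma pt_uniq n x : dot n n = 0 -> n <> vec0 -> dot n (Xp x) = 0 -> x = pt n.
Proof.
move=> nn n0 nx; have [k k0 kE] := null_pt nn n0.
apply: Xp_inj; move: nx; rewrite dotC kE => /eqP; rewrite mulf_eq0 (negbTE k0) => /eqP //.
Qed.

Lemma add_null v w : dot v v = 1 -> dot w w = 1 -> dot v w = -1 -> dot (v +v w) (v +v w) = 0.
Proof. by move=> v1 w1 vw; rewrite dot_linl !dot_linr (dotC w v) v1 w1 vw; ring. Qed.

Lemma add_neq0 v w : v <> opp w -> v +v w <> vec0.
Proof.
move=> h [e1 e2 e3 e4]; apply: h; apply: vecP => /=; lra.
Qed.

Lemma tangent_pt v w : dot v v = 1 -> dot w w = 1 -> dot v w = -1 -> v <> opp w ->
  Zs v (pt (v +v w)) /\ Zs w (pt (v +v w)).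
Proof.
move=> v1 w1 vw vNw; have nn := add_null v1 w1 vw; have n0 := add_neq0 vNw.
by split; apply: pt_in => //; rewrite dot_linr ?v1 ?w1 ?vw ?(dotC w v) ?vw; ring.
Qed.

(** v + w is isotropic and represents the point of contact. A common point is orthogonal to it, and
    orthogonal isotropic vectors are proportional. *)
Lemma tangent_dot v w : dot v v = 1 -> dot w w = 1 -> dot v w = -1 -> v <> opp w ->
  tangent (Zs v) (Zs w).
Proof.
move=> v1 w1 vw vNw; have nn := add_null v1 w1 vw; have n0 := add_neq0 vNw.
exists (pt (v +v w)); split; first exact: tangent_pt.
move=> y [/ZsP vy /ZsP wy]; symmetry; apply: pt_uniq => //.
by rewrite dot_linl vy wy; ring.
Qed.

(* Otherwise the orthogonal complement of [v] and [w] is a nondegenerate plane, and its second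
   null line is another common point. *)
Lemma dot_tangent v w : dot v v = 1 -> dot w w = 1 -> tangent (Zs v) (Zs w) ->
  dot v w = -1 \/ dot v w = 1.
Proof.
move=> v1 w1 [x0 [[/ZsP vx0 /ZsP wx0] uniq]].
have [/eqP|k1] := eqVneq (dot v w ^+ 2) 1.
  by rewrite sqrf_eq1 => /orP[] /eqP; [right|left].
exfalso; set k := dot v w in k1.
have k1' : 1 - k ^+ 2 != 0 by rewrite subr_eq0 eq_sym.
(* A timelike vector, hence orthogonal to no isotropic one. [T'] is its projection away from v and
   w, and [X1] the second isotropic direction in the plane of [T'] and [Xp x0]. *)
pose T : vec := Vec 1 0 0 1.
have Tx : dot T (Xp x0) != 0.
  rewrite /T /dot; case: (x0) => [[a b]|] /=; apply/eqP.
    by have := sqr_ge0 a; have := sqr_ge0 b; lra.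
  by lra.
pose al := (dot T v - k * dot T w) / (1 - k ^+ 2).
pose be := (dot T w - k * dot T v) / (1 - k ^+ 2).
pose T' := lin 1 T (-1) (lin al v be w).
have T'v : dot T' v = 0.
  by rewrite /T' !dot_linl v1 (dotC w v) -/k /al /be; field.
have T'w : dot T' w = 0.
  by rewrite /T' !dot_linl w1 -/k /al /be; field.
have T'x : dot T' (Xp x0) = dot T (Xp x0) by rewrite /T' !dot_linl vx0 wx0; ring.
clearbody T'.
pose X1 := lin 1 T' (- (dot T' T') / (2 * dot T (Xp x0))) (Xp x0).
have X1X : dot X1 (Xp x0) = dot T (Xp x0) by rewrite dot_linl Xp_null T'x; ring.
have X1n : dot X1 X1 = 0.
  rewrite dot_linl !dot_linr Xp_null (dotC (Xp x0)) T'x.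
  by move: (dot T' T') (dot T (Xp x0)) Tx => A B B0; field.
have X10 : X1 <> vec0.
  by move=> e; move: X1X; rewrite e => e0; move: Tx; rewrite -e0 => /eqP; apply; rewrite /dot /=; ring.
have vX1 : Zs v (pt X1) by apply: pt_in => //; rewrite dot_linr vx0 (dotC v) T'v; ring.
have wX1 : Zs w (pt X1) by apply: pt_in => //; rewrite dot_linr wx0 (dotC w) T'w; ring.
have [k0 k00 kE] := null_pt X1n X10.
move: (uniq _ (conj vX1 wX1)) => e.
by move: Tx; rewrite -X1X dotC kE -e Xp_null mulr0 eqxx.
Qed.

Lemma tangent_neq v w : dot v v = 1 -> tangent (Zs v) (Zs w) -> v <> w /\ v <> opp w.
Proof.
move=> v1 [x0 [_ uniq]]; have [x [y [vx vy xy]]] := Zs_two v1.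
have same : Zs v = Zs w -> False.
  move=> e; apply: xy; have [wx wy] : Zs w x /\ Zs w y by rewrite -e.
  by rewrite -(uniq x (conj vx wx)) (uniq y (conj vy wy)).
by split=> e; apply: same; rewrite e // Zs_opp.
Qed.

(* Future-directed causal vectors: the disks [Ns v] and [Ns w] are disjoint when [v + w] is one. *)
Definition fut u : Prop := [/\ dot u u <= 0, 0 <= va u & 0 <= vc u].

Lemma fut_ge0 u x : fut u -> 0 <= fz u x.
Proof.
case: u x => a x y c [[s t]|] [/= q a0 c0] //=; move: q; rewrite /dot /= => q.
have [a1|a1] := eqVneq a 0.
  have xy : x ^+ 2 + y ^+ 2 <= 0 by rewrite a1 in q; lra.
  have /andP[/eqP x0 /eqP y0] : (x == 0) && (y == 0).
    by rewrite -!(sqrf_eq0 x) -!(sqrf_eq0 y) -paddr_eq0 ?sqr_ge0 // eq_le xy addr_ge0 ?sqr_ge0.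
  by rewrite a1 x0 y0; lra.
have ap : 0 < a by rewrite lt_neqAle eq_sym a1.
rewrite -(pmulr_rge0 _ ap).
by have := sqr_ge0 (a * s - x); have := sqr_ge0 (a * t - y); nra.
Qed.

Lemma fut_gt0 u x : fut u -> dot u u < 0 -> 0 < fz u x.
Proof.
case: u x => a x y c [[s t]|] [/= q a0 c0] //=; move: q; rewrite /dot /= => _ q.
  have ap : 0 < a.
    by rewrite lt_neqAle a0 andbT; apply/eqP => a1; move: q; rewrite -a1; have := sqr_ge0 x; have := sqr_ge0 y; lra.
  rewrite -(pmulr_rgt0 _ ap).
  by have := sqr_ge0 (a * s - x); have := sqr_ge0 (a * t - y); nra.
rewrite lt_neqAle a0 andbT; apply/eqP => a1; move: q; rewrite -a1; have := sqr_ge0 x; have := sqr_ge0 y; lra.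
Qed.

(** By the reversed Cauchy-Schwarz inequality, causal vectors with negative product lie in the same
    half of the light cone. *)
Lemma fut_same u u' : fut u -> dot u' u' <= 0 -> dot u u' < 0 -> fut u'.
Proof.
case: u u' => a x y c [a' x' y' c'] [/= q a0 c0]; rewrite /dot /= in q * => q' d.
suff h : ~ (a' < 0 \/ c' < 0).
  by split => //; rewrite /= leNgt; apply/negP => e; apply: h; [left|right].
move=> h.
have ac : 0 <= a' * c' by have := sqr_ge0 x'; have := sqr_ge0 y'; lra.
have [a1 c1] : a' <= 0 /\ c' <= 0 by case: h => h; split; nra.
have cs : (x * x' + y * y') ^+ 2 <= (x ^+ 2 + y ^+ 2) * (x' ^+ 2 + y' ^+ 2).
  by have := sqr_ge0 (x * y' - y * x'); lra.
have cs2 : (x ^+ 2 + y ^+ 2) * (x' ^+ 2 + y' ^+ 2) <= (a * c) * (a' * c').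
  by apply: ler_pM; rewrite ?addr_ge0 ?sqr_ge0 //; lra.
have cs3 : (a * c) * (a' * c') <= ((a * c' + c * a') / 2) ^+ 2.
  by have := sqr_ge0 (a * c' - c * a'); lra.
have n1 : (a * c' + c * a') / 2 <= 0 by nra.
have := le_trans cs (le_trans cs2 cs3); nra.
Qed.

(** The signature is (3, 1), so the complement of a timelike vector is positive definite. *)
Lemma ortho_timelike (s n : vec) : dot s s < 0 -> dot n s = 0 -> n <> vec0 -> 0 < dot n n.
Proof.
case: s n => a x y c [a' x' y' c']; rewrite /dot /= => ss ns n0.
have ac : x ^+ 2 + y ^+ 2 < a * c by lra.
have ac0 : 0 < a * c by apply: le_lt_trans ac; rewrite addr_ge0 ?sqr_ge0.
have e : x' * x + y' * y = (a * c' + c * a') / 2 by lra.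
have cs : (x' * x + y' * y) ^+ 2 <= (x' ^+ 2 + y' ^+ 2) * (x ^+ 2 + y ^+ 2).
  by have := sqr_ge0 (x * y' - y * x'); lra.
have am : (a * c) * (a' * c') <= ((a * c' + c * a') / 2) ^+ 2.
  by have := sqr_ge0 (a * c' - c * a'); lra.
rewrite -e in am; have h := le_trans am cs.
have [z|z] := eqVneq (x' ^+ 2 + y' ^+ 2) 0.
  move: (z) => /eqP; rewrite paddr_eq0 ?sqr_ge0 // !sqrf_eq0 => /andP[/eqP x0 /eqP y0].
  rewrite x0 y0 in e n0 *.
  have e' : a * c' = - (c * a') by lra.
  have an : a != 0 by apply/eqP => a0; move: ac0; rewrite a0 mul0r ltxx.
  have e2 : a ^+ 2 * (a' * c') = - (a * c) * a' ^+ 2.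
    by rewrite [LHS](_ : _ = (a * c') * a' * a); [rewrite e'; ring | ring].
  have a'n : a' != 0.
    apply/eqP => a0; apply: n0; rewrite a0 mulr0 oppr0 in e'.
    by move/eqP: e'; rewrite mulf_eq0 (negbTE an) /= => /eqP ->; rewrite a0.
  have : 0 < a' ^+ 2 by rewrite exprn_even_gt0.
  have : 0 < a ^+ 2 by rewrite exprn_even_gt0.
  move=> h1 h2; have h3 : a ^+ 2 * (a' * c') < 0 by rewrite e2 mulNr oppr_lt0 mulr_gt0.
  have : a' * c' < 0 by rewrite -(pmulr_rlt0 _ h1).
  lra.
have zp : 0 < x' ^+ 2 + y' ^+ 2 by rewrite lt_neqAle eq_sym z addr_ge0 ?sqr_ge0.
have : (a * c) * (a' * c') < (a * c) * (x' ^+ 2 + y' ^+ 2).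
  by apply: (le_lt_trans h); rewrite mulrC ltr_pM2r.
rewrite ltr_pM2l //; lra.
Qed.

Lemma exists_ortho (v1 v2 v3 : vec) :
  exists n, [/\ n <> vec0, dot n v1 = 0, dot n v2 = 0 & dot n v3 = 0].
Proof.
pose w (j : 'I_3) := nth vec0 [:: v1; v2; v3] j.
pose co (i : 'I_4) v := nth 0 [:: - vc v / 2; vx v; vy v; - va v / 2] i.
pose A : 'M[R]_(4, 3) := \matrix_(i, j) co i (w j).
have : kermx A != 0.
  rewrite kermx_eq0 /row_free neq_ltn; apply/orP; left.
  exact: leq_ltn_trans (rank_leq_col A) _.
move=> /rowV0Pn [r /sub_kermxP rA r0].
pose n := Vec (r 0 i0) (r 0 i1) (r 0 i2) (r 0 i3).
have dE (j : 'I_3) : dot n (w j) = 0.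
  have := congr1 (fun M : 'M[R]_(1, 3) => M 0 j) rA; rewrite !mxE sum_ord4 !mxE /co /=.
  by rewrite /dot /= => <-; field.
exists n; split; [|exact: (dE (@Ordinal 3 0 isT))|exact: (dE (@Ordinal 3 1 isT))|exact: (dE (@Ordinal 3 2 isT))].
move=> [e0 e1 e2 e3]; move/eqP: r0; apply; apply/rowP => i; rewrite mxE.
by move: i; elim/ord4_ind.
Qed.

(** The sum s of the three has norm -3 and product -1 with each of them. Adding a vector of norm 4
    orthogonal to all three keeps these products and makes the norm 1; its sign distinguishes the
    two solutions. *)
Lemma desc_complete (v1 v2 v3 : vec) : dot v1 v1 = 1 -> dot v2 v2 = 1 -> dot v3 v3 = 1 ->
  dot v1 v2 = -1 -> dot v2 v3 = -1 -> dot v1 v3 = -1 ->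
  exists q, [/\ desc q, q i1 = v1, q i2 = v2 & q i3 = v3].
Proof.
move=> d11 d22 d33 d12 d23 d13; have [n [n0 n1 n2 n3]] := exists_ortho v1 v2 v3.
pose s := v1 +v (v2 +v v3).
have d21 : dot v2 v1 = -1 by rewrite dotC.
have d32 : dot v3 v2 = -1 by rewrite dotC.
have d31 : dot v3 v1 = -1 by rewrite dotC.
have s1 : dot s v1 = -1 by rewrite !dot_linl d11 d21 d31; ring.
have s2 : dot s v2 = -1 by rewrite !dot_linl d12 d22 d32; ring.
have s3 : dot s v3 = -1 by rewrite !dot_linl d13 d23 d33; ring.
have ss : dot s s = -3 by rewrite {2}/s !dot_linr s1 s2 s3; ring.
have ns : dot n s = 0 by rewrite !dot_linr n1 n2 n3; ring.
have nn : 0 < dot n n by apply: (ortho_timelike _ ns n0); rewrite ss; lra.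
clearbody s; pose t := 2 / Num.sqrt (dot n n).
have tE : t ^+ 2 * dot n n = 4.
  rewrite /t expr_div_n sqr_sqrtr ?(ltW nn) // divfK ?lt0r_neq0 //; ring.
pose v0 := lin 1 s t n.
have d00 : dot v0 v0 = 1.
  rewrite dot_linl !dot_linr ss (dotC s) ns; move: tE; lra.
have d01 : dot v0 v1 = -1 by rewrite dot_linl s1 n1; ring.
have d02 : dot v0 v2 = -1 by rewrite dot_linl s2 n2; ring.
have d03 : dot v0 v3 = -1 by rewrite dot_linl s3 n3; ring.
pose q (i : 'I_4) := nth vec0 [:: v0; v1; v2; v3] i.
exists q; split => //; elim/ord4_ind; elim/ord4_ind; rewrite /q //= ?(dotC _ v0) //.
Qed.

(** * The vectors of an Apollonian packing *)

(** A point common to all three would be the contact point u + v, but w has product -2 with that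
    vector. *)
Lemma mutually_tangent_dot (u v w : vec) : dot u u = 1 -> dot v v = 1 -> dot w w = 1 ->
  dot u v = -1 -> dot v w = -1 -> dot u w = -1 -> mutually_tangent (Zs u) (Zs v) (Zs w).
Proof.
move=> u1 v1 w1 uv vw uw.
have neq (x y z : vec) : dot x z = -1 -> dot y z = -1 -> x <> opp y.
  by move=> xz yz e; move: xz; rewrite e dot_oppl yz; lra.
have [nuv nvw nuw] : [/\ u <> opp v, v <> opp w & u <> opp w].
  by split; [apply: (neq _ _ w) | apply: (neq _ _ u) | apply: (neq _ _ v)] => //; rewrite dotC.
split; try exact: tangent_dot.
apply/seteqP; split=> // x [[/ZsP ux /ZsP vx] /ZsP wx].
have nn := add_null u1 v1 uv; have n0 := add_neq0 nuv.
have xE : x = pt (u +v v) by apply: pt_uniq => //; rewrite dot_linl ux vx; ring.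
have [k k0 kE] := null_pt nn n0.
have := kE w; rewrite -xE wx mulr0 dot_linr (dotC w u) (dotC w v) uw vw; lra.
Qed.

Lemma common_point (u v w : vec) : dot u u = 1 -> dot v v = 1 ->
  dot u v = -1 -> u <> opp v -> dot w u = - dot w v ->
  let x := pt (u +v v) in [/\ Zs u x, Zs v x & Zs w x].
Proof.
move=> u1 v1 uv nuv wuv /=; have [h1 h2] := tangent_pt u1 v1 uv nuv; split => //.
apply: pt_in; [exact: add_null | exact: add_neq0 |].
by rewrite dot_linr wuv; ring.
Qed.

Lemma null_fut (n : vec) : dot n n = 0 -> fut n \/ fut (opp n).
Proof.
case: n => a x y c; rewrite /fut /dot /= => nn.
have ac : 0 <= a * c by have := sqr_ge0 x; have := sqr_ge0 y; lra.
have [a0|a0] := leP 0 a; have [c0|c0] := leP 0 c.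
- by left; split => //; lra.
- by right; split; [lra|nra|lra].
- by right; split; [lra|lra|nra].
- by right; split; lra.
Qed.

(** Signs of v2 and v3 are chosen against v1. Were the remaining product 1, the contact point of the
    first two circles would lie on the third. A common sign change finally makes v1 + v2
    future-directed. *)
Lemma oriented_triple C1 C2 C3 : is_circle C1 -> is_circle C2 -> is_circle C3 ->
  mutually_tangent C1 C2 C3 -> exists v1 v2 v3,
  [/\ C1 = Zs v1, C2 = Zs v2 & C3 = Zs v3] /\
  [/\ dot v1 v1 = 1, dot v2 v2 = 1 & dot v3 v3 = 1] /\
  [/\ dot v1 v2 = -1, dot v2 v3 = -1, dot v1 v3 = -1 & fut (v1 +v v2)].
Proof.
move=> /is_circleE[v1 [u1 ->]] /is_circleE[v2 [u2 ->]] /is_circleE[v3 [u3 ->]] [t12 t23 t13 e0].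
wlog d12 : v2 u2 t12 t23 e0 / dot v1 v2 = -1.
  move=> h; have [d|d] := dot_tangent u1 u2 t12; first exact: (h v2).
  have := h (opp v2); rewrite Zs_opp; apply => //; first by rewrite dot_oppl dot_oppr u2 opprK.
  by rewrite dot_oppr d.
wlog d13 : v3 u3 t23 t13 e0 / dot v1 v3 = -1.
  move=> h; have [d|d] := dot_tangent u1 u3 t13; first exact: (h v3).
  have := h (opp v3); rewrite Zs_opp; apply => //; first by rewrite dot_oppl dot_oppr u3 opprK.
  by rewrite dot_oppr d.
have [n12 n12'] := tangent_neq u1 t12.
have d23 : dot v2 v3 = -1.
  have [//|d] := dot_tangent u2 u3 t23; exfalso.
  have [] := common_point (w := v3) u1 u2 d12 n12'; first by rewrite dotC d13 dotC d.
  move=> h1 h2 h3; have : (set0 : set (sphere R)) (pt (v1 +v v2)) by rewrite -e0.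
  by [].
have nn := add_null u1 u2 d12; have n0 := add_neq0 n12'.
have [f|nf] := pselect (fut (v1 +v v2)); first by exists v1, v2, v3.
exists (opp v1), (opp v2), (opp v3); rewrite !Zs_opp !dot_oppl !dot_oppr !opprK.
split => //; split => //; split => //.
have [//|] := null_fut nn; congr fut.
by apply: vecP; rewrite /=; ring.
Qed.

(** The product signs put the contact points of d with b and with c on the circle a. As d meets a
    only once, they coincide in a point of all of a, b and c. *)
Lemma mixed_signs (a b c d : vec) : dot b b = 1 -> dot c c = 1 -> dot d d = 1 ->
  dot a b = -1 -> dot a c = -1 -> dot d a = 1 -> dot d b = -1 -> dot d c = -1 ->
  tangent (Zs d) (Zs a) -> d <> opp b -> d <> opp c ->
  (forall x, Zs a x -> Zs b x -> Zs c x -> False) -> False.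
Proof.
move=> b1 c1 d1 ab ac da db dc [x0 [_ uniq]] ndb ndc none.
have ad : dot a d = 1 by rewrite dotC.
have [p1 p2 p3] := common_point (w := a) d1 b1 db ndb (etrans ad (esym (etrans (congr1 _ ab) (opprK 1)))).
have [q1 q2 q3] := common_point (w := a) d1 c1 dc ndc (etrans ad (esym (etrans (congr1 _ ac) (opprK 1)))).
apply: (none x0); first by rewrite (uniq _ (conj p1 p3)).
  by rewrite (uniq _ (conj p1 p3)).
by rewrite (uniq _ (conj q1 q3)).
Qed.

Lemma desc_neq_opp (q : @quad R) (i j : 'I_4) : desc q -> i != j -> q i <> opp (q j).
Proof.
move=> dq ij e.
have [k [ki kj]] : exists k, k != i /\ k != j.
  by move: i j ij {e}; elim/ord4_ind; elim/ord4_ind => // _;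
    [exists i2|exists i1|exists i1|exists i2|exists i0|exists i0|exists i1|exists i0|exists i0|exists i1|exists i0|exists i0].
have h1 := dq i k; have h2 := dq j k; rewrite eq_sym (negbTE ki) in h1.
rewrite eq_sym (negbTE kj) in h2; move: h1; rewrite e dot_oppl h2; lra.
Qed.

Section Packing.
Variables (C1 C2 C3 : set (sphere R)) (q : @quad R).
Hypotheses (dq : desc q) (q1 : C1 = Zs (q i1)) (q2 : C2 = Zs (q i2)) (q3 : C3 = Zs (q i3)).

Lemma generated_desc (r : @quad R) (i : 'I_4) : desc r ->
  (forall j, j != i -> generated C1 C2 C3 (Zs (r j))) -> generated C1 C2 C3 (Zs (r i)).
Proof.
move=> dr h.
have [j [k [l [ji ki li [jk kl jl]]]]] : exists j k l, [/\ j != i, k != i, l != i & [/\ j != k, k != l & j != l]].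
  by clear; move: i; elim/ord4_ind; [exists i1, i2, i3 | exists i0, i2, i3 | exists i0, i1, i3 | exists i0, i1, i2].
have tg m : m != i -> tangent (Zs (r i)) (Zs (r m)).
  move=> mi; apply: tangent_dot; rewrite ?dr ?eqxx // 1?eq_sym ?(negbTE mi) //.
  by apply: desc_neq_opp; rewrite // eq_sym.
apply: (@generated_step _ _ _ _ (Zs (r j)) (Zs (r k)) (Zs (r l))); try exact: h; try exact: tg.
  by apply: mutually_tangent_dot; rewrite dr ?eqxx ?(negbTE jk) ?(negbTE kl) ?(negbTE jl).
by apply/is_circleE; exists (r i); rewrite dr eqxx.
Qed.

Lemma generated_run (u : seq 'I_4) (i : 'I_4) : generated C1 C2 C3 (Zs (run u q i)).
Proof.
elim/last_ind: u i => [|u j IH] i; last first.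
  rewrite run_rcons; have [ij|ij] := eqVneq i j; last by rewrite /flip (negbTE ij).
  apply: generated_desc; first by apply: desc_flip; apply: desc_run.
  by move=> k; rewrite ij /flip => /negbTE ->; apply: IH.
have g (k : 'I_4) : k != i0 -> generated C1 C2 C3 (Zs (q k)).
  move: k; elim/ord4_ind => // _; rewrite -?q1 -?q2 -?q3; by constructor.
have [->|] := eqVneq i i0; last exact: g.
exact: generated_desc.
Qed.

(** A new circle has product 1 or -1 with each of three orbit vectors; one of d and - d has product
    -1 with two of them. The third cannot be 1 by [mixed_signs], and [orbit_closed] applies. *)
Lemma generated_orbit C : generated C1 C2 C3 C <-> exists2 w, orbit q w & C = Zs w.
Proof.
split; last by case=> _ [u [i ->]] ->; apply: generated_run.
have o i : orbit q (q i) by exists [::], i.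
elim=> [|||A B C' D _ [a oa ->] _ [b ob ->] _ [c oc ->] [tab tbc tac e0] /is_circleE[d [d1 ->]] tda tdb tdc].
- by rewrite q1; exists (q i1).
- by rewrite q2; exists (q i2).
- by rewrite q3; exists (q i3).
have [a1 b1 c1] := And3 (orbit_unit dq oa) (orbit_unit dq ob) (orbit_unit dq oc).
have dm1 x y : orbit q x -> orbit q y -> tangent (Zs x) (Zs y) -> dot x y = -1.
  move=> ox oy t; have [x1 y1] := (orbit_unit dq ox, orbit_unit dq oy).
  have [nxy _] := tangent_neq x1 t; have [//|e] := dot_tangent x1 y1 t.
  by have := orbit_dot dq ox oy nxy; rewrite e; lra.
have [ab bc ac] := And3 (dm1 _ _ oa ob tab) (dm1 _ _ ob oc tbc) (dm1 _ _ oa oc tac).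
have none x : Zs a x -> Zs b x -> Zs c x -> False.
  by move=> h1 h2 h3; have : (set0 : set (sphere R)) x by rewrite -e0.
pose two d' := (dot d' a = -1 /\ dot d' b = -1) \/ (dot d' a = -1 /\ dot d' c = -1) \/
    (dot d' b = -1 /\ dot d' c = -1).
suff main d' : dot d' d' = 1 -> tangent (Zs d') (Zs a) -> tangent (Zs d') (Zs b) ->
    tangent (Zs d') (Zs c) -> two d' -> orbit q d'.
  have [h|h] : two d \/ two (opp d).
  - rewrite /two !dot_oppl; have [->|->] := dot_tangent d1 a1 tda;
    have [->|->] := dot_tangent d1 b1 tdb; have [->|->] := dot_tangent d1 c1 tdc; tauto.
  - by exists d => //; apply: main.
  - exists (opp d); rewrite ?Zs_opp //; apply: main => //; rewrite ?Zs_opp //.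
    by rewrite dot_oppl dot_oppr opprK.
move=> d1' ta tb tc.
have [[_ nda] [_ ndb] [_ ndc]] := And3 (tangent_neq d1' ta) (tangent_neq d1' tb) (tangent_neq d1' tc).
have [ba cb ca] := And3 (etrans (dotC b a) ab) (etrans (dotC c b) bc) (etrans (dotC c a) ac).
have [da|da] := dot_tangent d1' a1 ta; have [db|db] := dot_tangent d1' b1 tb;
  have [dc|dc] := dot_tangent d1' c1 tc.
- by move=> _; apply: (orbit_closed dq oa ob oc).
- by move=> _; exfalso; apply: (@mixed_signs c a b d') => // x h1 h2 h3; apply: (none x).
- by move=> _; exfalso; apply: (@mixed_signs b a c d') => // x h1 h2 h3; apply: (none x).
- by rewrite /two da db dc => -[[]|[[]|[]]]; lra.
- by move=> _; exfalso; apply: (@mixed_signs a b c d') => // x h1 h2 h3; apply: (none x).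
- by rewrite /two da db dc => -[[]|[[]|[]]]; lra.
- by rewrite /two da db dc => -[[]|[[]|[]]]; lra.
- by rewrite /two da db dc => -[[]|[[]|[]]]; lra.
Qed.

(** For distinct members, x + y and y + z have product at most -2, so the time orientation passes
    from one pair to any pair sharing a member, and hence to all pairs. *)
Lemma orbit_fut v w : fut (q i1 +v q i2) -> orbit q v -> orbit q w -> v <> w -> fut (v +v w).
Proof.
move=> f0 ov ow vw.
have o i : orbit q (q i) by exists [::], i.
have neq12 : q i1 <> q i2 by move=> e; have := dq i1 i2; rewrite -e dq /=; lra.
have step (x y z : vec) : orbit q x -> orbit q y -> orbit q z -> x <> y -> y <> z -> x <> z ->
    fut (x +v y) -> fut (y +v z).
  move=> ox oy oz xy yz xz f; apply: (fut_same f).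
    rewrite dot_linl !dot_linr (dotC z y) !(orbit_unit dq) //.
    by have := orbit_dot dq oy oz yz; lra.
  rewrite dot_linl !dot_linr (orbit_unit dq oy).
  have := orbit_dot dq oy oz yz; have := orbit_dot dq ox oy xy; have := orbit_dot dq ox oz xz; lra.
have comm x y : fut (x +v y) -> fut (y +v x).
  by congr fut; apply: vecP; rewrite /=; ring.
have f1 x : orbit q x -> x <> q i1 -> fut (q i1 +v x).
  move=> ox x1; have [->//|x2] := pselect (x = q i2).
  by apply: (step (q i2)) => //; [move=> e; apply: neq12 | apply: nesym | apply: nesym | apply: comm].
have [e|v1] := pselect (v = q i1).
  by rewrite e; apply: f1 => // e'; apply: vw; rewrite e e'.
have [e|w1] := pselect (w = q i1); first by rewrite e; apply: comm; apply: f1.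
by apply: (step (q i1)) => //; [apply: nesym | apply: nesym | apply: f1].
Qed.

End Packing.

Lemma packing_orbit P : apollonian_packing P -> exists q, [/\ desc q,
  P = [set C | exists2 w, orbit q w & C = Zs w] &
  forall v w, orbit q v -> orbit q w -> v <> w -> fut (v +v w)].
Proof.
move=> [C1 [C2 [C3 [c1 c2 c3 mt ->]]]].
have [v1 [v2 [v3 [[-> -> ->] [[u1 u2 u3] [d12 d23 d13 f]]]]]] := oriented_triple c1 c2 c3 mt.
have [q [dq q1 q2 q3]] := desc_complete u1 u2 u3 d12 d23 d13.
exists q; split => //.
  by apply/seteqP; split=> C /=; rewrite (@generated_orbit _ _ _ q) // ?q1 ?q2 ?q3.
by move=> v w ov ow vw; apply: orbit_fut => //; rewrite q1 q2.
Qed.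

End Circles.

(** * The disks tangent to the first circle *)

Lemma unimod_coprime (a b c d : int) : unimod a b c d -> coprime `|a| `|b|.
Proof.
rewrite /unimod => /eqP e; rewrite -coprimezE; apply/coprimezP.
exists ((a * d - b * c) * d, - (a * d - b * c) * c) => /=; rewrite -e; ring.
Qed.

Lemma coprime_unimod (a b : int) : coprime `|a| `|b| -> exists c d, unimod a b c d.
Proof.
rewrite -coprimezE => /coprimezP[[u v] /= e]; exists (- v), u.
by rewrite /unimod (_ : a * u - b * - v = 1) // -e; ring.
Qed.

Definition primitive_disks (R : realType) (q : @quad R) : set (sphere R) :=
  [set x | exists a b : int, coprime `|a| `|b| /\ Ns (fv q a b) x].

Section TangentDisks.
Context {R : realType}.
Variables (P : set (set (sphere R))) (q : @quad R).
Hypotheses (dq : desc q) (PE : P = [set C | exists2 w, orbit q w & C = Zs w]).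
Hypothesis fq : forall v w, orbit q v -> orbit q w -> v <> w -> fut (v +v w).

Lemma orbit_coprime (a b : int) : coprime `|a| `|b| -> orbit q (fv q a b).
Proof. by move=> /coprime_unimod[c [d u]]; apply: orbit_fv u. Qed.

Lemma orbit_base i : orbit q (q i).
Proof. by exists [::], i. Qed.

Lemma orbit_other_side w w' z : orbit q w -> orbit q w' -> w <> w' -> Zs w' z -> 0 <= fz w z.
Proof.
move=> ow ow' ww; rewrite /Zs /mkset => z0.
by have := fut_ge0 z (fq ow ow' ww); rewrite fz_lin z0; lra.
Qed.

Lemma orbit_far_side w : orbit q w -> exists w', [/\ orbit q w', w' <> w, w' <> opp w &
  forall z, Zs w' z -> 0 < fz w z].
Proof.
move=> ow; have [w' ow' d] := orbit_far dq ow; exists w'.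
have w1 := orbit_unit dq ow.
have ww : w' <> w by move=> e; move: d; rewrite e w1; lra.
split => //; first by move=> e; move: d; rewrite e dot_oppr w1; lra.
move=> z; rewrite /Zs /mkset => z0.
have := fut_gt0 z (fq ow ow' (nesym ww)); rewrite fz_lin z0 dot_linl !dot_linr (dotC w' w).
rewrite w1 (orbit_unit dq ow'); lra.
Qed.

(** Of the two sides of a member, the positive one contains a whole circle of the packing by
    [orbit_far_side], and the negative one meets no other circle by [orbit_other_side]; so the disk
    is the negative side. *)
Lemma tangent_disksE : tangent_disks P (Zs (q i0)) = primitive_disks q.
Proof.
have q1 : dot (q i0) (q i0) = 1 by rewrite dq eqxx.
apply/seteqP; split=> x.
  move=> [D [C [PC tC [/is_sideE [v [v1 CE DE]] nD]] Dx]].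
  move: PC; rewrite PE => -[w ow Cw].
  have w1 := orbit_unit dq ow.
  rewrite Cw in tC; have [wq _] := tangent_neq w1 tC.
  have dw : dot w (q i0) = -1.
    have [//|e] := dot_tangent w1 q1 tC.
    by have := orbit_dot dq ow (orbit_base i0) wq; rewrite e; lra.
  have [a [b [c [d [u wE]]]]] := orbit_tangent0 dq ow dw.
  exists a, b; split; first exact: unimod_coprime u.
  rewrite -wE; have [vw|vw] := Zs_inj v1 w1 (etrans (esym CE) Cw); first by rewrite -vw -DE.
  exfalso; have [w' [ow' ww ww' far]] := orbit_far_side ow.
  apply: (nD (Zs w')).
  - by rewrite PE; exists w'.
  - by rewrite Cw => /(Zs_inj (orbit_unit dq ow') w1) [].
  - by move=> z /far h; rewrite DE vw /Ns /mkset fz_opp oppr_lt0.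
move=> [a [b [cop Nx]]].
have ow := orbit_coprime cop; set w := fv q a b in ow Nx.
have w1 := orbit_unit dq ow.
exists (Ns w) => //; exists (Zs w); split.
- by rewrite PE; exists w.
- apply: tangent_dot => //; first exact: dot_fv0.
  move=> e; have := orbit_dot dq ow (orbit_base i1).
  have [e1 _|ne /(_ ne)] := pselect (w = q i1).
    by apply: (@desc_neq_opp _ q i0 i1 dq) => //; rewrite -e1 e oppK.
  by rewrite e dot_oppl dq /=; lra.
split; first by apply/is_sideE; exists w.
move=> C'; rewrite PE => -[w' ow' ->] CC sub.
have ww : w <> w' by move=> e; apply: CC; rewrite e.
have [z [_ [zw _ _]]] := Zs_two (orbit_unit dq ow').
have := orbit_other_side ow ow' ww zw; have := sub z zw.
by rewrite /Ns /mkset => /lt_geF ->.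
Qed.

(** A nonzero determinant makes the vectors distinct by [dot_fv]; their sum is then future-directed,
    hence nonnegative at every point. *)
Lemma fv_disjoint (a b c d : int) x : coprime `|a| `|b| -> coprime `|c| `|d| ->
  a * d - b * c != 0 -> Ns (fv q a b) x -> Ns (fv q c d) x -> False.
Proof.
move=> ab cd det h1 h2; have o1 := orbit_coprime ab; have o2 := orbit_coprime cd.
have ne : fv q a b <> fv q c d.
  move=> e; have := dot_fv a b c d dq; rewrite e (orbit_unit dq o2) => /eqP.
  rewrite eq_sym subr_eq addrC -subr_eq subrr eq_sym mulf_eq0 pnatr_eq0 /= sqrf_eq0.
  by rewrite intr_eq0 (negbTE det).
have := fut_ge0 x (fq o1 o2 ne); rewrite fz_lin !mul1r leNgt.
by rewrite -[X in _ < X]addr0 ltrD.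
Qed.

Lemma fv_fut (a b : int) : coprime `|a| `|b| ->
  fut (q i0 +v fv q a b) /\ dot (q i0 +v fv q a b) (q i0 +v fv q a b) = 0.
Proof.
move=> ab; have o1 := orbit_coprime ab; have d0 := dot_fv0 a b dq.
have q1 : dot (q i0) (q i0) = 1 by rewrite dq eqxx.
split; first apply: fq => //; first exact: orbit_base.
  by move=> e; move: d0; rewrite -e q1; lra.
by apply: add_null => //; [exact: orbit_unit o1 | rewrite dotC].
Qed.

Lemma base_side C z : P C -> C z -> 0 <= fz (q i0) z.
Proof.
rewrite PE => -[w ow ->] zw; have [e|ne] := pselect (q i0 = w).
  by rewrite e (zw : fz w z = 0).
by apply: (orbit_other_side (orbit_base i0) ow ne).
Qed.

Lemma base_far : exists C z, [/\ P C, C z & 0 < fz (q i0) z].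
Proof.
have [w [ow _ _ h]] := orbit_far_side (orbit_base i0).
have [z [_ [zw _ _]]] := Zs_two (orbit_unit dq ow).
by exists (Zs w), z; split => //; [rewrite PE; exists w | apply: h].
Qed.

End TangentDisks.

Lemma packing_base (R : realType) (P : set (set (sphere R))) C0 : apollonian_packing P -> P C0 ->
  exists q, [/\ desc q, P = [set C | exists2 w, orbit q w & C = Zs w],
    forall v w, orbit q v -> orbit q w -> v <> w -> fut (v +v w) & C0 = Zs (q i0)].
Proof.
move=> /packing_orbit[q [dq PE fq]]; rewrite {1}PE => -[w ow ->].
have [q' [dq' oq' q'w]] := orbit_rebase dq ow.
by exists q'; rewrite oq' q'w.
Qed.

(** * Equidistant circles *)

Lemma cvg_right_EFin (R : realType) (f : R -> \bar R) (l : R) :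
  (forall e, 0 < e -> \forall t \near 0^'+, exists2 m : R, f t = m%:E & `|l - m| <= e) ->
  f t @[t --> 0^'+] --> l%:E.
Proof.
move=> h; apply/fine_cvgP; split.
  by apply: filterS (h 1 ltr01) => t [m -> _].
apply/cvgrPdist_le => e e0; apply: filterS (h e e0) => t [m + le].
by rewrite /= => ->.
Qed.

(** With phi in [pi, 3 pi], an arc of half-width at most pi about phi meets [0, 2 pi] only directly
    or after the single shift by - 2 pi. *)
Lemma angle_of_unit (R : realType) (x y : R) : x ^+ 2 + y ^+ 2 = 1 ->
  exists2 phi, pi <= phi <= 3 * pi & cos phi = x /\ sin phi = y.
Proof.
move=> e; have x1 : -1 <= x <= 1.
  by have := sqr_ge0 y; have := sqr_ge0 (x - 1); have := sqr_ge0 (x + 1); nra.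
have xi : x \in `[(-1), 1] by rewrite in_itv.
have := acos_ge0 x1; have := acos_lepi x1; have ca := acosK xi; have sa := sin_acos x1.
have sE : Num.sqrt (1 - x ^+ 2) = `|y| by rewrite -e addrAC subrr add0r sqrtr_sqr.
rewrite sE in sa; move: (acos x) ca sa => a ca sa api a0.
have pe : 2 * pi = pi *+ 2 :> R by rewrite mulr_natl.
have [y0|y0] := leP 0 y.
  exists (a + 2 * pi); first by have := pi_ge0 R; lra.
  by rewrite pe cosD2pi sinD2pi ca sa ger0_norm.
exists (- a + 2 * pi); first by have := pi_ge0 R; lra.
by rewrite pe cosD2pi sinD2pi cosN sinN ca sa ltr0_norm // opprK.
Qed.

Section ArcMeasure.
Context {R : realType}.
Local Notation mu := (@lebesgue_measure R).

Lemma arc_measure (phi c : R) : pi <= phi <= 3 * pi -> -1 <= c <= 1 ->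
  let S := `[0, 2 * pi]%classic `&` [set t | c < cos (t - phi)] in
  measurable S /\ mu S = (2 * acos c)%:E.
Proof.
move=> phip c1 S; set al := acos c.
have ci : c \in `[(-1), 1] by rewrite in_itv.
have a0 : 0 <= al := acos_ge0 c1; have api : al <= pi := acos_lepi c1.
have ca : cos al = c := acosK ci.
have pp := pi_gt0 R.
have pe : 2 * pi = pi *+ 2 :> R by rewrite mulr_natl.
have cl x : `|x| <= pi -> (c < cos x) = (`|x| < al).
  by move=> xp; rewrite -ca -(cos_norm x) ltr_cos ?in_itv /= ?normr_ge0 ?xp ?a0.
have cE t : 0 <= t <= 2 * pi ->
    (c < cos (t - phi)) = (`|t - phi| < al) || (`|t - phi + 2 * pi| < al).
  move=> tp; have [h|h] := leP `|t - phi| pi.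
    rewrite cl // orbC; case: (ltP `|t - phi + 2 * pi| al) => // h'.
    by move: h h'; rewrite ler_norml !ltr_norml; lra.
  have h2 : `|t - phi + 2 * pi| <= pi.
    by move: h; rewrite ltNge !ler_norml => /negP h; apply/andP; split; lra.
  rewrite -[in LHS](cosD2pi (t - phi)) -pe cl //.
  by rewrite [`|t - phi| < al]ltNge (le_trans api (ltW h)).
have SE t : S t <-> (0 <= t <= 2 * pi) /\
    ((phi - al < t < phi + al) \/ (phi - 2 * pi - al < t < phi - 2 * pi + al)).
  rewrite /S /= in_itv /=; split=> [[tp]|[tp h]].
    by rewrite cE // !ltr_norml => /orP h; split => //; case: h => h; [left|right]; lra.
  split => //; rewrite cE // !ltr_norml; apply/orP; case: h => h; [left|right]; lra.
have itv (x : R) : measurable `]x - al, x + al[%classic /\ mu `]x - al, x + al[%classic = (2 * al)%:E.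
  split; first exact: measurable_itv.
  rewrite lebesgue_measure_itv /= lte_fin; case: ifPn; first by move=> _; rewrite -EFinD; congr EFin; ring.
  by rewrite -leNgt => h; congr EFin; lra.
have [hA|hA] := leP (phi + al) (2 * pi).
  have -> : S = `]phi - al, phi + al[%classic.
    apply/seteqP; split=> t; rewrite SE /= in_itv /=; first by move=> [h1 [|]] h2; lra.
    by move=> h; split; [lra|left; lra].
  exact: itv.
have [hB|hB] := leP (2 * pi) (phi - al).
  have -> : S = `]phi - 2 * pi - al, phi - 2 * pi + al[%classic.
    apply/seteqP; split=> t; rewrite SE /= in_itv /=; first by move=> [h1 [|]] h2; lra.
    by move=> h; split; [lra|right; lra].
  exact: itv.
have -> : S = `]phi - al, 2 * pi]%classic `|` `[0, phi - 2 * pi + al[%classic.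
  apply/seteqP; split=> t; rewrite SE /= !in_itv /=; first by move=> [h1 [|]] h2; [left|right]; lra.
  by move=> [|] h; (split; first lra); [left|right]; lra.
split; first by apply: measurableU; exact: measurable_itv.
pose I1 : set R := `]phi - al, 2 * pi]%classic.
pose I2 : set R := `[0, phi - 2 * pi + al[%classic.
transitivity (mu I1 + mu I2)%E.
  apply: measureU; [exact: measurable_itv|exact: measurable_itv|].
  by apply/seteqP; split=> // t [] /=; rewrite !in_itv /=; lra.
rewrite /I1 /I2 !lebesgue_measure_itv /= !lte_fin !ifT; [|lra|lra].
by rewrite -!EFinD; congr EFin; ring.
Qed.

(** For al = acos c, y is the chord 2 sin (al / 2) and 1 - y^2 / 4 is cos^2 (al / 2); the second
    bound weakens a cosine to its square to stay free of roots. *)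
Lemma acos_chord (c : R) : -1 <= c <= 1 -> let y := Num.sqrt (2 * (1 - c)) in
  y <= acos c /\ acos c * (1 - y ^+ 2 / 4) <= y.
Proof.
move=> c1 y; set al := acos c.
have ci : c \in `[(-1), 1] by rewrite in_itv.
have a0 : 0 <= al := acos_ge0 c1; have api : al <= pi := acos_lepi c1.
have ca : cos al = c := acosK ci.
have half : al = (al / 2) *+ 2 by rewrite -mulr_natr divfK.
have cs : c = 1 - 2 * sin (al / 2) ^+ 2.
  by rewrite -ca half cos_mulr2n cos2sin2 -half; rewrite -mulr_natl; ring.
have s0 : 0 <= sin (al / 2) by apply: sin_ge0_pi; have := pi_ge0 R; lra.
have yE : y = 2 * sin (al / 2).
  rewrite /y cs -[RHS]ger0_norm ?mulr_ge0 // -sqrtr_sqr; congr Num.sqrt; ring.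
split; first by rewrite yE; have := @sin_le_id R (al / 2) (divr_ge0 a0 (ler0n _ 2)); lra.
have c0 : 0 <= cos (al / 2) by apply: cos_ge0_pihalf; have := pi_ge0 R; lra.
have h : al / 2 * cos (al / 2) <= sin (al / 2) by apply: id_cos_le_sin; lra.
have -> : 1 - y ^+ 2 / 4 = cos (al / 2) ^+ 2 by rewrite yE cos2sin2; field.
have : cos (al / 2) ^+ 2 <= cos (al / 2) by rewrite expr2 ler_piMr // cos_le1.
by move=> h2; rewrite yE; have := ler_wpM2l a0 h2; lra.
Qed.

End ArcMeasure.

(** The integral of s / (A x^2 + B x + C) over the real line, split into |x| <= 1 and the rest,
    which x -> - 1 / x folds back. Here the addition formulas show that the sum T has sine 0, and 0
    < T < 2 pi. *)
Lemma atan_sum_pi (R : realType) (A B C s : R) : 0 < A -> 0 < C -> 0 < s ->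
  A * C - B ^+ 2 / 4 = s ^+ 2 ->
  atan ((A + B / 2) / s) + atan ((A - B / 2) / s) +
  (atan ((C - B / 2) / s) + atan ((C + B / 2) / s)) = pi.
Proof.
move=> A0 C0 s0 e.
have sum (u v : R) : 0 < u + v -> 0 < atan u + atan v < pi.
  move=> uv; have := atan_ltpi2 u; have := atan_ltpi2 v.
  have : atan (- v) < atan u by apply: lt_atan; lra.
  by rewrite atanN; lra.
have sn : s != 0 by rewrite lt0r_neq0.
have h1 := sum ((A + B / 2) / s) ((A - B / 2) / s).
have h2 := sum ((C - B / 2) / s) ((C + B / 2) / s).
have e1 : (A + B / 2) / s + (A - B / 2) / s = 2 * A / s by field.
have e2 : (C - B / 2) / s + (C + B / 2) / s = 2 * C / s by field.
rewrite e1 divr_gt0 ?mulr_gt0 // in h1; rewrite e2 divr_gt0 ?mulr_gt0 // in h2.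
have {h1} h1 := h1 isT; have {h2} h2 := h2 isT.
set u := (A + B / 2) / s in e1 h1 *; set v := (A - B / 2) / s in e1 h1 *.
set u' := (C - B / 2) / s in e2 h2 *; set v' := (C + B / 2) / s in e2 h2 *.
have sinE x : sin (atan x) = x * cos (atan x) :> R.
  have c0 : cos (atan x) != 0.
    by rewrite cos_atan invr_eq0 gt_eqF // sqrtr_gt0 ltr_wpDr ?sqr_ge0.
  by rewrite -{2}(atanK x) /tan divfK.
set T := _ + _.
have T0 : sin T = 0.
  rewrite /T sinD (sinD (atan u)) (cosD (atan u')) (cosD (atan u)) (sinD (atan u')) !sinE.
  have br : (u + v) * (1 - u' * v') + (1 - u * v) * (u' + v') = 0.
    rewrite e1 e2 /u /v /u' /v'.
    have -> : 2 * A / s * (1 - (C - B / 2) / s * ((C + B / 2) / s)) +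
      (1 - (A + B / 2) / s * ((A - B / 2) / s)) * (2 * C / s) =
      2 / s ^+ 3 * (A * (s ^+ 2 - C ^+ 2 + B ^+ 2 / 4) + C * (s ^+ 2 - A ^+ 2 + B ^+ 2 / 4)) by field.
    by rewrite -e; field.
  move: (cos _) (cos _) (cos _) (cos _) => c1 c2 c3 c4.
  transitivity (c1 * c2 * c3 * c4 * ((u + v) * (1 - u' * v') + (1 - u * v) * (u' + v'))); last by rewrite br mulr0.
  by ring.
have T1 : 0 < T < 2 * pi by rewrite /T; lra.
have [l|g|//] := ltgtP T pi.
  by have := @sin_gt0_pi R T; rewrite T0; lra.
have := @sin_gt0_pi R (T - pi); have := sinDpi (T - pi); rewrite subrK T0; lra.
Qed.

Lemma derive_lipschitz (R : realType) (f sg : R -> R) (A B K : R) :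
  (forall x : R, A <= x <= B -> is_derive x (1 : R) sg (f x)) ->
  (forall x y, A <= x <= B -> A <= y <= B -> `|f x - f y| <= K * `|x - y|) -> 0 <= K ->
  forall x y, A <= x -> x <= y -> y <= B ->
  `|sg y - sg x - (y - x) * f x| <= K * (y - x) ^+ 2.
Proof.
move=> df lf K0 x y Ax xy yB.
have cs : {within `[x, y], continuous sg}.
  apply: derivable_within_continuous => z; rewrite in_itv /= => /andP[xz zy].
  by have [] := df z; [rewrite (le_trans Ax xz) (le_trans zy yB) | ].
have ds z : z \in `]x, y[%R -> is_derive z (1 : R) sg (f z).
  rewrite in_itv /= => /andP[xz zy]; apply: df.
  by rewrite (le_trans Ax (ltW xz)) (le_trans (ltW zy) yB).
have [c] := MVT_segment xy ds cs; rewrite in_itv /= => /andP[xc cy] ->.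
rewrite mulrC -mulrBr normrM ger0_norm ?subr_ge0 //.
apply: (@le_trans _ _ ((y - x) * (K * `|c - x|))).
  by rewrite ler_wpM2l ?subr_ge0 //; apply: lf; rewrite ?Ax ?(le_trans Ax xc) ?(le_trans cy yB) ?(le_trans xy yB).
rewrite ger0_norm ?subr_ge0 // expr2 mulrCA ler_wpM2l // ler_wpM2l ?subr_ge0 // lerB //.
Qed.

(** * The weight of a definite quadratic form *)

Section Quadratic.
Context {R : realType}.
Variables (A B C s : R).
Hypotheses (A0 : 0 < A) (s0 : 0 < s) (De : A * C - B ^+ 2 / 4 = s ^+ 2).

Let w (x : R) := A * x ^+ 2 + B * x + C.

Lemma quadratic_ge x : s ^+ 2 / A <= w x.
Proof.
rewrite ler_pdivrMr // /w -De; have := sqr_ge0 (A * x + B / 2); lra.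
Qed.

Lemma quadratic_gt0 x : 0 < w x.
Proof. by apply: lt_le_trans (quadratic_ge x); rewrite divr_gt0 ?exprn_gt0. Qed.

Lemma quadratic_psum : forall e : R, 0 < e -> exists X0, forall X N, X0 <= X ->
  X * (A / s ^+ 2 + 1) <= N%:R ^+ 2 ->
  `|psum (-1) 1 (fun x => (w x)^-1) N X -
    kappa * (s^-1 * (atan ((A + B / 2) / s) + atan ((A - B / 2) / s))) * X| <= e * X.
Proof.
(* An antiderivative of 1 / w, by completing the square: A w = s^2 + (A x + B / 2)^2. *)
move=> e e0; pose sg x := s^-1 * atan ((A * x + B / 2) / s).
have sn : s != 0 by rewrite lt0r_neq0.
pose M := A / s ^+ 2; pose m := (A + `|B| + `|C|)^-1.
have M0 : 0 < M by rewrite divr_gt0 ?exprn_gt0.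
have wM x : (w x)^-1 <= M.
  by rewrite /M -[A / _]invf_div lef_pV2 ?posrE ?quadratic_gt0 ?divr_gt0 ?exprn_gt0 // quadratic_ge.
have S0 : 0 < A + `|B| + `|C| by rewrite -addrA ltr_wpDr // addr_ge0.
have m0 : 0 < m by rewrite invr_gt0.
have wm (x : R) : -1 <= x <= 1 -> m <= (w x)^-1.
  move=> x1; rewrite /m lef_pV2 ?posrE ?quadratic_gt0 // /w.
  have xn : `|x| <= 1 by rewrite ler_norml.
  have x2 : x ^+ 2 <= 1 by rewrite -real_normK ?num_real // exprn_ile1.
  have Bx : B * x <= `|B| by apply: (le_trans (ler_norm _)); rewrite normrM ler_piMr.
  by rewrite !lerD ?ler_norm // ler_piMr // ltW.
pose K := M ^+ 2 * (2 * A + `|B|).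
have K0 : 0 <= K by rewrite mulr_ge0 ?sqr_ge0 // addr_ge0 // mulr_ge0 // ltW.
have lip (x y : R) : -1 <= x <= 1 -> -1 <= y <= 1 -> `|(w x)^-1 - (w y)^-1| <= K * `|x - y|.
  move=> x1 y1; have [wx wy] := (lt0r_neq0 (quadratic_gt0 x), lt0r_neq0 (quadratic_gt0 y)).
  have -> : (w x)^-1 - (w y)^-1 = ((w x)^-1 * (w y)^-1) * (- (A * (x + y) + B)) * (x - y).
    by rewrite /w in wx wy *; field; rewrite wx wy.
  rewrite normrM ler_wpM2r // normrM /K; apply: ler_pM => //.
    rewrite normrM expr2; apply: ler_pM => //; rewrite gtr0_norm ?invr_gt0 ?quadratic_gt0 //.
  rewrite normrN (le_trans (ler_normD _ _)) // lerD2r normrM (gtr0_norm A0) mulrC ler_pM2r //.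
  by rewrite ler_norml; lra.
have dsg (x : R) : is_derive x (1 : R) sg ((w x)^-1).
  have -> : (w x)^-1 = s^-1 * ((1 + ((A * x + B / 2) / s) ^+ 2)^-1 * (A / s)).
    have wx := lt0r_neq0 (quadratic_gt0 x).
    have e1 : A * w x = s ^+ 2 + (A * x + B / 2) ^+ 2 by rewrite /w -De; field.
    have n1 : s ^+ 2 + (A * x + B / 2) ^+ 2 != 0 by rewrite -e1 mulf_neq0 // lt0r_neq0.
    apply: (mulIf wx); rewrite mulVf //.
    have -> : s^-1 * ((1 + ((A * x + B / 2) / s) ^+ 2)^-1 * (A / s)) * w x =
       (A * w x) / (s ^+ 2 + (A * x + B / 2) ^+ 2).
      move: (w x) (A * x + B / 2) n1 => W y n1; field.
      by rewrite ?sn ?n1 ?addrC ?n1.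
    by rewrite e1 divff.
  rewrite /sg.
  have d1 : is_derive x (1 : R) (fun x => (A * x + B / 2) / s) (A / s).
    by apply: is_derive_eq; rewrite /GRing.scale /= ; ring.
  have d2 := @is_derive1_comp R atan (fun x => (A * x + B / 2) / s) x _ _ (is_derive1_atan _) d1.
  by apply: is_derive_eq; rewrite /GRing.scale /=; ring.
have sgK := derive_lipschitz (fun x _ => dsg x) lip K0.
have e2 : 0 < e / 2 by rewrite divr_gt0.
have fm (x : R) : -1 <= x <= 1 -> m <= (w x)^-1 <= M by move=> /wm ->; rewrite wM.
have [|||X0 h] := @psum_asymp R (-1) 1 m M K _ sg m0 K0 fm lip sgK (e / 2) (-1) 1 e2; rewrite // ?lexx //; try lra.
exists X0 => X N hX hN; have := h X N hX hN.
have -> : sg 1 - sg (-1) = s^-1 * (atan ((A + B / 2) / s) + atan ((A - B / 2) / s)).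
  rewrite /sg mulr1 mulrN1 -mulrBr; congr (_ * (_ + _)); rewrite -atanN; congr atan; field.
  exact: sn.
by have -> : e / 2 * (1 - -1) = e by field.
Qed.

End Quadratic.

Section FamilyMeasure.
Context {R : realType}.
Local Notation mu := (@lebesgue_measure R).
Variables (u v : R) (T : nat -> int -> set R) (m : nat -> int -> R).
Hypothesis Tm : forall q p, (0 < q)%N -> fracs u v q p ->
  measurable (T q p) /\ mu (T q p) = (m q p)%:E.
Hypothesis Td : forall q p q' p' t, (0 < q)%N -> (0 < q')%N -> fracs u v q p -> fracs u v q' p' ->
  T q p t -> T q' p' t -> q = q' /\ p = p'.

Definition family N : set R :=
  [set t | exists q p, [/\ (0 < q < N)%N, fracs u v q p & T q p t]].

Lemma family_measure N : measurable (family N) /\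
  mu (family N) = (\sum_(1 <= q < N) \sum_(p \in fracs u v q) m q p)%:E.
Proof.
elim: N => [|N [mN eN]].
  have -> : family 0 = set0 by apply/seteqP; split=> // t [q [p []]]; rewrite ltn0 andbF.
  by split; [exact: measurable0 | rewrite big_geq // measure0].
have [N0|N0] := posnP N.
  have -> : family N.+1 = set0.
    by apply/seteqP; split=> // t [q [p [/andP[q0 +] _ _]]]; rewrite N0 ltnS leqNgt q0.
  by split; [exact: measurable0 | rewrite N0 big_geq // measure0].
pose W : set R := \bigcup_(p in fracs u v N) T N p.
have mW : measurable W.
  by apply: fin_bigcup_measurable => [|p pf]; [exact: finite_fracs | have [] := Tm N0 pf].
have eW : mu W = (\sum_(p \in fracs u v N) m N p)%:E.
  rewrite /W; etransitivity; first apply: (@measure_fin_bigcup _ _ _ mu).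
  - exact: finite_fracs.
  - move=> p p' pf pf' [t [t1 t2]]; by have [] := Td N0 N0 pf pf' t1 t2.
  - by move=> p pf; have [] := Tm N0 pf.
  rewrite -fsumEFin //; last exact: finite_fracs.
  by apply: eq_fsbigr => p; rewrite inE => pf; have [] := Tm N0 pf.
have E : family N.+1 = family N `|` W.
  apply/seteqP; split=> [t [q [p [/andP[q0 qN] pf Tt]]]|t [[q [p [/andP[q0 qN] pf Tt]]]|[p pf Tt]]].
  - move: qN; rewrite ltnS leq_eqVlt => /orP[/eqP e|qN]; last by left; exists q, p; rewrite q0 qN.
    by right; exists p; rewrite /= -?e.
  - by exists q, p; rewrite q0 ltnS ltnW.
  - by exists N, p; rewrite N0 ltnSn.
rewrite E; split; first exact: measurableU.
rewrite big_nat_recr //= EFinD -eN -eW; apply: measureU => //.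
apply/seteqP; split=> // t [[q [p [/andP[q0 qN] pf Tt]]] [p' pf' Tt']].
by have [e _] := Td q0 N0 pf pf' Tt Tt'; move: qN; rewrite e ltnn.
Qed.

End FamilyMeasure.

Section TangentForm.
Context {R : realType}.
Variable q : @quad R.
Hypothesis dq : desc q.

Definition formA := va (q i0) + va (q i1).
Definition formC := va (q i0) + va (q i2).
Definition formB := va (q i3) - va (q i1) - va (q i2) - va (q i0).

Lemma formE (a b : int) : va (q i0 +v fv q a b) =
  formA * a%:~R ^+ 2 + formB * (a%:~R * b%:~R) + formC * b%:~R ^+ 2.
Proof. by rewrite /formA /formB /formC /=; ring. Qed.

(* Descartes' circle theorem, in the form of the discriminant of the form. *)
Lemma form_disc : formA * formC - formB ^+ 2 / 4 = va (q i0) ^+ 2.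
Proof.
pose d : @vec R := Vec 0 0 0 1.
have dE i : dot d (q i) = - va (q i) / 2 by rewrite /dot /=; field.
have dd : dot d d = 0 by rewrite /dot /=; field.
have := desc_span d dq; rewrite /= !dE => e.
have := dd; rewrite {1 2}e dot_comb // /formA /formB /formC.
move: (va (q i0)) (va (q i1)) (va (q i2)) (va (q i3)) => a b c f; lra.
Qed.

End TangentForm.

(** * Cutting one tangent disk with the equidistant circle *)

Section CircleSlice.
Context {R : realType}.
Variables (q : @quad R) (x0 y0 r0 sg : R).
Hypotheses (dq : desc q) (r0p : 0 < r0) (sg1 : sg ^+ 2 = 1).
Hypothesis q0E : q i0 = lin sg (circ (x0 +i* y0) r0) 0 (circ (x0 +i* y0) r0).

(** The isotropic vector q i0 + fv a b represents F |z - p|^2, with p the contact point at angle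
    phi. The first summand is the law of cosines; the second is [q i0], constant on circles about
    the centre. [sg] is -1 when the packing lies inside the circle. *)
Lemma circle_slice (a b : int) :
  dot (q i0 +v fv q a b) (q i0 +v fv q a b) = 0 -> 0 < va (q i0 +v fv q a b) ->
  exists2 phi, pi <= phi <= 3 * pi & forall t rho,
    fz (fv q a b) (Some ((x0 +i* y0) + rho%:C * (cos t +i* sin t))) =
    va (q i0 +v fv q a b) * ((rho - r0) ^+ 2 + 2 * r0 * rho * (1 - cos (t - phi)))
    - sg * (rho ^+ 2 - r0 ^+ 2) / r0.
Proof.
set n := q i0 +v fv q a b => nn F0.
have n0 : dot n (q i0) = 0 by rewrite dot_linl dot_fv0 // dq eqxx; ring.
have fE z : fz (fv q a b) z = fz n z - fz (q i0) z by rewrite fz_lin; ring.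
have rn : r0 != 0 by rewrite lt0r_neq0.
have sn : sg != 0 by apply/eqP => s0; move/eqP: sg1; rewrite s0 expr0n /= eq_sym oner_eq0.
have {fE} fE t rho : fz (fv q a b) (Some ((x0 +i* y0) + rho%:C * (cos t +i* sin t))) =
    fz n (Some ((x0 +i* y0) + rho%:C * (cos t +i* sin t))) - sg * (rho ^+ 2 - r0 ^+ 2) / r0.
  rewrite fE; congr (_ - _); rewrite q0E fz_lin mul0r addr0 -mulrA; congr (_ * _).
  have -> : (x0 +i* y0) + rho%:C * (cos t +i* sin t) = (x0 + rho * cos t) +i* (y0 + rho * sin t).
    by apply/eqP; rewrite eq_complex /= !mul0r subr0 addr0 !eqxx.
  rewrite fz_circ //=; congr (_ / _).
  by rewrite -[rho ^+ 2]mulr1 -(cos2Dsin2 t); ring.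
move: n nn F0 n0 fE => [F X Y c]; rewrite {1}/dot /= => nn F0 n0 fE.
have Fn : F != 0 by rewrite lt0r_neq0.
have cE : c = 2 * (X * x0 + Y * y0) - F * (x0 ^+ 2 + y0 ^+ 2 - r0 ^+ 2).
  move: n0; rewrite q0E dot_linr mul0r addr0 => /eqP; rewrite mulf_eq0 (negbTE sn) /= => /eqP.
  rewrite /dot /= => h; have : r0 * (X * (x0 / r0) + Y * (y0 / r0) - (F * ((x0 ^+ 2 + y0 ^+ 2 - r0 ^+ 2) / r0) + c / r0) / 2) = 0 by rewrite h mulr0.
  have -> : r0 * (X * (x0 / r0) + Y * (y0 / r0) - (F * ((x0 ^+ 2 + y0 ^+ 2 - r0 ^+ 2) / r0) + c / r0) / 2)
     = X * x0 + Y * y0 - (F * (x0 ^+ 2 + y0 ^+ 2 - r0 ^+ 2) + c) / 2 by field.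
  lra.
have [phi phip [cphi sphi]] : exists2 phi, pi <= phi <= 3 * pi &
    cos phi = (X - F * x0) / (F * r0) /\ sin phi = (Y - F * y0) / (F * r0).
  apply: angle_of_unit.
  have h : (X - F * x0) ^+ 2 + (Y - F * y0) ^+ 2 = (F * r0) ^+ 2.
    have : F * c = X ^+ 2 + Y ^+ 2 by lra.
    by rewrite cE; lra.
  by rewrite !expr_div_n -mulrDl h divff // expf_neq0 // mulf_neq0.
exists phi => // t rho; rewrite fE; congr (_ - _) => /=.
have XE : X = F * (x0 + r0 * cos phi) by rewrite cphi; field; rewrite rn Fn.
have YE : Y = F * (y0 + r0 * sin phi) by rewrite sphi; field; rewrite rn Fn.
have cE' : c = F * ((x0 + r0 * cos phi) ^+ 2 + (y0 + r0 * sin phi) ^+ 2).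
  by apply: (mulfI Fn); rewrite XE YE in nn; lra.
rewrite !mul0r subr0 addr0 cE' XE YE cosB.
have e1 := cos2Dsin2 t; have e2 := cos2Dsin2 phi.
move: (cos t) (sin t) (cos phi) (sin phi) e1 e2 => ct st cp sp e1 e2.
have -> : F * ((rho - r0) ^+ 2 + 2 * r0 * rho * (1 - (ct * cp + st * sp))) =
  F * (rho ^+ 2 * (ct ^+ 2 + st ^+ 2) + r0 ^+ 2 * (cp ^+ 2 + sp ^+ 2) - 2 * r0 * rho * (ct * cp + st * sp)).
  by rewrite e1 e2; ring.
by ring.
Qed.

(** The slice is an arc of angular half-width acos c, replaced by its chord y. The relative error
    [del] is the same for all disks because 1 / F is bounded by [Mx]. *)
Lemma slice_measure (a b : int) (eps Mx : R) (F := va (q i0 +v fv q a b))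
    (rho := r0 + sg * eps) (h := eps * (2 * r0 + sg * eps) / r0) (X := h / eps ^+ 2)
    (del := h * Mx / (4 * r0 * rho))
    (S := `[0, 2 * pi]%classic `&`
       [set t | Ns (fv q a b) (Some ((x0 +i* y0) + rho%:C * (cos t +i* sin t)))]) :
  dot (q i0 +v fv q a b) (q i0 +v fv q a b) = 0 -> 0 < F -> F^-1 <= Mx ->
  0 < eps -> 0 < rho -> 0 <= h -> del <= 1 ->
  let y := eps / Num.sqrt (r0 * rho) * Num.sqrt (X / F - 1) in
  [/\ measurable S, X <= F -> S = set0 &
    exists m : R, [/\ (@lebesgue_measure R) S = m%:E, 2 * y <= m & m * (1 - del) <= 2 * y]].
Proof.
move=> nn F0 FM e0 rho0 h0 del1 y.
have [phi phip fE] := circle_slice nn F0.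
have rn : r0 != 0 by rewrite lt0r_neq0.
have en : eps != 0 by rewrite lt0r_neq0.
have Fn : F != 0 by rewrite lt0r_neq0.
have rhon : rho != 0 by rewrite lt0r_neq0.
have rr : 0 < r0 * rho by rewrite mulr_gt0.
pose c := 1 - (h / F - eps ^+ 2) / (2 * (r0 * rho)).
have hE : sg * (rho ^+ 2 - r0 ^+ 2) / r0 = h.
  rewrite /h /rho; have -> : sg * ((r0 + sg * eps) ^+ 2 - r0 ^+ 2) = (sg ^+ 2) * eps * (2 * r0 + sg * eps) by ring.
  by rewrite sg1 mul1r.
have rE : (rho - r0) ^+ 2 = eps ^+ 2 by rewrite /rho addrAC subrr add0r exprMn sg1 mul1r.
have key t : (fz (fv q a b) (Some ((x0 +i* y0) + rho%:C * (cos t +i* sin t))) < 0) =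
    (c < cos (t - phi)).
  rewrite fE hE rE -/F subr_lt0 mulrC -ltr_pdivlMr // /c ltrBlDr -ltrBlDl.
  by rewrite [X in _ = X]ltr_pdivlMr ?mulr_gt0 // [X in _ = X]ltrBrDl; congr (_ < _); ring.
have SE : S = `[0, 2 * pi]%classic `&` [set t | c < cos (t - phi)].
  apply/seteqP; split=> t [t1 h1]; split => //.
    by have : fz (fv q a b) (Some ((x0 +i* y0) + rho%:C * (cos t +i* sin t))) < 0 := h1; rewrite key.
  by have : c < cos (t - phi) := h1; rewrite -key.
have ef : 0 < eps ^+ 2 by rewrite exprn_gt0.
have y2 : 2 * (1 - c) = eps ^+ 2 / (r0 * rho) * (X / F - 1).
  by rewrite /c /X; field; rewrite en rn rhon Fn.
have yE : Num.sqrt (2 * (1 - c)) = y.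
  rewrite y2 /y sqrtrM ?divr_ge0 ?sqr_ge0 ?(ltW rr) //; congr (_ * _).
  by rewrite sqrtrM ?sqr_ge0 // sqrtr_sqr gtr0_norm // sqrtrV // ltW.
have [XF|FX] := leP X F.
  have c1 : 1 <= c.
    rewrite /c lerBrDr gerDl pmulr_lle0 ?invr_gt0 ?mulr_gt0 // subr_le0.
    by rewrite ler_pdivrMr // mulrC -ler_pdivrMr.
  have S0 : S = set0.
    rewrite SE; apply/seteqP; split=> // t [_ /= ct]; have := le_lt_trans c1 ct.
    by rewrite ltNge cos_le1.
  rewrite S0; split; [exact: measurable0 | by [] |].
  have -> : y = 0 by rewrite -yE ler0_sqrtr // pmulr_rle0 // subr_le0.
  by exists 0; rewrite measure0 mulr0 mul0r.
have c1 : -1 <= c <= 1.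
  have hF : 0 <= h / F - eps ^+ 2.
    by rewrite subr_ge0 ler_pdivlMr // mulrC -ler_pdivlMr // ltW.
  apply/andP; split; last by rewrite /c gerBl divr_ge0 // mulr_ge0 // ltW.
  rewrite /c lerBrDr -lerBrDl opprK ler_pdivrMr ?mulr_gt0 //.
  have : h / F <= h * Mx by rewrite ler_wpM2l.
  move: del1; rewrite /del ler_pdivrMr ?mulr_gt0 // mul1r => d1 d2.
  by have := ltW ef; lra.
have [mS eS] := arc_measure phip c1; rewrite -SE in mS eS.
have [h1 h2] := acos_chord c1; rewrite yE in h1 h2.
have a0 := acos_ge0 c1.
split => //.
exists (2 * acos c); split => //; first by lra.
have : acos c * (1 - del) <= acos c * (1 - y ^+ 2 / 4).
  rewrite ler_wpM2l // lerB // -yE sqr_sqrtr; last by move: c1; lra.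
  rewrite /c /del.
  have -> : 2 * (1 - (1 - (h / F - eps ^+ 2) / (2 * (r0 * rho)))) / 4 = (h / F - eps ^+ 2) / (4 * r0 * rho).
    by field; rewrite rn rhon Fn.
  rewrite ler_pM2r ?invr_gt0 ?mulr_gt0 //.
  have : h / F <= h * Mx by rewrite ler_wpM2l.
  by have := ltW ef; lra.
by lra.
Qed.

End CircleSlice.

Lemma coprime_frac_inj (p p' : int) (q q' : nat) : (0 < q)%N -> (0 < q')%N ->
  coprime `|p| q -> coprime `|p'| q' -> p * q'%:Z - q%:Z * p' = 0 -> q = q' /\ p = p'.
Proof.
move=> q0 q0' c c' /eqP; rewrite subr_eq0 => /eqP e.
have eN : (`|p| * q' = q * `|p'|)%N by have := congr1 absz e; rewrite !abszM !absz_nat.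
have qq : q = q'.
  apply/eqP; rewrite eqn_dvd; apply/andP; split.
    by rewrite -(@Gauss_dvdr _ `|p|) 1?coprime_sym // eN dvdn_mulr.
  by rewrite -(@Gauss_dvdl _ _ `|p'|) 1?coprime_sym // -eN dvdn_mull.
split => //; move: e; rewrite -qq mulrC => /mulfI; apply.
by rewrite eqz_nat -lt0n.
Qed.

(** Disks from different charts are distinct: p p' = - k k' would force p = - k or p' = - k', which
    the half-open ranges exclude. *)
Lemma frac_cross (p p' : int) (k k' : nat) : (0 < k)%N -> (0 < k')%N ->
  - k%:Z < p <= k%:Z -> - k'%:Z < p' <= k'%:Z -> p * - p' - k%:Z * k'%:Z != 0.
Proof. by move=> *; apply/eqP; nia. Qed.

Lemma dist_sum_bounds {R : realType} (x y a b c d : R) : `|x - a| <= d -> `|y - b| <= d ->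
  a + b = c -> c - 2 * d <= x + y /\ x + y <= c + 2 * d.
Proof. by move=> /ler_normlP[? ?] /ler_normlP[? ?] <-; split; lra. Qed.

(** Without errors m = 2 * (2 / r) * (3 / 2 * r) = 6, and 6 / (2 pi) = 3 / pi; [ea] and [eb] are
    scaled so that r cancels. *)
Lemma mass_bounds {R : realType} (r e G H m : R) (ea := r * e / 8) (eb := e / (3 * r)) :
  0 < r -> 0 < e -> e <= 1 -> `|2 / r - G| <= eb -> `|2 / r - H| <= eb ->
  2 * (G * (3 / 2 * r - 2 * ea)) <= m -> m <= 2 * (H * (3 / 2 * r + 2 * ea)) ->
  `|3 / pi - (2 * pi)^-1 * m| <= e.
Proof.
move=> rp e0 e1 hG hGD lo up.
have mb : 6 - 2 * e <= m <= 6 + 3 * e.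
  move: hG hGD => /ler_normlP[_ hG] /ler_normlP[hGD _].
  have k1 : 0 <= 3 / 2 * r - 2 * ea by rewrite /ea; have := ler_wpM2l (ltW rp) e1; rewrite mulr1; have := rp; lra.
  have k2 : 0 <= 3 / 2 * r + 2 * ea by have := mulr_gt0 rp e0; rewrite /ea; have := rp; lra.
  have l1 : (2 / r - eb) * (3 / 2 * r - 2 * ea) <= G * (3 / 2 * r - 2 * ea).
    by apply: ler_wpM2r => //; lra.
  have l2 : H * (3 / 2 * r + 2 * ea) <= (2 / r + eb) * (3 / 2 * r + 2 * ea).
    by apply: ler_wpM2r => //; lra.
  have v1 : (2 / r - eb) * (3 / 2 * r - 2 * ea) = 3 - e + e ^+ 2 / 12.
    by rewrite /ea /eb; field; rewrite lt0r_neq0.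
  have v2 : (2 / r + eb) * (3 / 2 * r + 2 * ea) = 3 + e + e ^+ 2 / 12.
    by rewrite /ea /eb; field; rewrite lt0r_neq0.
  have e2 : 0 <= e ^+ 2 <= e by rewrite sqr_ge0 expr2 ler_piMr // ltW.
  by rewrite v1 in l1; rewrite v2 in l2; lra.
have p0 := pi_gt0 R; have p2 := pi_ge2 R.
have -> : 3 / pi - (2 * pi)^-1 * m = (6 - m) / (2 * pi) :> R.
  by move: (pi : R) p0 => p p0; field; rewrite lt0r_neq0.
rewrite normrM [`|(2 * pi)^-1|]gtr0_norm ?invr_gt0 ?mulr_gt0 //.
rewrite ler_pdivrMr ?mulr_gt0 //.
have : `|6 - m| <= 3 * e by apply/ler_normlP; split; lra.
move=> /le_trans; apply.
have : e * 4 <= e * (2 * pi) by rewrite ler_pM2l //; lra.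
by lra.
Qed.

(** * The limit along a bounded circle *)

Section CircleLimit.
Context {R : realType}.
Local Notation mu := (@lebesgue_measure R).
Variables (q : @quad R) (x0 y0 r0 sg : R).
Hypotheses (dq : desc q) (r0p : 0 < r0) (sgE : sg = 1 \/ sg = -1).
Hypothesis q0E : q i0 = lin sg (circ (x0 +i* y0) r0) 0 (circ (x0 +i* y0) r0).
Hypothesis fq : forall v w, orbit q v -> orbit q w -> v <> w -> fut (v +v w).

Let A := formA q.
Let B := formB q.
Let C := formC q.
Let s := r0^-1.

Lemma sg_sqr : sg ^+ 2 = 1.
Proof. by case: sgE => ->; rewrite ?sqrrN expr1n. Qed.

Lemma s_gt0 : 0 < s. Proof. by rewrite invr_gt0. Qed.

Lemma circle_disc : A * C - B ^+ 2 / 4 = s ^+ 2.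
Proof. by rewrite form_disc // q0E /= mul0r addr0 exprMn sg_sqr mul1r. Qed.

Lemma circle_AC : 0 < A /\ 0 < C.
Proof.
have s2 : 0 < s ^+ 2 by rewrite exprn_gt0 // s_gt0.
have AC : 0 < A * C by have := circle_disc; have := sqr_ge0 B; lra.
have [_ A0 _] := (fv_fut dq fq (isT : coprime `|1%Z| `|0%Z|)).1.
have {}A0 : 0 <= A by move: A0; rewrite formE rmorph1 rmorph0 expr1n expr0n /= !mulr0 !addr0 mulr1.
have An : A != 0 by apply/eqP => a0; move: AC; rewrite a0 mul0r ltxx.
have Ap : 0 < A by rewrite lt_neqAle eq_sym An.
by split => //; move: AC; rewrite pmulr_rgt0.
Qed.

Let A0 : 0 < A := circle_AC.1.
Let C0 : 0 < C := circle_AC.2.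

Lemma circle_disc' : C * A - (- B) ^+ 2 / 4 = s ^+ 2.
Proof. by rewrite sqrrN mulrC circle_disc. Qed.

(** The two charts: pairs (p, k) with p / k in (-1, 1], and pairs (k, - p) with the same range. Up
    to sign they exhaust the primitive pairs by [fracs_normal]. *)
Let w1 (x : R) := A * x ^+ 2 + B * x + C.
Let w2 (x : R) := C * x ^+ 2 + - B * x + A.

Let F1 (k : nat) (p : int) : R := va (q i0 +v fv q p k%:Z).
Let F2 (k : nat) (p : int) : R := va (q i0 +v fv q k%:Z (- p)).

Lemma F1E k p : (0 < k)%N -> F1 k p = k%:R ^+ 2 * w1 (p%:~R / k%:R).
Proof.
move=> k0; have kn : k%:R != 0 :> R by rewrite pnatr_eq0 -lt0n.
by rewrite /F1 formE /w1 -/A -/B -/C -pmulrn; field.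
Qed.

Lemma F2E k p : (0 < k)%N -> F2 k p = k%:R ^+ 2 * w2 (p%:~R / k%:R).
Proof.
move=> k0; have kn : k%:R != 0 :> R by rewrite pnatr_eq0 -lt0n.
by rewrite /F2 formE /w2 -/A -/B -/C -pmulrn rmorphN /=; field.
Qed.

Local Notation fr := (fracs (-1 : R) 1).

Lemma fracs11 (k : nat) p : fr k p <-> (- k%:Z < p <= k%:Z) /\ coprime `|p| k.
Proof.
rewrite /fracs /ints /=; split=> -[h c]; split => //; move: h.
  by rewrite mulN1r mul1r pmulrn -rmorphN /= ltr_int ler_int.
by rewrite mulN1r mul1r pmulrn -rmorphN /= ltr_int ler_int.
Qed.

Lemma fracs_normal (a b : int) : coprime `|a| `|b| -> exists (k : nat) (p : int),
  [/\ (0 < k)%N, fr k p & fv q a b = fv q p k%:Z \/ fv q a b = fv q k%:Z (- p)].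
Proof.
move=> ab.
have abn : (a != 0) || (b != 0).
  by case: eqP ab => // ->; case: eqP => // ->; rewrite /coprime gcdn0.
wlog b0 : a b ab abn / 0 <= b.
  move=> h; have [/h|b0] := leP 0 b; first exact.
  have [|||k [p [k0 pf fE]]] := h (- a) (- b); rewrite ?abszN ?oppr_eq0 ?oppr_ge0 ?(ltW b0) //.
  by exists k, p; split => //; move: fE; rewrite fvN.
have [h1|h1] := boolP (- b < a <= b).
  exists `|b|%N, a; split; [lia| | by left; rewrite gez0_abs].
  by apply/fracs11; split => //; rewrite gez0_abs.
have [a0|a0] := leP 0 a.
  exists `|a|%N, (- b); split; [lia| | by right; rewrite opprK gez0_abs].
  by apply/fracs11; rewrite abszN coprime_sym; split => //; rewrite gez0_abs //; lia.
exists `|a|%N, b; split; [lia| | by right; rewrite ltz0_abs // fvN].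
by apply/fracs11; rewrite coprime_sym; split => //; rewrite ltz0_abs //; lia.
Qed.

Section Slice.
Variable eps : R.
Let rho := r0 + sg * eps.
Let h := eps * (2 * r0 + sg * eps) / r0.
Let X := h / eps ^+ 2.
Let Mx := A / s ^+ 2 + C / s ^+ 2.
Let del := h * Mx / (4 * r0 * rho).
Let P (t : R) : sphere R := Some ((x0 +i* y0) + rho%:C * (cos t +i* sin t)).
Hypotheses (e0 : 0 < eps) (rho0 : 0 < rho) (h0 : 0 < h) (del1 : del < 1).

Let T1 (k : nat) (p : int) : set R := `[0, 2 * pi]%classic `&` [set t | Ns (fv q p k%:Z) (P t)].
Let T2 (k : nat) (p : int) : set R := `[0, 2 * pi]%classic `&` [set t | Ns (fv q k%:Z (- p)) (P t)].

Let g := eps / Num.sqrt (r0 * rho).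

(** Disks with k >= N have F >= X and do not reach the curve; the others form two finite families of
    disjoint slices, so their measures add. *)
Lemma circle_slice_sum N : X * (Mx + 1) <= N%:R ^+ 2 ->
  exists m : R, [/\ mu (`[0, 2 * pi]%classic `&`
      [set t | primitive_disks q (P t)]) = m%:E,
    2 * g * (psum (-1) 1 (fun x => (w1 x)^-1) N X + psum (-1) 1 (fun x => (w2 x)^-1) N X) <= m &
    m * (1 - del) <= 2 * g * (psum (-1) 1 (fun x => (w1 x)^-1) N X + psum (-1) 1 (fun x => (w2 x)^-1) N X)].
Proof.
move=> XN.
have s2 : 0 < s ^+ 2 by rewrite exprn_gt0 // s_gt0.
have MA : 0 < A / s ^+ 2 by rewrite divr_gt0.
have MC : 0 < C / s ^+ 2 by rewrite divr_gt0.
have X0 : 0 < X by rewrite divr_gt0 // exprn_gt0.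
have w1p x : 0 < w1 x := quadratic_gt0 A0 s_gt0 circle_disc x.
have w2p x : 0 < w2 x := quadratic_gt0 C0 s_gt0 circle_disc' x.
have w1M x : (w1 x)^-1 <= Mx.
  have := quadratic_ge A0 circle_disc x; rewrite -/(w1 x) => h1.
  apply: (@le_trans _ _ (A / s ^+ 2)); last by rewrite lerDl ltW.
  by rewrite -[A / _]invf_div lef_pV2 ?posrE // divr_gt0.
have w2M x : (w2 x)^-1 <= Mx.
  have := quadratic_ge C0 circle_disc' x; rewrite -/(w2 x) => h1.
  apply: (@le_trans _ _ (C / s ^+ 2)); last by rewrite lerDr ltW.
  by rewrite -[C / _]invf_div lef_pV2 ?posrE // divr_gt0.
have kk k : (0 < k)%N -> 0 < k%:R ^+ 2 :> R by move=> k0; rewrite exprn_gt0 // ltr0n.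
have slice (w : R -> R) (a b : int) (k : nat) (x : R) : (0 < k)%N -> coprime `|a| `|b| ->
    0 < w x -> (w x)^-1 <= Mx -> va (q i0 +v fv q a b) = k%:R ^+ 2 * w x ->
    let S := `[0, 2 * pi]%classic `&` [set t | Ns (fv q a b) (P t)] in
    let y := g * Num.sqrt (X * (w x)^-1 / k%:R ^+ 2 - 1) in
    [/\ measurable S, (N <= k)%N -> S = set0, mu S = (fine (mu S))%:E, 2 * y <= fine (mu S) &
      fine (mu S) * (1 - del) <= 2 * y].
  move=> k0 ab wx wM FE S y; have k2 := kk k k0.
  have k1 : 1 <= k%:R ^+ 2 :> R by rewrite exprn_ege1 // ler1n.
  have F0 : 0 < va (q i0 +v fv q a b) by rewrite FE mulr_gt0.
  have FM : (va (q i0 +v fv q a b))^-1 <= Mx.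
    apply: le_trans wM; have : w x <= k%:R ^+ 2 * w x by rewrite ler_peMl // ltW.
    by rewrite -lef_pV2 ?posrE -?FE.
  have [mS XF [m [mE y1 y2]]] := @slice_measure R q x0 y0 r0 sg dq r0p sg_sqr q0E a b eps Mx
     (fv_fut dq fq ab).2 F0 FM e0 rho0 (ltW h0) (ltW del1).
  have yE : y = g * Num.sqrt (X / va (q i0 +v fv q a b) - 1).
    rewrite /y FE; congr (g * Num.sqrt (_ - 1)); rewrite -[LHS]mulrA; congr (_ * _).
    by rewrite [RHS]invfM [RHS]mulrC.
  have {}y1 : 2 * y <= m by rewrite yE.
  have {}y2 : m * (1 - del) <= 2 * y by rewrite yE.
  split => //; [|by rewrite mE..].
  move=> Nk; apply: XF; rewrite FE.
  have XM : X * Mx <= k%:R ^+ 2.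
    apply: (@le_trans _ _ (N%:R ^+ 2)); last by rewrite lerXn2r ?nnegrE ?ler0n // ler_nat.
    by apply: le_trans XN; rewrite ler_pM2l // lerDl.
  rewrite -ler_pdivrMr //; apply: le_trans XM; rewrite ler_pM2l //.
have sl1 k p : (0 < k)%N -> fr k p -> _ :=
  fun k0 pf => slice w1 p k%:Z k (p%:~R / k%:R) k0 pf.2 (w1p _) (w1M _) (F1E p k0).
have sl2 k p : (0 < k)%N -> fr k p -> _ := fun k0 pf =>
  slice w2 k%:Z (- p) k (p%:~R / k%:R) k0
   (etrans (congr1 (fun z => coprime _ z) (abszN p)) (etrans (coprime_sym _ _) pf.2)) (w2p _) (w2M _) (F2E p k0).
have det1 k p k' p' t : (0 < k)%N -> (0 < k')%N -> fr k p -> fr k' p' ->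
    T1 k p t -> T1 k' p' t -> k = k' /\ p = p'.
  move=> k0 k0' [_ c] [_ c'] [_ /= h1] [_ /= h2]; apply: coprime_frac_inj => //.
  apply/eqP; apply: contrapT => /negP ne.
  exact: (fv_disjoint dq fq (_ : coprime `|p| `|k%:Z|) (_ : coprime `|p'| `|k'%:Z|) ne h1 h2).
have det2 k p k' p' t : (0 < k)%N -> (0 < k')%N -> fr k p -> fr k' p' ->
    T2 k p t -> T2 k' p' t -> k = k' /\ p = p'.
  move=> k0 k0' [_ c] [_ c'] [_ /= h1] [_ /= h2]; apply: coprime_frac_inj => //.
  apply/eqP; apply: contrapT => /negP ne.
  apply: (fv_disjoint dq fq _ _ _ h1 h2); rewrite ?abszN 1?coprime_sym //.
  by apply: contra ne => /eqP e; apply/eqP; rewrite -e; ring.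
have det12 k p k' p' t : (0 < k)%N -> (0 < k')%N -> fr k p -> fr k' p' ->
    T1 k p t -> T2 k' p' t -> False.
  move=> k0 k0' /fracs11[pk c] /fracs11[pk' c'] [_ /= h1] [_ /= h2].
  apply: (fv_disjoint dq fq _ _ _ h1 h2); rewrite ?abszN // 1?coprime_sym //.
  exact: frac_cross.
have [mf1 ef1] := family_measure (m := fun k p => fine (mu (T1 k p)))
  (fun k p k0 pf => let: And5 a _ b _ _ := sl1 k p k0 pf in conj a b) det1 N.
have [mf2 ef2] := family_measure (m := fun k p => fine (mu (T2 k p)))
  (fun k p k0 pf => let: And5 a _ b _ _ := sl2 k p k0 pf in conj a b) det2 N.
set m1 := (\sum_(1 <= k < N) _) in ef1; set m2 := (\sum_(1 <= k < N) _) in ef2.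
have SE : `[0, 2 * pi]%classic `&` [set t | primitive_disks q (P t)]
    = family (-1) 1 T1 N `|` family (-1) 1 T2 N.
  apply/seteqP; split=> [t [t1 [a [b [ab Nt]]]]|t [] [k [p [/andP[k0 kN] pf [t1 Nt]]]]].
  - have [k [p [k0 pf fE]]] := fracs_normal ab.
    case: fE => fE; rewrite fE in Nt; [left|right]; exists k, p; split => //; rewrite k0 /= ltnNge;
      apply/negP => Nk.
      have [_ /(_ Nk) S0 _ _ _] := sl1 k p k0 pf.
      by have : (set0 : set R) t by rewrite -S0.
    have [_ /(_ Nk) S0 _ _ _] := sl2 k p k0 pf.
    by have : (set0 : set R) t by rewrite -S0.
  - by split => //; exists p, k%:Z; split => //; case: pf.
  - split => //; exists k%:Z, (- p); split => //; case: pf => _ c.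
    by rewrite abszN coprime_sym.
exists (m1 + m2); split.
- rewrite SE EFinD -ef1 -ef2; apply: measureU => //.
  apply/seteqP; split=> // t [[k [p [/andP[k0 kN] pf Tt]]] [k' [p' [/andP[k0' kN'] pf' Tt']]]].
  exact: (det12 _ _ _ _ _ k0 k0' pf pf' Tt Tt').
- rewrite mulrDr /psum !mulr_sumr lerD //; apply: ler_sum_nat => k /andP[k0 _];
    rewrite mulr_fsumr; apply: ler_fsum; rewrite ?finite_fracs //; try exact: finite_fracs.
  + by move=> p pf; have [_ _ _ + _] := sl1 k p k0 pf; rewrite mulrA.
  + by move=> p pf; have [_ _ _ + _] := sl2 k p k0 pf; rewrite mulrA.
- rewrite [X in _ <= X]mulrDr [X in X <= _]mulrDl /psum !mulr_sumr /m1 /m2 !mulr_suml lerD //; apply: ler_sum_nat => k /andP[k0 _];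
    rewrite mulr_fsumr mulr_fsuml; apply: ler_fsum; rewrite ?finite_fracs //; try exact: finite_fracs.
  + by move=> p pf; have [_ _ _ _ +] := sl1 k p k0 pf; rewrite mulrA.
  + by move=> p pf; have [_ _ _ _ +] := sl2 k p k0 pf; rewrite mulrA.
Qed.

End Slice.

Lemma cvg_right0 : (fun x : R => x) x @[x --> 0^'+] --> (0 : R).
Proof. exact: cvg_at_right_filter. Qed.

Lemma cvg_affine (k : R) : (k + sg * eps) @[eps --> 0^'+] --> k.
Proof.
have h := cvgD (cvg_cst k) (cvgM (cvg_cst sg) cvg_right0).
by rewrite mulr0 addr0 in h; exact: h.
Qed.

(** The factor [g] of the arcs times the size X of the sums; [D] is the relative error of chord
    against arc. *)
Let G (eps : R) : R := (2 * r0 + sg * eps) / (r0 * Num.sqrt (r0 * (r0 + sg * eps))).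
Let Mx := A / s ^+ 2 + C / s ^+ 2.
Let D (eps : R) : R := eps * (2 * r0 + sg * eps) / r0 * Mx / (4 * r0 * (r0 + sg * eps)).

Lemma G_cvg : G eps @[eps --> 0^'+] --> 2 / r0.
Proof.
have -> : 2 / r0 = (2 * r0) / (r0 * Num.sqrt (r0 * r0)).
  by rewrite -expr2 sqrtr_sqr gtr0_norm //; field; rewrite lt0r_neq0.
apply: cvgM; first exact: cvg_affine.
apply: cvgV; first by rewrite mulf_neq0 ?lt0r_neq0 // sqrtr_gt0 mulr_gt0.
apply: cvgM; first exact: cvg_cst.
apply: continuous_cvg; first exact: sqrt_continuous.
by apply: cvgM; [exact: cvg_cst | exact: cvg_affine].
Qed.

Lemma D_cvg : D eps @[eps --> 0^'+] --> (0 : R).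
Proof.
suff : D eps @[eps --> 0^'+] --> 0 * (2 * r0) / r0 * Mx / (4 * r0 * r0) by rewrite !mul0r.
apply: cvgM; last first.
  apply: cvgV; first by rewrite !mulf_neq0 ?lt0r_neq0.
  by apply: cvgM; [exact: cvg_cst | exact: cvg_affine].
apply: cvgM; last exact: cvg_cst.
apply: cvgM; last exact: cvg_cst.
by apply: cvgM; [exact: cvg_right0 | exact: cvg_affine].
Qed.

Lemma GD_cvg : (G eps / (1 - D eps)) @[eps --> 0^'+] --> 2 / r0.
Proof.
rewrite -[X in _ --> X]divr1 -[X in _ / X](subr0 1).
apply: cvgM; first exact: G_cvg.
by apply: cvgV; [rewrite subr0 oner_eq0 | apply: cvgB; [exact: cvg_cst | exact: D_cvg]].
Qed.

Lemma circle_limit :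
  circle_prob (x0 +i* y0) (r0 + sg * eps)
    (primitive_disks q) @[eps --> 0^'+] --> ((3 / pi)%:E : \bar R).
Proof.
apply: cvg_right_EFin => e' e'0; pose e := Num.min e' 1.
have e0 : 0 < e by rewrite lt_min e'0 ltr01.
have e1 : e <= 1 by rewrite ge_min lexx orbT.
have ee : e <= e' by rewrite ge_min lexx.
pose ea := r0 * e / 8; have ea0 : 0 < ea by rewrite !mulr_gt0 ?invr_gt0.
pose eb := e / (3 * r0); have eb0 : 0 < eb by rewrite divr_gt0 ?mulr_gt0.
have [X1 hX1] := quadratic_psum A0 s_gt0 circle_disc ea0.
have [X2 hX2] := quadratic_psum C0 s_gt0 circle_disc' ea0.
pose X3 := Num.max 1 (Num.max X1 X2).
have X30 : 0 < X3 by rewrite lt_max ltr01.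
near=> eps.
have eps0 : 0 < eps by near: eps; exact: nbhs_right_gt.
have epsr : eps < r0 by near: eps; exact: nbhs_right_lt.
have epsX : eps < X3^-1 by near: eps; apply: nbhs_right_lt; rewrite invr_gt0.
have hG : `|2 / r0 - G eps| <= eb by near: eps; move: eb eb0; apply/cvgrPdist_le; exact: G_cvg.
have hGD : `|2 / r0 - G eps / (1 - D eps)| <= eb.
  by near: eps; move: eb eb0; apply/cvgrPdist_le; exact: GD_cvg.
have hD : `|0 - D eps| < 1 by near: eps; move: (1 : R) (@ltr01 R); apply/cvgrPdist_lt; exact: D_cvg.
have D1 : D eps < 1 by move: hD; rewrite sub0r normrN; apply: le_lt_trans; apply: ler_norm.
have [rho0 num0] : 0 < r0 + sg * eps /\ r0 < 2 * r0 + sg * eps.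
  by case: sgE => ->; split; lra.
have h0 : 0 < eps * (2 * r0 + sg * eps) / r0 by rewrite divr_gt0 ?mulr_gt0 // (lt_trans r0p).
set X := eps * (2 * r0 + sg * eps) / r0 / eps ^+ 2.
have XE : X = (2 * r0 + sg * eps) / r0 / eps by rewrite /X; field; rewrite !lt0r_neq0.
have X3X : X3 <= X.
  rewrite XE ler_pdivlMr //; apply: (@le_trans _ _ 1).
    by rewrite -ler_pdivlMl // mulr1 ltW.
  by rewrite ler_pdivlMr // mul1r ltW.
have X0 : 0 < X by apply: lt_le_trans X3X.
pose N := cut (X * (Mx + 1)).
have XN : X * (Mx + 1) <= N%:R ^+ 2 := cut_sqr _.
have s2 : 0 < s ^+ 2 by rewrite exprn_gt0 // s_gt0.
have [m [mE lo up]] := circle_slice_sum eps0 rho0 h0 D1 XN.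
rewrite -/X in lo up.
have XN1 : X * (A / s ^+ 2 + 1) <= N%:R ^+ 2.
  by apply: le_trans XN; rewrite ler_pM2l // lerD2r lerDl divr_ge0 // ltW.
have XN2 : X * (C / s ^+ 2 + 1) <= N%:R ^+ 2.
  by apply: le_trans XN; rewrite ler_pM2l // lerD2r lerDr divr_ge0 // ltW.
have /andP[XX1 XX2] : (X1 <= X) && (X2 <= X).
  by apply/andP; split; apply: le_trans X3X; rewrite !le_max lexx ?orbT.
have p1 := hX1 X N XX1 XN1; have p2 := hX2 X N XX2 XN2.
set S1 := psum _ _ _ _ _ in p1 lo up; set S2 := psum _ _ _ _ _ in p2 lo up.
have at_pi := atan_sum_pi A0 C0 s_gt0 circle_disc.
(* The four arctangents of the two charts add up to pi, and kappa * pi * r0 = 3 / 2 * r0. *)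
have sumE : kappa * (s^-1 * (atan ((A + B / 2) / s) + atan ((A - B / 2) / s))) * X +
   kappa * (s^-1 * (atan ((C + - B / 2) / s) + atan ((C - - B / 2) / s))) * X = 3 / 2 * r0 * X.
  have -> : C + - B / 2 = C - B / 2 by rewrite mulNr.
  have -> : C - - B / 2 = C + B / 2 by rewrite mulNr opprK.
  rewrite -mulrDl -mulrDr -mulrDr at_pi /s invrK /kappa.
  by have := lt0r_neq0 (pi_gt0 R); move: (pi : R) => p pn; field.
have [Slo Sup] := dist_sum_bounds p1 p2 sumE.
rewrite mulrA -mulrBl in Slo; rewrite mulrA -mulrDl in Sup.
have gX : eps / Num.sqrt (r0 * (r0 + sg * eps)) * X = G eps.
  rewrite XE /G; have : 0 < Num.sqrt (r0 * (r0 + sg * eps)) by rewrite sqrtr_gt0 mulr_gt0.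
  by move: (Num.sqrt _) => c c0; field; rewrite !lt0r_neq0.
have g0 : 0 < eps / Num.sqrt (r0 * (r0 + sg * eps)).
  by rewrite divr_gt0 // sqrtr_gt0 mulr_gt0.
set g := eps / _ in gX g0 lo up.
have {}lo : 2 * (G eps * (3 / 2 * r0 - 2 * ea)) <= m.
  apply: le_trans lo; rewrite -gX; rewrite -[2 * g * _]mulrA ler_pM2l // -mulrA [X * _]mulrC.
  by rewrite ler_pM2l.
have d0 : 0 < 1 - D eps by rewrite subr_gt0.
have {}up : m <= 2 * (G eps / (1 - D eps) * (3 / 2 * r0 + 2 * ea)).
  rewrite -(ler_pM2r d0); apply: (le_trans up).
  have -> : 2 * (G eps / (1 - D eps) * (3 / 2 * r0 + 2 * ea)) * (1 - D eps) = 2 * (G eps * (3 / 2 * r0 + 2 * ea)).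
    by move: (G eps) (1 - D eps) d0 => u v v0; field; rewrite lt0r_neq0.
  rewrite -gX; rewrite -[2 * g * _]mulrA ler_pM2l // -mulrA [X * _]mulrC.
  by rewrite ler_pM2l.
exists ((2 * pi)^-1 * m).
  by rewrite /circle_prob; rewrite [X in (_ * X)%E](mE : _ = m%:E).
by apply: le_trans ee; exact: (mass_bounds r0p e0 e1 hG hGD lo up).
Unshelve. all: by end_near.
Qed.

End CircleLimit.

(** * Equidistant lines *)

Lemma unimod_mul (p q r t a b c d : int) : unimod p q r t -> unimod a b c d ->
  unimod (p * a + r * b) (q * a + t * b) (p * c + r * d) (q * c + t * d).
Proof.
rewrite /unimod => /eqP h1 /eqP h2; apply/eqP.
by rewrite -[RHS]mulr1 -{1}h1 -h2; ring.
Qed.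

Section Ford.
Context {R : realType}.
Local Notation mu := (@lebesgue_measure R).

(* The disks of radius [1 / L ^ 2] tangent to the real axis at [M / L], cut at height [eps]. *)
Definition ford (al be ga de eps : R) : set R :=
  [set s | exists a b : int, coprime `|a| `|b| /\
    (al * a%:~R + be * b%:~R) ^+ 2 * eps ^+ 2 +
    ((al * a%:~R + be * b%:~R) * s - (ga * a%:~R + de * b%:~R)) ^+ 2 < 2 * eps].

(** A unimodular substitution permutes the primitive pairs; its inverse is the adjugate times the
    determinant D. *)
Lemma ford_unimod (al be ga de eps : R) (p q r t : int) : unimod p q r t ->
  ford (al * p%:~R + be * q%:~R) (al * r%:~R + be * t%:~R)
       (ga * p%:~R + de * q%:~R) (ga * r%:~R + de * t%:~R) eps = ford al be ga de eps.
Proof.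
move=> u; apply/seteqP; split=> s [a [b [ab h]]]; have [c [d u']] := coprime_unimod ab.
  exists (p * a + r * b), (q * a + t * b); split.
    exact: unimod_coprime (unimod_mul u u').
  by apply: (etrans _ h); congr (_ < _); rewrite !rmorphD !rmorphM /=; ring.
pose D := p * t - q * r; have DD : D * D = 1 by move: u; rewrite /unimod => /eqP <-; rewrite /D; ring.
have u2 : unimod (D * t) (- (D * q)) (- (D * r)) (D * p).
  rewrite /unimod; apply/eqP; rewrite -[RHS]mulr1 -{1}DD -DD /D.
  by move: u; rewrite /unimod => /eqP u; rewrite -[RHS]mulr1 -u; ring.
pose x := D * t * a + - (D * r) * b; pose y := - (D * q) * a + D * p * b.
exists x, y; split; first exact: unimod_coprime (unimod_mul u2 u').
have e1 : p * x + r * y = a.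
  by transitivity ((p * t - q * r) * D * a); [rewrite /x /y; ring | rewrite -/D DD mul1r].
have e2 : q * x + t * y = b.
  by transitivity ((p * t - q * r) * D * b); [rewrite /x /y; ring | rewrite -/D DD mul1r].
clearbody x y.
have lin_eq (k l : R) : (k * p%:~R + l * q%:~R) * x%:~R + (k * r%:~R + l * t%:~R) * y%:~R =
    k * a%:~R + l * b%:~R by rewrite -e1 -e2 !rmorphD !rmorphM /=; ring.
by rewrite !lin_eq.
Qed.

(** The left sides are sums of two squares, and their product is a sum of two squares one of which
    is eps^2 (L M' - L' M)^2. *)
Lemma ford_disjoint (L M L' M' eps s : R) : 0 < eps ->
  L ^+ 2 * eps ^+ 2 + (L * s - M) ^+ 2 < 2 * eps ->
  L' ^+ 2 * eps ^+ 2 + (L' * s - M') ^+ 2 < 2 * eps -> (L * M' - L' * M) ^+ 2 < 4.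
Proof.
move=> e0 h1 h2; have e2 : 0 < eps ^+ 2 by rewrite exprn_gt0.
rewrite -(ltr_pM2l e2).
have : (L ^+ 2 * eps ^+ 2 + (L * s - M) ^+ 2) * (L' ^+ 2 * eps ^+ 2 + (L' * s - M') ^+ 2)
    < (2 * eps) * (2 * eps) by apply: ltr_pM => //; exact: (addr_ge0 (mulr_ge0 (sqr_ge0 _) (sqr_ge0 _)) (sqr_ge0 _)).
have := sqr_ge0 (L * L' * eps ^+ 2 + (L * s - M) * (L' * s - M')).
by lra.
Qed.

Lemma affine_sqr_ge (L M t1 t2 s m : R) : t1 <= s <= t2 -> 0 < (L * t1 - M) * (L * t2 - M) ->
  m <= (L * t1 - M) ^+ 2 -> m <= (L * t2 - M) ^+ 2 -> m <= (L * s - M) ^+ 2.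
Proof.
move=> /andP[s1 s2].
wlog p1 : L M / 0 < L * t1 - M.
  move=> h; have [/h|n1 pp h1 h2] := ltP 0 (L * t1 - M); first exact.
  have nE x : - L * x - - M = - (L * x - M) by ring.
  rewrite -sqrrN -nE; apply: h; rewrite ?nE ?mulrNN ?sqrrN //.
  rewrite oppr_gt0 lt_neqAle n1 andbT; apply/eqP => e.
  by move: pp; rewrite e mul0r ltxx.
rewrite pmulr_rgt0 // => p2 h1 h2.
have [L0|/ltW L0] := leP 0 L.
  apply: (le_trans h1); have h : L * t1 - M <= L * s - M by rewrite lerD2r ler_wpM2l.
  by rewrite lerXn2r // nnegrE ltW // (lt_le_trans p1).
apply: (le_trans h2); have h : L * t2 - M <= L * s - M by rewrite lerD2r ler_wnM2l.
by rewrite lerXn2r // nnegrE ltW // (lt_le_trans p2).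
Qed.

Lemma det_sqr_ge (al be ga de : R) (a b a' b' : int) : (be * ga - al * de) ^+ 2 = 4 ->
  let L := al * a%:~R + be * b%:~R in let M := ga * a%:~R + de * b%:~R in
  let L' := al * a'%:~R + be * b'%:~R in let M' := ga * a'%:~R + de * b'%:~R in
  a * b' - b * a' <> 0 -> 4 <= (L * M' - L' * M) ^+ 2.
Proof.
move=> D L M L' M' ne.
have -> : (L * M' - L' * M) ^+ 2 = (be * ga - al * de) ^+ 2 * ((a * b' - b * a') ^+ 2)%:~R.
  by rewrite /L /M /L' /M' rmorphXn rmorphB !rmorphM /=; ring.
rewrite D ler_peMr // ler1z; have : 0 < (a * b' - b * a') ^+ 2; last by lia.
by rewrite exprn_even_gt0 //=; apply/eqP.
Qed.

(** The contact point is a Moebius function of a / b. Choose s in the interval different from the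
    image of infinity, and approximate its preimage by a rational. *)
Lemma tangency_dense (al be ga de c d : R) : be * ga - al * de != 0 -> c < d ->
  exists a b : int, [/\ coprime `|a| `|b|, al * a%:~R + be * b%:~R != 0 &
    c < (ga * a%:~R + de * b%:~R) / (al * a%:~R + be * b%:~R) < d].
Proof.
move=> D0 cd.
have [s /andP[cs sd] sn] : exists2 s, c < s < d & ga - al * s != 0.
  have [e|ne] := eqVneq (ga - al * ((c + d) / 2)) 0; last by exists ((c + d) / 2) => //; lra.
  exists ((2 * c + d) / 3); first by lra.
  apply/eqP => e'; have /eqP : al * (d - c) = 0 by lra.
  rewrite mulf_eq0 subr_eq0 (gt_eqF cd) orbF => /eqP al0.
  by move/eqP: D0; apply; move: e; rewrite al0 mul0r subr0 => ->; rewrite mulr0 mul0r subrr.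
pose Y x := al * x + be; pose x := (be * s - de) / (ga - al * s).
have Yx : Y x = (be * ga - al * de) / (ga - al * s) by rewrite /Y /x; field.
have Yn : Y x != 0 by rewrite Yx mulf_neq0 ?invr_eq0.
have Sx : (ga * x + de) / Y x = s by rewrite Yx /x; field; rewrite sn D0.
have cA (u v : R) : (u * y + v) @[y --> x] --> u * x + v.
  by apply: cvgD; [apply: cvgM; [exact: cvg_cst | exact: cvg_id] | exact: cvg_cst].
have cS : ((ga * y + de) / Y y) @[y --> x] --> s.
  by rewrite -Sx; apply: cvgM; [exact: cA | apply: cvgV => //; exact: cA].
have near_x : \forall y \near x, Y y != 0 /\ c < (ga * y + de) / Y y < d.
  near=> y; split; first by near: y; exact: (cvgr_neq0 _ (cA al be)).
  apply/andP; split; near: y; [exact: (cvgr_gt _ cS) | exact: (cvgr_lt _ cS)].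
have /nbhs_ballP[r /= r0 hr] := near_x.
have [z /itvP hz] : exists z : rat, ratr z \in `]x - r, x + r[%R by apply: rat_in_itvoo; lra.
have [|Yz /andP[z1 z2]] := hr (ratr z).
  by rewrite /ball /= ltr_distlC !hz.
have dn : (denq z)%:~R != 0 :> R by rewrite intr_eq0 denq_neq0.
have zE : ratr z = (numq z)%:~R / (denq z)%:~R :> R by [].
exists (numq z), (denq z).
have YE : al * (numq z)%:~R + be * (denq z)%:~R = (denq z)%:~R * Y (ratr z).
  by rewrite /Y zE; field.
have ME : ga * (numq z)%:~R + de * (denq z)%:~R = (denq z)%:~R * (ga * ratr z + de).
  by rewrite zE; field.
split; first exact: coprime_num_den.
  by rewrite YE mulf_neq0.
by rewrite YE ME -mulf_div divff // mul1r z1.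
Unshelve. all: by end_near.
Qed.

(** * Contact points in an interval with bounded parameter *)

Section RegularInterval.
Variables al be ga de a0 b0 : R.
Hypothesis det : be * ga - al * de = 2.
Hypothesis ab0 : a0 < b0.
Hypothesis pos : forall s, a0 <= s <= b0 -> 0 < ga - al * s.

(** For x = a / b, [S x] is the contact point and [Xs] the inverse map, finite on the interval by
    [pos]. The derivative of S is 2 / Y^2 = 2 f, so S / 2 is an antiderivative of f. *)
Let Y x := al * x + be.
Let S x := (ga * x + de) / Y x.
Let Xs s := (be * s - de) / (ga - al * s).
Let f x := (Y x ^+ 2)^-1.

Lemma Y_Xs s : a0 <= s <= b0 -> Y (Xs s) = 2 / (ga - al * s).
Proof. by move=> /pos/lt0r_neq0 h; rewrite -det /Y /Xs; field. Qed.

Lemma Y_Xs_gt0 s : a0 <= s <= b0 -> 0 < Y (Xs s).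
Proof. by move=> h; rewrite Y_Xs // divr_gt0 // pos. Qed.

Lemma S_Xs s : a0 <= s <= b0 -> S (Xs s) = s.
Proof.
move=> h; have /lt0r_neq0 hn := pos h; rewrite /S Y_Xs // /Xs.
have -> : ga * ((be * s - de) / (ga - al * s)) + de = (be * ga - al * de) * s / (ga - al * s) by field.
by rewrite det; field.
Qed.

Lemma S_diff x y : Y x != 0 -> Y y != 0 -> S y - S x = 2 * (y - x) / (Y x * Y y).
Proof. by move=> hx hy; rewrite -det /S /Y; field; rewrite -/(Y x) -/(Y y) hx hy. Qed.

Lemma S_lt x y : 0 < Y x -> 0 < Y y -> (S x < S y) = (x < y).
Proof.
move=> hx hy; rewrite -subr_gt0 S_diff ?lt0r_neq0 //.
have h : 0 < (Y x * Y y)^-1 by rewrite invr_gt0 mulr_gt0.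
by rewrite (pmulr_lgt0 _ h) (pmulr_rgt0 _ (ltr0n _ 2)) subr_gt0.
Qed.

Lemma S_le x y : 0 < Y x -> 0 < Y y -> (S x <= S y) = (x <= y).
Proof. by move=> hx hy; rewrite !leNgt S_lt. Qed.

Lemma Y_of_S x : Y x != 0 -> a0 <= S x <= b0 -> 0 < Y x.
Proof.
move=> yn /pos; have -> : ga - al * S x = 2 / Y x by rewrite -det /S /Y; field.
by rewrite pmulr_rgt0 // invr_gt0.
Qed.

Let a0I : a0 <= a0 <= b0. Proof. by rewrite lexx ltW. Qed.
Let b0I : a0 <= b0 <= b0. Proof. by rewrite lexx ltW. Qed.

Lemma Xs_le s t : a0 <= s <= b0 -> a0 <= t <= b0 -> (Xs s <= Xs t) = (s <= t).
Proof. by move=> hs ht; rewrite -S_le ?Y_Xs_gt0 // !S_Xs. Qed.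

Let yl := Num.min (Y (Xs a0)) (Y (Xs b0)).
Let yh := Num.max (Y (Xs a0)) (Y (Xs b0)).

Lemma yl_gt0 : 0 < yl. Proof. by rewrite lt_min !Y_Xs_gt0. Qed.

Lemma Y_bounds x : Xs a0 <= x <= Xs b0 -> yl <= Y x <= yh.
Proof.
move=> /andP[h1 h2]; rewrite /yl /yh ge_min le_max /Y !lerD2r.
have [al0|/ltW al0] := leP 0 al.
  by rewrite (ler_wpM2l al0 h1) (ler_wpM2l al0 h2) orbT.
by rewrite (ler_wnM2l al0 h1) (ler_wnM2l al0 h2) orbT.
Qed.

Lemma Y_gt0 x : Xs a0 <= x <= Xs b0 -> 0 < Y x.
Proof. by move=> /Y_bounds/andP[h _]; apply: lt_le_trans h; exact: yl_gt0. Qed.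

Let Mf := (yl ^+ 2)^-1.

Lemma f_bounds x : Xs a0 <= x <= Xs b0 -> (yh ^+ 2)^-1 <= f x <= Mf.
Proof.
move=> xI; have /andP[h1 h2] := Y_bounds xI; have y0 := Y_gt0 xI; have l0 := yl_gt0.
have h0 : 0 < yh by apply: lt_le_trans h2.
by rewrite !lef_pV2 ?posrE ?exprn_gt0 // !lerXn2r ?nnegrE // ltW.
Qed.

Lemma inv_cube_le x y : Xs a0 <= x <= Xs b0 -> Xs a0 <= y <= Xs b0 ->
  (Y x ^+ 2 * Y y)^-1 <= (yl ^+ 3)^-1.
Proof.
move=> xI yI; have l0 := yl_gt0.
have /andP[hx _] := Y_bounds xI; have /andP[hy _] := Y_bounds yI.
rewrite lef_pV2 ?posrE ?mulr_gt0 ?exprn_gt0 ?Y_gt0 // exprSr.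
by apply: ler_pM; rewrite ?sqr_ge0 ?(ltW l0) // lerXn2r // nnegrE ltW ?Y_gt0.
Qed.

Lemma f_lipschitz x y : Xs a0 <= x <= Xs b0 -> Xs a0 <= y <= Xs b0 ->
  `|f x - f y| <= 2 * `|al| / yl ^+ 3 * `|x - y|.
Proof.
move=> xI yI; have x0 := Y_gt0 xI; have y0 := Y_gt0 yI.
have -> : f x - f y = (y - x) * (al * ((Y x * Y y ^+ 2)^-1 + (Y x ^+ 2 * Y y)^-1)).
  by rewrite /f /Y; field; rewrite -/(Y x) -/(Y y) !lt0r_neq0.
rewrite normrM distrC mulrC ler_wpM2r // normrM [2 * `|al|]mulrC -[X in _ <= X]mulrA ler_wpM2l //.
have h1 := inv_cube_le yI xI; rewrite mulrC in h1; have h2 := inv_cube_le xI yI.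
rewrite ger0_norm; first by rewrite mulr_natl mulr2n lerD.
by rewrite addr_ge0 // invr_ge0 mulr_ge0 ?sqr_ge0 // ltW.
Qed.

Lemma S_taylor x y : Xs a0 <= x -> x <= y -> y <= Xs b0 ->
  `|S y / 2 - S x / 2 - (y - x) * f x| <= 2 * `|al| / yl ^+ 3 * (y - x) ^+ 2.
Proof.
move=> ax xy yb; have xI : Xs a0 <= x <= Xs b0 by rewrite ax (le_trans xy).
have yI : Xs a0 <= y <= Xs b0 by rewrite yb (le_trans ax).
have x0 := Y_gt0 xI; have y0 := Y_gt0 yI.
have -> : S y / 2 - S x / 2 - (y - x) * f x = (y - x) ^+ 2 * (- al * (Y x ^+ 2 * Y y)^-1).
  rewrite -mulrBl S_diff ?lt0r_neq0 // /f /Y; field.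
  by rewrite -/(Y x) -/(Y y) !lt0r_neq0.
have l0 := yl_gt0; rewrite normrM ger0_norm ?sqr_ge0 // mulrC ler_wpM2r ?sqr_ge0 // normrM normrN.
rewrite [2 * `|al|]mulrC -[X in _ <= X]mulrA ler_wpM2l //.
have h2 := inv_cube_le xI yI.
rewrite ger0_norm; last by rewrite invr_ge0 mulr_ge0 ?sqr_ge0 // ltW.
by apply: (le_trans h2); rewrite ler_peMl ?ler1n // invr_ge0 exprn_ge0 // ltW.
Qed.

Lemma psum_limit e c d : 0 < e -> a0 <= c -> c <= d -> d <= b0 -> exists2 E0 : R, 0 < E0 &
  forall eps N, 0 < eps -> eps <= E0 -> 2 / eps * (Mf + 1) <= N%:R ^+ 2 ->
  `|2 * eps * psum (Xs c) (Xs d) f N (2 / eps) - 3 / pi * (d - c)| <= e.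
Proof.
move=> e0 ac cd db; have cI : a0 <= c <= b0 by rewrite ac (le_trans cd).
have dI : a0 <= d <= b0 by rewrite db (le_trans ac).
have w0 : 0 <= Xs d - Xs c by rewrite subr_ge0 Xs_le.
pose e' := e / (4 * (Xs d - Xs c) + 1).
have k0 : 0 < 4 * (Xs d - Xs c) + 1 by apply: ltr_wpDl; rewrite ?mulr_ge0.
have e'0 : 0 < e' by rewrite divr_gt0.
have l0 := yl_gt0.
have h0 : 0 < yh by apply: lt_le_trans l0 _; rewrite /yl /yh ge_min le_max lexx.
have m0 : 0 < (yh ^+ 2)^-1 by rewrite invr_gt0 exprn_gt0.
have K0 : 0 <= 2 * `|al| / yl ^+ 3 by rewrite divr_ge0 ?mulr_ge0 ?exprn_ge0 // ltW.
have [|||X0 h] := @psum_asymp R (Xs a0) (Xs b0) _ Mf _ f (fun x => S x / 2) m0 K0 f_bounds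
  f_lipschitz S_taylor e' (Xs c) (Xs d) e'0; rewrite ?Xs_le //.
pose X1 := Num.max X0 1; have X10 : 0 < X1 by rewrite lt_max ltr01 orbT.
exists (2 / X1) => [|eps N eps0 epsE hN]; first by rewrite divr_gt0.
have hX : X0 <= 2 / eps.
  apply: (@le_trans _ _ X1); first by rewrite le_max lexx.
  by rewrite ler_pdivlMr // mulrC -ler_pdivlMr.
have := h (2 / eps) N hX hN; rewrite !S_Xs //.
set p := psum _ _ _ _ _ => hp.
have -> : 2 * eps * p - 3 / pi * (d - c) = 2 * eps * (p - kappa * (d / 2 - c / 2) * (2 / eps)).
  by rewrite /kappa; have := lt0r_neq0 (pi_gt0 R); move: (pi : R) => z zn; field; rewrite lt0r_neq0 ?zn.
rewrite normrM gtr0_norm ?mulr_gt0 //.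
apply: (@le_trans _ _ (2 * eps * (e' * (Xs d - Xs c) * (2 / eps)))); first by rewrite ler_pM2l ?mulr_gt0.
have -> : 2 * eps * (e' * (Xs d - Xs c) * (2 / eps)) = e' * (4 * (Xs d - Xs c)).
  by field; rewrite lt0r_neq0.
by rewrite /e' mulrAC ler_pdivrMr // ler_pM2l // lerDl.
Qed.

Let T eps (k : nat) (p : int) : set R :=
  [set s | (al * p%:~R + be * k%:Z%:~R) ^+ 2 * eps ^+ 2 +
    ((al * p%:~R + be * k%:Z%:~R) * s - (ga * p%:~R + de * k%:Z%:~R)) ^+ 2 < 2 * eps].

Let hw eps (k : nat) (p : int) : R := eps * Num.sqrt (2 / eps * f (p%:~R / k%:R) / k%:R ^+ 2 - 1).

(** For a line the slice is exactly an interval; if the disk is not reached, the root is 0 and the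
    open interval is empty. *)
Lemma T_itv eps k p : 0 < eps -> (0 < k)%N -> Y (p%:~R / k%:R) != 0 ->
  T eps k p = `]S (p%:~R / k%:R) - hw eps k p, S (p%:~R / k%:R) + hw eps k p[%classic.
Proof.
move=> e0 k0 yn; have kn : k%:R != 0 :> R by rewrite pnatr_eq0 -lt0n.
set x := p%:~R / k%:R in yn *.
have LE : al * p%:~R + be * k%:Z%:~R = k%:R * Y x by rewrite /Y /x -pmulrn; field.
have ME : ga * p%:~R + de * k%:Z%:~R = k%:R * Y x * S x.
  by rewrite /S -pmulrn -mulrA [Y x * _]mulrC divfK // /x; field.
have Ln : 0 < (k%:R * Y x) ^+ 2 by rewrite exprn_even_gt0 //= mulf_neq0.
have key s : T eps k p s <-> (s - S x) ^+ 2 < eps ^+ 2 * (2 / eps * f x / k%:R ^+ 2 - 1).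
  rewrite /T /= LE ME -[(s - S x) ^+ 2 < _](ltr_pM2l Ln).
  have -> : (k%:R * Y x) ^+ 2 * (eps ^+ 2 * (2 / eps * f x / k%:R ^+ 2 - 1)) =
     2 * eps - (k%:R * Y x) ^+ 2 * eps ^+ 2 by rewrite /f; field; rewrite kn yn lt0r_neq0.
  have -> : (k%:R * Y x) ^+ 2 * (s - S x) ^+ 2 = (k%:R * Y x * s - k%:R * Y x * S x) ^+ 2 by ring.
  by rewrite ltrBrDl.
have hE s : `|s - S x| < hw eps k p <-> (s - S x) ^+ 2 < eps ^+ 2 * (2 / eps * f x / k%:R ^+ 2 - 1).
  rewrite /hw -/x; set D := _ - 1; have [D0|D0] := leP 0 D.
    have h0 : 0 <= eps * Num.sqrt D by rewrite mulr_ge0 ?sqrtr_ge0 // ltW.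
    rewrite -[D in eps ^+ 2 * D]sqr_sqrtr // -exprMn -real_normK ?num_real //.
    by rewrite ltr_pXn2r ?nnegrE.
  rewrite ler0_sqrtr ?(ltW D0) // mulr0; split => [|h]; first by rewrite normr_lt0.
  by have := le_lt_trans (sqr_ge0 _) h; rewrite pmulr_rgt0 ?exprn_gt0 // ltNge (ltW D0).
apply/seteqP; split=> s.
  by move=> /key/hE; rewrite /= in_itv /= ltr_distl.
by rewrite /= in_itv /= => h; apply/key/hE; rewrite ltr_distl.
Qed.

Lemma fracs_range c d k p : a0 <= c <= b0 -> a0 <= d <= b0 -> (0 < k)%N ->
  fracs (Xs c) (Xs d) k p -> Xs a0 <= p%:~R / k%:R <= Xs b0.
Proof.
move=> /[dup] cI /andP[? _] /[dup] dI /andP[_ ?] k0 /(fracs_frac k0)/andP[h1 h2].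
rewrite (@le_trans _ _ (Xs c)) ?Xs_le //; last exact: ltW.
by rewrite (le_trans h2) // Xs_le.
Qed.

Lemma ford_family_measure eps c d N : 0 < eps -> a0 <= c -> c <= d -> d <= b0 ->
  measurable (family (Xs c) (Xs d) (T eps) N) /\
  mu (family (Xs c) (Xs d) (T eps) N) = (2 * eps * psum (Xs c) (Xs d) f N (2 / eps))%:E.
Proof.
move=> e0 ac cd db; have cI : a0 <= c <= b0 by rewrite ac (le_trans cd).
have dI : a0 <= d <= b0 by rewrite db (le_trans ac).
have xI k p := @fracs_range c d k p cI dI.
have Tm k p : (0 < k)%N -> fracs (Xs c) (Xs d) k p ->
    measurable (T eps k p) /\ mu (T eps k p) = (2 * hw eps k p)%:E.
  move=> k0 pf; rewrite T_itv //; last by rewrite lt0r_neq0 // Y_gt0 // xI.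
  split; first exact: measurable_itv.
  have h0 : 0 <= hw eps k p by rewrite mulr_ge0 ?sqrtr_ge0 // ltW.
  rewrite lebesgue_measure_itv /= lte_fin; case: ifPn => [_|].
    by rewrite -EFinB; congr EFin; ring.
  rewrite -leNgt => h; have -> : hw eps k p = 0 by apply/eqP; rewrite eq_le h0 andbT; lra.
  by rewrite mulr0.
have Td k p k' p' t : (0 < k)%N -> (0 < k')%N -> fracs (Xs c) (Xs d) k p ->
    fracs (Xs c) (Xs d) k' p' -> T eps k p t -> T eps k' p' t -> k = k' /\ p = p'.
  move=> k0 k0' [_ cp] [_ cp'] h1 h2; apply: coprime_frac_inj => //.
  apply: contrapT => ne; have := ford_disjoint e0 h1 h2.
  rewrite ltNge => /negP; apply; apply: det_sqr_ge => //.
  by rewrite det; ring.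
have [mf ef] := family_measure Tm Td N; split => //; rewrite ef; congr EFin.
rewrite /psum mulr_sumr; apply: eq_bigr => k _; rewrite mulr_fsumr; apply: eq_fsbigr => p _.
by rewrite /hw mulrA.
Qed.

Lemma ford_lower eps c d N : 0 < eps -> a0 <= c -> c <= d -> d <= b0 ->
  family (Xs c) (Xs d) (T eps) N `<=`
  ford al be ga de eps `&` `[c - Num.sqrt (2 * eps * Mf), d + Num.sqrt (2 * eps * Mf)]%classic.
Proof.
move=> e0 ac cd db s [k [p [/andP[k0 _] pf Ts]]].
have cI : a0 <= c <= b0 by rewrite ac (le_trans cd).
have dI : a0 <= d <= b0 by rewrite db (le_trans ac).
split; first by exists p, k%:Z; split => //; case: pf.
have /andP[h1 h2] := fracs_frac k0 pf.
have xI := fracs_range cI dI k0 pf.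
have y0 := Y_gt0 xI.
have s1 : c < S (p%:~R / k%:R) by rewrite -[c]S_Xs // S_lt // Y_Xs_gt0.
have s2 : S (p%:~R / k%:R) <= d by rewrite -[d]S_Xs // S_le // Y_Xs_gt0.
have hM : hw eps k p <= Num.sqrt (2 * eps * Mf).
  have /andP[_ fM] := f_bounds xI.
  have f0 : 0 <= f (p%:~R / k%:R) by rewrite invr_ge0 sqr_ge0.
  have -> : hw eps k p = Num.sqrt (eps ^+ 2 * (2 / eps * f (p%:~R / k%:R) / k%:R ^+ 2 - 1)).
    by rewrite sqrtrM ?sqr_ge0 // sqrtr_sqr gtr0_norm.
  apply: ler_wsqrtr.
  have -> : eps ^+ 2 * (2 / eps * f (p%:~R / k%:R) / k%:R ^+ 2 - 1) =
     2 * eps * (f (p%:~R / k%:R) / k%:R ^+ 2) - eps ^+ 2.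
    by field; rewrite pnatr_eq0 -lt0n k0 lt0r_neq0.
  apply: (@le_trans _ _ (2 * eps * (f (p%:~R / k%:R) / k%:R ^+ 2))).
    by rewrite gerBl sqr_ge0.
  rewrite ler_pM2l ?mulr_gt0 //; apply: le_trans fM.
  by rewrite ler_pdivrMr ?exprn_gt0 ?ltr0n // ler_peMr // exprn_ege1 // ler1n.
move: Ts; rewrite T_itv ?lt0r_neq0 // /= !in_itv /= => /andP[t1 t2].
by apply/andP; split; lra.
Qed.

(** Two fixed disks with contact points in (a0, a) and (b, b0) act as barriers. If L t - M had the
    same sign at both, its square would be at least 4 / L1^2 or 4 / L2^2 there, hence at least 2 eps
    in between, so the disk would miss [a, b]. Thus its contact point lies between the barriers. *)
Lemma ford_upper a b : a0 < a -> a < b -> b < b0 -> exists2 E0 : R, 0 < E0 &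
  forall eps N, 0 < eps -> eps <= E0 -> 2 / eps * (Mf + 1) <= N%:R ^+ 2 ->
  `[a, b]%classic `&` ford al be ga de eps `<=` family (Xs a0) (Xs b0) (T eps) N.
Proof.
move=> a0a ab bb0.
have det4 : (be * ga - al * de) ^+ 2 = 4 by rewrite det; ring.
have detn : be * ga - al * de != 0 by rewrite det.
have [p1 [k1 [_ L1n /andP[t1a t1b]]]] := tangency_dense detn a0a.
have [p2 [k2 [_ L2n /andP[t2a t2b]]]] := tangency_dense detn bb0.
set L1 := al * _ + _ in L1n t1a t1b; set L2 := al * _ + _ in L2n t2a t2b.
set M1 := ga * _ + _ in t1a t1b; set M2 := ga * _ + _ in t2a t2b.
have L10 : 0 < L1 ^+ 2 by rewrite exprn_even_gt0 //=.
have L20 : 0 < L2 ^+ 2 by rewrite exprn_even_gt0 //=.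
exists (2 / (L1 ^+ 2 + L2 ^+ 2)) => [|eps N e0 eE hN]; first by rewrite divr_gt0 // addr_gt0.
move=> s [/= sI [a' [b' [cop hs]]]].
wlog b'0 : a' b' cop hs / 0 <= b'.
  move=> h; have [b'p|b'n] := leP 0 b'; first exact: (h a' b').
  apply: (h (- a') (- b')); rewrite ?abszN ?oppr_ge0 ?(ltW b'n) //.
  by apply: (etrans _ hs); congr (_ < _); rewrite !rmorphN /=; ring.
move: sI; rewrite in_itv /= => /andP[sa sb].
set L := al * a'%:~R + _ in hs; set M := ga * a'%:~R + _ in hs.
have small : (L * s - M) ^+ 2 < 2 * eps by apply: le_lt_trans hs; rewrite lerDr mulr_ge0 ?sqr_ge0.
have blk Li Mi (pi ki : int) : Li = al * pi%:~R + be * ki%:~R -> Mi = ga * pi%:~R + de * ki%:~R ->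
    Li != 0 -> Li ^+ 2 <= L1 ^+ 2 + L2 ^+ 2 -> L * (Mi / Li) - M != 0 -> 2 * eps <= (L * (Mi / Li) - M) ^+ 2.
  move=> LiE MiE Lin Lile ne.
  have Li0 : 0 < Li ^+ 2 by rewrite exprn_even_gt0 //=.
  have E : (L * (Mi / Li) - M) ^+ 2 = (L * Mi - Li * M) ^+ 2 / Li ^+ 2 by field.
  rewrite E ler_pdivlMr //; apply: (@le_trans _ _ 4).
    have : eps * (L1 ^+ 2 + L2 ^+ 2) <= 2 by rewrite -ler_pdivlMr // addr_gt0.
    have : eps * Li ^+ 2 <= eps * (L1 ^+ 2 + L2 ^+ 2) by rewrite ler_pM2l.
    by lra.
  rewrite LiE MiE; apply: (@det_sqr_ge al be ga de a' b' pi ki) => //.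
  move=> z; move/eqP: ne; apply; apply/eqP; rewrite -sqrf_eq0 E LiE MiE.
  have -> : (L * (ga * pi%:~R + de * ki%:~R) - (al * pi%:~R + be * ki%:~R) * M) =
     (al * de - be * ga) * (a' * ki - b' * pi)%:~R.
    by rewrite /L /M rmorphB !rmorphM /=; ring.
  by rewrite z mulr0 expr0n mul0r.
have sgn : (L * (M1 / L1) - M) * (L * (M2 / L2) - M) <= 0.
  rewrite leNgt; apply/negP => pp; move: small; apply/negP; rewrite -leNgt.
  have n1 : L * (M1 / L1) - M != 0 by apply/eqP => z; move: pp; rewrite z mul0r ltxx.
  have n2 : L * (M2 / L2) - M != 0 by apply/eqP => z; move: pp; rewrite z mulr0 ltxx.
  apply: (affine_sqr_ge _ pp).
  - by apply/andP; split; lra.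
  - by apply: (blk L1 M1 p1 k1) => //; rewrite lerDl ltW.
  - by apply: (blk L2 M2 p2 k2) => //; rewrite lerDr ltW.
have Ln : L != 0.
  apply/eqP => L0; move: sgn; rewrite L0 !mul0r sub0r mulrNN -expr2 => M0.
  have {}M0 : M = 0 by apply/eqP; rewrite -sqrf_eq0 eq_le M0 sqr_ge0.
  have aE : 2 * a'%:~R = be * M - de * L by rewrite -det /L /M; ring.
  have bE : 2 * b'%:~R = ga * L - al * M by rewrite -det /L /M; ring.
  move: aE bE; rewrite L0 M0 !mulr0 subrr => /eqP + /eqP.
  rewrite !mulf_eq0 !pnatr_eq0 /= !intr_eq0 => /eqP a'z /eqP b'z.
  by move: cop; rewrite b'z a'z.
have tI : a0 < M / L < b0.
  have E : (L * (M1 / L1) - M) * (L * (M2 / L2) - M) = L ^+ 2 * ((M1 / L1 - M / L) * (M2 / L2 - M / L)).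
    by field; rewrite Ln L1n L2n.
  move: sgn; rewrite E pmulr_rle0; last by rewrite exprn_even_gt0 //=.
  move=> h; apply/andP; split; rewrite ltNge; apply/negP => h'.
    by move: h; rewrite leNgt mulr_gt0 // subr_gt0; lra.
  by move: h; rewrite leNgt nmulr_rgt0 subr_lt0; lra.
have b'n : b' != 0.
  apply/eqP => z; have : 0 < ga - al * (M / L) by apply: pos; move: tI => /andP[/ltW -> /ltW ->].
  rewrite /L /M z !mulr0 !addr0; have aln : al * a'%:~R != 0 by move: Ln; rewrite /L z mulr0 addr0.
  have -> : ga - al * (ga * a'%:~R / (al * a'%:~R)) = 0.
    by move: aln; rewrite mulf_eq0 negb_or => /andP[h1 h2]; field; rewrite h1 h2.
  by rewrite ltxx.
have [k kE] : exists k : nat, b' = k%:Z by exists `|b'|%N; rewrite gez0_abs.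
have k0 : (0 < k)%N by rewrite lt0n; move: b'n; rewrite kE eqz_nat.
have kn : k%:R != 0 :> R by rewrite pnatr_eq0 -lt0n.
set x := a'%:~R / k%:R : R.
have LE : L = k%:R * Y x by rewrite /L kE /Y /x -pmulrn; field.
have ME : M = k%:R * (ga * x + de) by rewrite /M kE /x -pmulrn; field.
have Yn : Y x != 0 by move: Ln; rewrite LE mulf_eq0 negb_or => /andP[].
have SE : S x = M / L by rewrite LE ME -mulf_div divff // mul1r.
have Y0 : 0 < Y x by apply: Y_of_S => //; rewrite SE; move: tI => /andP[/ltW -> /ltW ->].
have xI : Xs a0 < x < Xs b0.
  rewrite -(S_lt (Y_Xs_gt0 a0I) Y0) -(S_lt Y0 (Y_Xs_gt0 b0I)).
  by rewrite (S_Xs a0I) (S_Xs b0I) SE.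
have Tk : T eps k a' s by rewrite /T /=; move: hs; rewrite /L /M kE.
exists k, a'; split => //; last first.
  split; last by move: cop; rewrite kE.
  move: xI; rewrite /ints /= => /andP[h1 h2].
  by rewrite -ltr_pdivlMr ?ltr0n // -ler_pdivrMr ?ltr0n // h1 ltW.
rewrite k0 ltnNge; apply/negP => Nk.
have e1 : 2 / eps * f x / k%:R ^+ 2 <= 1.
  have /andP[_ fM] : (yh ^+ 2)^-1 <= f x <= Mf.
    by apply: f_bounds; move: xI => /andP[/ltW -> /ltW ->].
  rewrite ler_pdivrMr ?exprn_gt0 ?ltr0n // mul1r.
  apply: (@le_trans _ _ (N%:R ^+ 2)); last by rewrite lerXn2r ?nnegrE ?ler0n // ler_nat.
  apply: le_trans hN; rewrite ler_pM2l ?divr_gt0 //; apply: (le_trans fM).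
  by rewrite lerDl.
move: Tk; rewrite T_itv // /= in_itv /= /hw -/x ler0_sqrtr ?subr_le0 // mulr0 addr0 subr0.
by move=> /andP[u1 u2]; have := lt_trans u1 u2; rewrite ltxx.
Qed.

Lemma ford_squeeze a b c d e : a0 < a -> a < c -> c < d -> d < b -> b < b0 -> 0 < e ->
  exists2 E0 : R, 0 < E0 & forall eps, 0 < eps -> eps <= E0 ->
  exists m : R, [/\ mu (`[a, b]%classic `&` ford al be ga de eps) = m%:E,
    3 / pi * (d - c) - e <= m & m <= 3 / pi * (b0 - a0) + e].
Proof.
move=> a0a ac cd db bb0 e0.
have a0c : a0 <= c by lra.
have db0 : d <= b0 by lra.
have ab : a < b by lra.
have [E1 E10 h1] := psum_limit e0 a0c (ltW cd) db0.
have [E2 E20 h2] := psum_limit e0 (lexx a0) (ltW ab0) (lexx b0).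
have [E3 E30 h3] := ford_upper a0a ab bb0.
have M0 : 0 < Mf by rewrite invr_gt0 exprn_gt0 // yl_gt0.
pose h := Num.min (c - a) (b - d); have hp : 0 < h by rewrite lt_min !subr_gt0 ac.
pose E4 := h ^+ 2 / (2 * Mf).
have E40 : 0 < E4 by rewrite divr_gt0 ?exprn_gt0 // mulr_gt0.
exists (Num.min (Num.min E1 E2) (Num.min E3 E4)) => [|eps eps0]; first by rewrite !lt_min E10 E20 E30.
rewrite !le_min => /andP[/andP[e1 e2] /andP[e3 e4]].
pose N := cut (2 / eps * (Mf + 1)); have hN : 2 / eps * (Mf + 1) <= N%:R ^+ 2 := cut_sqr _.
have {}h1 := h1 _ _ eps0 e1 hN; have {}h2 := h2 _ _ eps0 e2 hN; have {}h3 := h3 _ _ eps0 e3 hN.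
have [mlo elo] := ford_family_measure N eps0 a0c (ltW cd) db0.
have [mup eup] := ford_family_measure N eps0 (lexx a0) (ltW ab0) (lexx b0).
set S0 := _ `&` _.
have SE : S0 = `[a, b]%classic `&` family (Xs a0) (Xs b0) (T eps) N.
  apply/seteqP; split=> s [s1 s2]; split => //; first exact: h3.
  by have [] := ford_lower eps0 (lexx a0) (ltW ab0) (lexx b0) s2.
have mS : measurable S0 by rewrite SE; apply: measurableI => //; exact: measurable_itv.
have lo : (mu (family (Xs c) (Xs d) (T eps) N) <= mu S0)%E.
  apply: le_measure; rewrite ?inE // => s fs.
  have [fo] := ford_lower eps0 a0c (ltW cd) db0 fs; rewrite /= !in_itv /= => /andP[s1 s2].
  split => //; rewrite /= in_itv /=.
  have : Num.sqrt (2 * eps * Mf) <= h.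
    rewrite -[h]gtr0_norm // -sqrtr_sqr; apply: ler_wsqrtr.
    by rewrite mulrAC mulrC -ler_pdivlMr // mulr_gt0.
  by rewrite le_min => /andP[k1 k2]; apply/andP; split; lra.
have up : (mu S0 <= mu (family (Xs a0) (Xs b0) (T eps) N))%E.
  by apply: le_measure; rewrite ?inE // SE => s [].
rewrite elo in lo; rewrite eup in up.
have [m mE] : exists m : R, mu S0 = m%:E.
  exists (fine (mu S0)); rewrite fineK // ge0_fin_numE //.
  by apply: le_lt_trans up _; rewrite ltry.
rewrite mE !lee_fin in lo up; exists m; split => //.
  by move/ler_normlP: h1 => [k1 k2]; lra.
by move/ler_normlP: h2 => [k1 k2]; lra.
Qed.

End RegularInterval.

(** Take as first basis vector a disk touching the line beyond b + 1, with L > 0: the new ga - al s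
    = L (t - s), with t its contact point, is positive on the interval. The sign of the second
    vector makes the determinant 2. *)
Lemma ford_limit (al be ga de a b e : R) : (be * ga - al * de) ^+ 2 = 4 -> a < b -> 0 < e ->
  exists2 E0 : R, 0 < E0 & forall eps, 0 < eps -> eps <= E0 ->
  exists2 m : R, mu (`[a, b]%classic `&` ford al be ga de eps) = m%:E &
    `|3 / pi * (b - a) - m| <= e.
Proof.
move=> det4 ab e0.
have detn : be * ga - al * de != 0 by apply/eqP => z; move: det4; rewrite z expr0n /=; lra.
(* Shrinking or enlarging the interval by eta on both sides costs at most 2 * (3 / 2) * (e / 6) = e
   / 2, as 3 / pi <= 3 / 2. *)
pose eta := Num.min (Num.min ((b - a) / 3) 1) (e / 6).
have eta0 : 0 < eta by rewrite !lt_min ltr01 !divr_gt0 ?subr_gt0.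
have [eta1 eta2 eta3] : [/\ eta <= (b - a) / 3, eta <= 1 & eta <= e / 6].
  by rewrite /eta; split; rewrite !ge_min lexx ?orbT.
have b12 : b + 1 < b + 2 by lra.
have [p [q [cop Ln /andP[t1 t2]]]] := tangency_dense detn b12.
have {cop Ln t1 t2 b12} [p' [q' [cop L0 t1]]] : exists p q : int, [/\ coprime `|p| `|q|,
    0 < al * p%:~R + be * q%:~R &
    b + 1 < (ga * p%:~R + de * q%:~R) / (al * p%:~R + be * q%:~R)].
  have [L0|L0] := ltP 0 (al * p%:~R + be * q%:~R); first by exists p, q.
  have LE : al * (- p)%:~R + be * (- q)%:~R = - (al * p%:~R + be * q%:~R) by rewrite !rmorphN /=; ring.
  have ME : ga * (- p)%:~R + de * (- q)%:~R = - (ga * p%:~R + de * q%:~R) by rewrite !rmorphN /=; ring.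
  exists (- p), (- q); rewrite !abszN LE ME invrN mulrNN; split => //.
  by rewrite oppr_gt0 lt_neqAle Ln.
have [r [t [u det2]]] : exists r t : int, unimod p' q' r t /\
    (al * r%:~R + be * t%:~R) * (ga * p'%:~R + de * q'%:~R)
    - (al * p'%:~R + be * q'%:~R) * (ga * r%:~R + de * t%:~R) = 2.
  have [r [t u]] := coprime_unimod cop.
  pose x := (al * r%:~R + be * t%:~R) * (ga * p'%:~R + de * q'%:~R)
    - (al * p'%:~R + be * q'%:~R) * (ga * r%:~R + de * t%:~R).
  have x2 : x ^+ 2 = 2 ^+ 2.
    have -> : x ^+ 2 = (be * ga - al * de) ^+ 2 * ((p' * t - q' * r) ^+ 2)%:~R.
      by rewrite /x rmorphXn rmorphB !rmorphM /=; ring.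
    by move: u; rewrite /unimod => /eqP ->; rewrite det4 mulr1; ring.
  have /orP[/eqP xE|/eqP xE] : (x == 2) || (x == -2) by rewrite -eqf_sqr x2.
    by exists r, t.
  exists (- r), (- t); split; first by move: u; rewrite /unimod => /eqP <-; apply/eqP; ring.
  by rewrite -[RHS]opprK -xE /x !rmorphN /=; ring.
have a0b0 : a - eta < b + eta by lra.
have pos s : a - eta <= s <= b + eta ->
    0 < ga * p'%:~R + de * q'%:~R - (al * p'%:~R + be * q'%:~R) * s.
  move=> /andP[_ sb]; rewrite subr_gt0 mulrC -ltr_pdivlMr //; lra.
have [E0 E00 h] := @ford_squeeze _ _ _ _ _ _ det2 a0b0 pos a b (a + eta) (b - eta) (e / 2)
  ltac:(lra) ltac:(lra) ltac:(lra) ltac:(lra) ltac:(lra) ltac:(lra).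
exists E0 => // eps eps0 /(h eps eps0)[m []]; rewrite ford_unimod // => mE lo up.
exists m => //.
have p0 := pi_gt0 R; have p2 := pi_ge2 R.
have k1 : 3 / pi <= 3 / 2 :> R by rewrite ler_pM2l // lef_pV2 ?posrE //.
have k2 : 0 < 3 / pi :> R by rewrite divr_gt0.
move: (3 / pi : R) k1 k2 lo up => k k1 k2 lo up.
have k3 : k * eta <= 3 / 2 * (e / 6) by apply: ler_pM => //; rewrite ltW.
by apply/ler_normlP; split; lra.
Qed.

End Ford.

(** * The limit along a line *)

Section LineLimit.
Context {R : realType}.

Lemma rank_one_form (F m k : R) : 0 <= F -> 0 <= k -> m ^+ 2 = F * k ->
  exists L M : R, [/\ F = L ^+ 2, m = L * M & k = M ^+ 2].
Proof.
move=> F0 k0 mm; have E : Num.sqrt F * Num.sqrt k = `|m| by rewrite -sqrtrM // -mm sqrtr_sqr.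
have [m0|m0] := leP 0 m.
  by exists (Num.sqrt F), (Num.sqrt k); rewrite !sqr_sqrtr // E ger0_norm.
by exists (Num.sqrt F), (- Num.sqrt k); rewrite sqrrN !sqr_sqrtr // mulrN E ltr0_norm // opprK.
Qed.

(** Each disk determines its pair (L, M) only up to sign, so the third pair is the first plus or
    minus the second. Cramer's rule expresses it, and e is the relative sign. *)
Lemma rank_one_combine (al ga be de P Q : R) : (al * de - be * ga) ^+ 2 = 4 ->
  (al * Q - P * ga) ^+ 2 = 4 -> (be * Q - P * de) ^+ 2 = 4 ->
  exists e : R, [/\ e ^+ 2 = 1, P ^+ 2 = (al + e * be) ^+ 2,
    P * Q = (al + e * be) * (ga + e * de) & Q ^+ 2 = (ga + e * de) ^+ 2].
Proof.
set D := al * de - be * ga; set U := al * Q - P * ga; set V := be * Q - P * de => d u v.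
have PE : P * D = be * U - al * V by rewrite /U /V /D; ring.
have QE : Q * D = de * U - ga * V by rewrite /U /V /D; ring.
exists (- (U * V) / 4).
have e2 : (- (U * V) / 4) ^+ 2 = 1.
  by transitivity ((U ^+ 2) * (V ^+ 2) / 16); [field | rewrite u v; field].
have n4 : (4 : R) != 0 by rewrite pnatr_eq0.
have gen (x y x' y' : R) : (y * U - x * V) * (y' * U - x' * V) =
   4 * ((x + - (U * V) / 4 * y) * (x' + - (U * V) / 4 * y')).
  transitivity (y * y' * U ^+ 2 + x * x' * V ^+ 2 - U * V * (x * y' + y * x')); first ring.
  transitivity (4 * (x * x' + - (U * V) / 4 * (x * y' + y * x') + (- (U * V) / 4) ^+ 2 * (y * y'))); last ring.
  by rewrite e2 u v; field.
split => //; apply: (mulfI n4); rewrite -{1}d.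
- by rewrite [X in _ = 4 * X]expr2 -gen -PE; ring.
- by rewrite -gen -PE -QE; ring.
- by rewrite [X in _ = 4 * X]expr2 -gen -QE; ring.
Qed.

Section OnLine.
Variables p v : R[i].
Hypothesis v1 : Normc.normc v = 1.

Let pt eps s : sphere R := Some (p + (0 +i* eps) * v + s%:C * v).

(** Coordinates on the orthogonal complement of the line: [va n], m and the value at p are the
    coefficients of [fz n] in s, which has no term linear in eps. *)
Definition line_coords (n : @vec R) (m : R) :=
  [/\ vx n = va n * Re p + m * Re v, vy n = va n * Im p + m * Im v &
    vc n = fz n (Some p) + va n * (Re p ^+ 2 + Im p ^+ 2) +
      2 * m * (Re p * Re v + Im p * Im v)].

Lemma ortho_line_coords (n : @vec R) : dot n (linev p v) = 0 -> exists m,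
  (forall eps s, fz n (pt eps s) = va n * (s ^+ 2 + eps ^+ 2) - 2 * m * s + fz n (Some p)) /\
  line_coords n m.
Proof.
have := normc1 v1; rewrite /pt /line_coords; case: v p => c d [x y] /= cd; rewrite /dot /= => o.
case: n o => F X Z K /= o.
have o' : (Z - F * y) * c - (X - F * x) * d = 0 by lra.
pose m := (X - F * x) * c + (Z - F * y) * d; exists m.
have XE : X = F * x + m * c.
  transitivity (F * x + (X - F * x) * (c ^+ 2 + d ^+ 2)); first by rewrite cd; ring.
  transitivity (F * x + m * c - ((Z - F * y) * c - (X - F * x) * d) * d); first by rewrite /m; ring.
  by rewrite o'; ring.
have ZE : Z = F * y + m * d.
  transitivity (F * y + (Z - F * y) * (c ^+ 2 + d ^+ 2)); first by rewrite cd; ring.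
  transitivity (F * y + m * d + ((Z - F * y) * c - (X - F * x) * d) * c); first by rewrite /m; ring.
  by rewrite o'; ring.
clearbody m; rewrite XE ZE; split; last by split => //; ring.
move=> eps s.
transitivity (F * (s ^+ 2 + eps ^+ 2) * (c ^+ 2 + d ^+ 2) - 2 * m * s * (c ^+ 2 + d ^+ 2) +
   (F * (x ^+ 2 + y ^+ 2) - 2 * ((F * x + m * c) * x + (F * y + m * d) * y) + K)); last by rewrite cd; ring.
ring.
Qed.

Lemma dot_ortho_line (n n' : @vec R) m m' :
  line_coords n m ->
  line_coords n' m' ->
  dot n n' = m * m' - (va n * fz n' (Some p) + va n' * fz n (Some p)) / 2.
Proof.
have := normc1 v1; rewrite /line_coords; move: (fz n (Some p)) (fz n' (Some p)) => k k'; case: v => c d.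
move=> /= cd [h1 h2 h3] [h1' h2' h3']; rewrite /dot h1 h2 h3 h1' h2' h3'.
move: (va n) (va n') => F F'.
transitivity (m * m' * (c ^+ 2 + d ^+ 2) - (F * k' + F' * k) / 2); last by rewrite cd; ring.
by field.
Qed.

Lemma null_ortho_line (n : @vec R) : dot n (linev p v) = 0 -> dot n n = 0 -> fut n ->
  exists L M : R, (forall eps s, fz n (pt eps s) = L ^+ 2 * eps ^+ 2 + (L * s - M) ^+ 2) /\
   [/\ va n = L ^+ 2, fz n (Some p) = M ^+ 2 & line_coords n (L * M)].
Proof.
move=> o nn fn; have [m [fE c]] := ortho_line_coords o.
have := dot_ortho_line c c; rewrite nn => h.
have [_ F0 _] := fn; have k0 := fut_ge0 (Some p) fn.
have [|L [M [FE mE kE]]] := @rank_one_form (va n) m (fz n (Some p)) F0 k0; first by lra.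
exists L, M; rewrite -mE; split; last by split.
by move=> eps s; rewrite fE FE kE mE; ring.
Qed.

Variable q : @quad R.
Hypotheses (dq : desc q) (q0E : q i0 = opp (linev p v)).
Hypothesis fq : forall v w, orbit q v -> orbit q w -> v <> w -> fut (v +v w).

(** For n = q i0 + fv a b, products are - 2 det^2 in the index pairs and - (L M' - L' M)^2 / 2 in
    the line coordinates. Three disks fix the quadratic dependence on (a, b), and [rank_one_combine]
    makes L and M linear in it. *)
Lemma line_ford : exists al be ga de : R, (be * ga - al * de) ^+ 2 = 4 /\
  forall eps s, (exists a b : int, coprime `|a| `|b| /\ Ns (fv q a b) (pt eps s)) <->
    ford al be ga de eps s.
Proof.
pose n (a b : int) := q i0 +v fv q a b.
have dn a b c d : dot (n a b) (n c d) = - 2 * ((a * d - b * c)%:~R) ^+ 2.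
  rewrite /n !dot_linl !dot_linr dot_fv // dot_fv0 // dotC dot_fv0 // dq eqxx; ring.
have on a b : dot (n a b) (linev p v) = 0.
  have : dot (n a b) (q i0) = 0 by rewrite dot_linl dot_fv0 // dq eqxx; ring.
  by rewrite q0E dot_oppr => /eqP; rewrite oppr_eq0 => /eqP.
have get a b : coprime `|a| `|b| -> _ := fun ab =>
  null_ortho_line (on a b) (fv_fut dq fq ab).2 (fv_fut dq fq ab).1.
have [al [ga [f1 [F1 k1 c1]]]] := get 1 0 isT.
have [be [de [f2 [F2 k2 c2]]]] := get 0 1 isT.
have [P [Q [f3 [F3 k3 c3]]]] := get 1 1 isT.
have h12 := dot_ortho_line c1 c2.
have h13 := dot_ortho_line c1 c3.
have h23 := dot_ortho_line c2 c3.
move: h12 h13 h23; rewrite !dn F1 F2 F3 k1 k2 k3 => h12 h13 h23.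
have d12 : (al * de - be * ga) ^+ 2 = 4.
  by move: h12; rewrite (_ : 1 * 1 - 0 * 0 = 1 :> int) // rmorph1; lra.
have d13 : (al * Q - P * ga) ^+ 2 = 4.
  by move: h13; rewrite (_ : 1 * 1 - 0 * 1 = 1 :> int) // rmorph1; lra.
have d23 : (be * Q - P * de) ^+ 2 = 4.
  by move: h23; rewrite mul0r mul1r sub0r mulrNz sqrrN expr1n; lra.
have [e [e2 PP PQ QQ]] := rank_one_combine d12 d13 d23.
exists al, (e * be), ga, (e * de); split.
  by transitivity (e ^+ 2 * (al * de - be * ga) ^+ 2); [ring | rewrite e2 d12 mul1r].
move=> eps s.
have key a b : Ns (fv q a b) (pt eps s) <->
  (al * a%:~R + e * be * b%:~R) ^+ 2 * eps ^+ 2 +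
    ((al * a%:~R + e * be * b%:~R) * s - (ga * a%:~R + e * de * b%:~R)) ^+ 2 < 2 * eps.
  have f0 : fz (q i0) (pt eps s) = 2 * eps.
    rewrite q0E fz_opp fz_linev //.
    have vn : v != 0.
      apply/eqP => z; move: v1; rewrite z /= expr0n /= addr0 sqrtr0 => /eqP.
      by rewrite eq_sym oner_eq0.
    have -> : (p + (0 +i* eps) * v + s%:C * v - p) / v = (s +i* eps).
      rewrite addrAC [p + _]addrC addrK -mulrDl mulfK //.
      by apply/eqP; rewrite eq_complex /= add0r addr0 !eqxx.
    by rewrite /=; ring.
  have fE : fz (fv q a b) (pt eps s) + 2 * eps =
     a%:~R ^+ 2 * fz (n 1 0) (pt eps s) + a%:~R * b%:~R * (fz (n 1 1) (pt eps s)
       - fz (n 1 0) (pt eps s) - fz (n 0 1) (pt eps s)) + b%:~R ^+ 2 * fz (n 0 1) (pt eps s).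
    rewrite -f0 /n fv10 fv01 fv11 !fz_lin /pt /fz /fv /comb.
    by move: (_ + _ : R[i]) => z; cbn [va vx vy vc]; ring.
  have gE : fz (fv q a b) (pt eps s) + 2 * eps = (al * a%:~R + e * be * b%:~R) ^+ 2 * eps ^+ 2 +
    ((al * a%:~R + e * be * b%:~R) * s - (ga * a%:~R + e * de * b%:~R)) ^+ 2.
    rewrite fE f1 f2 f3.
    have -> : P ^+ 2 * eps ^+ 2 + (P * s - Q) ^+ 2 = P ^+ 2 * (eps ^+ 2 + s ^+ 2) - 2 * (P * Q) * s + Q ^+ 2 by ring.
    rewrite PP PQ QQ.
    have -> : be ^+ 2 * eps ^+ 2 + (be * s - de) ^+ 2 = e ^+ 2 * (be ^+ 2 * eps ^+ 2 + (be * s - de) ^+ 2).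
      by rewrite e2 mul1r.
    ring.
  by rewrite -gE /Ns /= -[X in _ <-> (_ < X)]add0r ltrD2r.
by split=> -[a [b [ab h]]]; exists a, b; split => //; apply/key.
Qed.

Lemma line_limit (a b : R) : a < b ->
  segment_prob (p + (0 +i* eps) * v) v a b
    (primitive_disks q) @[eps --> 0^'+] --> ((3 / pi)%:E : \bar R).
Proof.
move=> ab; have [al [be [ga [de [det h]]]]] := line_ford.
have ba : 0 < b - a by rewrite subr_gt0.
apply: cvg_right_EFin => e e0.
have [E0 E00 lim] := ford_limit det ab (mulr_gt0 e0 ba).
near=> eps.
have eps0 : 0 < eps by near: eps; exact: nbhs_right_gt.
have epsE : eps <= E0 by near: eps; exact: nbhs_right_le.
have [m mE hm] := lim eps eps0 epsE.
exists ((b - a)^-1 * m).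
  rewrite /segment_prob EFinM -mE; congr (_ * lebesgue_measure _)%E.
  by apply/seteqP; split=> s [s1 s2]; split => //; apply/h.
have -> : 3 / pi - (b - a)^-1 * m = (3 / pi * (b - a) - m) / (b - a).
  by rewrite mulrBl mulfK ?lt0r_neq0 // [m / _]mulrC.
by rewrite normrM [`|(b - a)^-1|]gtr0_norm ?invr_gt0 // ler_pdivrMr.
Unshelve. all: by end_near.
Qed.

End OnLine.

End LineLimit.

Theorem theorem1 (R : realType) (P : set (set (sphere R))) (C0 : set (sphere R))
    (HP : apollonian_packing P) (HC0 : P C0) :
  [/\ (forall (z0 : R[i]) (r0 : R), 0 < r0 -> C0 = circle z0 r0 ->
         ~ is_outer_circle P z0 r0 ->
         circle_prob z0 (r0 + eps) (tangent_disks P C0) @[eps --> 0^'+]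
           --> ((3 / pi)%:E : \bar R)),
      (forall (z0 : R[i]) (r0 : R), 0 < r0 -> C0 = circle z0 r0 ->
         is_outer_circle P z0 r0 ->
         circle_prob z0 (r0 - eps) (tangent_disks P C0) @[eps --> 0^'+]
           --> ((3 / pi)%:E : \bar R))
    & (forall (p v : R[i]) (a b : R), Normc.normc v = 1 ->
         C0 = line p v -> lies_on_left P p v -> a < b ->
         segment_prob (p + (0 +i* eps) * v) v a b (tangent_disks P C0)
           @[eps --> 0^'+] --> ((3 / pi)%:E : \bar R))].
Proof.
have [q [dq PE fq C0E]] := packing_base HP HC0.
have q1 : dot (q i0) (q i0) = 1 by rewrite dq eqxx.
have [C1 [z1 [PC1 Cz1 far]]] := base_far dq PE fq.
rewrite C0E (tangent_disksE dq PE fq).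
(* Some circle has a point strictly on the positive side of [q i0]; this fixes its orientation in
   the outer and line cases. In the remaining case the wrong sign would make the circle outer. *)
have nonpos w : (forall C, P C -> C `<=` Zs w `|` Ns w) -> q i0 <> w.
  move=> h e; have := far; rewrite e; have [w0|w0] := h C1 PC1 z1 Cz1.
    by rewrite (w0 : fz w z1 = 0) ltxx.
  by rewrite ltNge ltW.
split.
- move=> z0 r0 r0p CE nout.
  have q0E : q i0 = circ z0 r0.
    have [//|e] := Zs_circ_inj r0p q1 (etrans CE (circleE z0 r0p)).
    exfalso; apply: nout => C PC z Cz; have := base_side PE fq PC Cz.
    rewrite e fz_opp oppr_ge0 circleE // diskE // le_eqVlt => /orP[/eqP|]; [by left | by right].
  case: z0 q0E {CE nout} => x0 y0 q0E.
  have := @circle_limit R q x0 y0 r0 1 dq r0p (or_introl erefl) _ fq; under eq_fun do rewrite mul1r.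
  by apply; rewrite q0E; apply: vecP; rewrite /= ?mul1r ?mul0r ?addr0.
- move=> z0 r0 r0p CE out.
  have q0E : q i0 = opp (circ z0 r0).
    have [e|//] := Zs_circ_inj r0p q1 (etrans CE (circleE z0 r0p)).
    by exfalso; apply: nonpos e => C PC; rewrite -circleE // -diskE //; exact: out.
  case: z0 q0E {CE out} => x0 y0 q0E.
  have := @circle_limit R q x0 y0 r0 (-1) dq r0p (or_intror erefl) _ fq; under eq_fun do rewrite mulN1r.
  by apply; rewrite q0E; apply: vecP; rewrite /= ?mulN1r ?mul0r ?addr0.
- move=> p v a b v1 CE left_ ab; apply: line_limit => //.
  have [e|//] := Zs_linev_inj v1 q1 (etrans CE (lineE p v1)).
  by exfalso; apply: nonpos e => C PC; rewrite -lineE // -left_halfE //; exact: left_.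
Qed.
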